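(* Let $n\ge1$, $1\le M\le n$, and let $\underline{s}\in\mathbb{R}^n$ with $s_i>\frac12$ for $i\neq M$ and $s_M>0$. The variance function $V(m)$, $m\in Q_G$, of the Wishart family $(\gamma^{(M)}_{\underline{s},y})_{y\in P_G}$ on $Q_G$ equals $$\sum_{i=1}^{M-1}(s_i-s_{i+1})\,\mathbb{P}\Bigl(\sum_{j=1}^{i-1}\bigl(\tfrac1{s_j}-\tfrac1{s_{j+1}}\bigr)M_{\{1:j\}}+\tfrac1{s_i}M_{\{1:i\}}\Bigr)$$ $$+\;s_M\,\mathbb{P}\Bigl(\tfrac{\hat m}{s_M}+\sum_{j=1}^{M-1}\bigl(\tfrac1{s_j}-\tfrac1{s_{j+1}}\bigr)M_{\{1:j\}}+\sum_{k=M+1}^{n}\bigl(\tfrac1{s_k}-\tfrac1{s_{k-1}}\bigr)M_{\{k:n\}}\Bigr)$$ $$+\sum_{i=M+1}^{n}(s_i-s_{i-1})\,\mathbb{P}\Bigl(\tfrac1{s_i}M_{\{i:n\}}+\sum_{j=i+1}^{n}\bigl(\tfrac1{s_j}-\tfrac1{s_{j-1}}\bigr)M_{\{j:n\}}\Bigr).$$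
   Context: $G=A_n$ is the path graph $1-2-\cdots-n$ on $V=\{1,\dots,n\}$; $E=\{(i,j): |i-j|\le 1\}$. $S_n$ is the space of real symmetric $n\times n$ matrices, $Z_G=\{y\in S_n:y_{ij}=0\text{ if }(i,j)\notin E\}$; $P_G$ is the set of positive definite $y\in Z_G$. $I_G$ is the dual space of $Z_G$, realised as the space of incomplete symmetric matrices $\eta=(\eta_{ij})_{(i,j)\in E}$, with $\langle y,\eta\rangle=\mathrm{tr}(y\eta)=\sum_{(i,j)\in E}y_{ij}\eta_{ij}$. $Q_G=\{\eta\in I_G:\langle y,\eta\rangle>0\ \forall y\in\overline{P_G}\setminus\{0\}\}$. $\pi:S_n\to I_G$ keeps the entries indexed by $E$. $d\eta$ is Lebesgue measure on $I_G$. For $I\subset V$, a subscript $I$ denotes the submatrix with rows and columns in $I$; $\{i:j\}=\{i,\dots,j\}$; $|\cdot|$ is the determinant. For a matrix $K$ indexed by $B\subset V$, $K^0$ is the $n\times n$ matrix with $(K^0)_{ij}=K_{ij}$ if $i,j\in B$ and $0$ otherwise. With $s_0=s_{n+1}=0$, for $\eta\in Q_G$, $$\delta^{(M)}_{\underline{s}}(\eta)=\frac{\prod_{i=1}^{M-1}|\eta_{\{i:i+1\}}|^{s_i}\prod_{i=M+1}^{n}|\eta_{\{i-1:i\}}|^{s_i}}{\prod_{i=2}^{M-1}\eta_{ii}^{s_{i-1}}\cdot\eta_{MM}^{s_{M-1}-s_M+s_{M+1}}\cdot\prod_{i=M+1}^{n-1}\eta_{ii}^{s_{i+1}}};$$ $\varphi_{A_1}(\eta)=\eta^{-1}$,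 and for $n\ge2$, $\varphi_{A_n}(\eta)=\prod_{i=1}^{n-1}|\eta_{\{i,i+1\}}|^{-3/2}\prod_{i=2}^{n-1}\eta_{ii}$. For $y\in P_G$, $\gamma^{(M)}_{\underline{s},y}$ is the probability measure on $Q_G$ with density proportional to $e^{-\mathrm{tr}(y\eta)}\delta^{(M)}_{\underline{s}}(\eta)\varphi_{A_n}(\eta)$ with respect to $d\eta$. Its mean function $m^{(M)}_{\underline{s}}(y)=\int\eta\,\gamma^{(M)}_{\underline{s},y}(d\eta)$ is a diffeomorphism $P_G\to Q_G$ with inverse $\psi^{(M)}_{\underline{s}}$. The covariance operator $v(y):Z_G\to I_G$ is defined by $\langle z',v(y)z\rangle=\mathrm{Cov}(\langle z,X\rangle,\langle z',X\rangle)$ for $X\sim\gamma^{(M)}_{\underline{s},y}$ (equivalently minus the differential of $m^{(M)}_{\underline{s}}$ at $y$), and the variance function is $V(m)=v(\psi^{(M)}_{\underline{s}}(m)):Z_G\to I_G$. For $m\in Q_G$, $\hat m$ is the unique positive definite matrix in $S_n$ with $\pi(\hat m)=m$ and $\hat m^{-1}\in P_G$. For $I\subset V$, $M_I=[((\hat m^{-1})_I)^{-1}]^0$. For $A\in S_n$, $\mathbb{P}(A):Z_G\to I_G$ is $\mathbb{P}(A)u=\pi(AuA)$. *)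

(* Defs.v *)
From HB Require Import structures.
From mathcomp Require Import all_boot all_order all_algebra.
From mathcomp Require Import all_classical all_reals all_analysis.
Import Order.TTheory GRing.Theory Num.Theory.
Import numFieldNormedType.Exports.

Set Implicit Arguments.
Unset Strict Implicit.
Unset Printing Implicit Defensive.

Local Open Scope classical_set_scope.
Local Open Scope ring_scope.

(* Conventions.  The vertex labelled k (1 <= k <= n) is the ordinal of 'I_n
   of value k.-1; intervals, diagonal entries and the parameters s_i are all
   addressed by these 1-based labels.  Incomplete matrices are represented by
   the symmetric matrices with 0 at the unspecified entries, so that <y, eta>
   is literally \tr (y *m eta).  Objects characterised by existence and
   uniqueness (hat m, the inverse of the mean function, the operator dual to
   the covariance form, the Wishart law) are obtained by choice; their junk
   values are used only where no such object exists. *)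

Section lebesgue_tuple.
Variable R : realType.
Local Notation RR := (measurableTypeR R).

(* Lebesgue measure on R^k is built as an iterated product; the library has no
   usable sigma-finite instance for the product of two sigma-finite measures,
   so sigma-finiteness is proved at each step. *)
Definition cons_pair k (p : RR * k.-tuple RR) : k.+1.-tuple RR :=
  [the k.+1.-tuple RR of p.1 :: p.2].

Lemma measurable_cons_pair k : measurable_fun [set: RR * k.-tuple RR]
  (@cons_pair k).
Proof. exact: measurable_cons measurable_fst measurable_snd. Qed.

Section step.
Variables (k : nat) (mu : {sigma_finite_measure set (k.-tuple RR) -> \bar R}).

Let leb : {sigma_finite_measure set RR -> \bar R} := @lebesgue_measure R.

Definition lebesgue_cons : set (k.+1.-tuple RR) -> \bar R :=
  pushforward (leb \x mu)%E (@cons_pair k).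

Let nu : {measure set (RR * k.-tuple RR) -> \bar R} :=
  (leb \x mu)%E.

Let lebesgue_cons0 : lebesgue_cons set0 = 0%E.
Proof. by rewrite /lebesgue_cons /pushforward preimage_set0 (measure0 nu). Qed.

Let lebesgue_cons_ge0 A : (0 <= lebesgue_cons A)%E.
Proof. exact: (measure_ge0 nu). Qed.

Let lebesgue_cons_sigma_additive : semi_sigma_additive lebesgue_cons.
Proof.
move=> F mF tF mUF; rewrite /lebesgue_cons /pushforward preimage_bigcup.
apply: (@measure_semi_sigma_additive _ _ _ nu).
- by move=> i; rewrite -[X in measurable X]setTI; exact: measurable_cons_pair.
- apply/trivIsetP => /= i j _ _ ij; rewrite -preimage_setI.
  by move/trivIsetP : tF => /(_ _ _ _ _ ij) ->//; rewrite preimage_set0.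
- by rewrite -preimage_bigcup -[X in measurable X]setTI;
     exact: measurable_cons_pair.
Qed.

HB.instance Definition _ := isMeasure.Build _ _ _ lebesgue_cons
  lebesgue_cons0 lebesgue_cons_ge0 lebesgue_cons_sigma_additive.

Let lebesgue_cons_sigma_finite : sigma_finite setT lebesgue_cons.
Proof.
have /sigma_finiteP[F [TF ndF mF]] := sigma_finiteT leb.
have /sigma_finiteP[G [TG ndG mG]] := sigma_finiteT mu.
pose split (t : k.+1.-tuple RR) : RR * k.-tuple RR :=
  (thead t, [tuple of behead t]).
have msplit : measurable_fun setT split.
  by apply/measurable_fun_pairP; split;
     [exact: measurable_tnth | exact: measurable_behead].
have splitK : cancel (@cons_pair k) split.
  by move=> [x t]; congr pair; exact: val_inj.
exists (fun i => split @^-1` (F i `*` G i)).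
  rewrite -preimage_bigcup -(preimage_setT split); congr preimage.
  rewrite -setXTT TF TG predeqE => -[x y]; split.
    move=> [/= [i _ Fx] [j _ Gy]]; exists (maxn i j) => //; split.
    - by move: x Fx; exact/subsetPset/ndF/leq_maxl.
    - by move: y Gy; exact/subsetPset/ndG/leq_maxr.
  by move=> [i _ []/= ? ?]; split; exists i.
move=> i; have [mFi Fioo] := mF i; have [mGi Gioo] := mG i; split.
  by rewrite -[X in measurable X]setTI; apply: msplit => //;
     exact: measurableX.
rewrite /lebesgue_cons /pushforward -comp_preimage.
rewrite (_ : split \o _ = id); last by apply/funext => x /=; rewrite splitK.
by rewrite preimage_id product_measure1E// lte_mul_pinfty// ge0_fin_numE.
Qed.

HB.instance Definition _ := Measure_isSigmaFinite.Build _ _ _ lebesgue_cons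
  lebesgue_cons_sigma_finite.

End step.

Fixpoint lebesgue_tuple k :
    {sigma_finite_measure set (k.-tuple RR) -> \bar R} :=
  if k is j.+1 then lebesgue_cons (lebesgue_tuple j)
  else \d_([tuple] : 0.-tuple RR).

End lebesgue_tuple.

Section path_graph.
Variables (R : realType) (n : nat).
Local Notation mx := 'M[R]_n.

Definition edge (i j : 'I_n) : bool := (i <= j.+1)%N && (j <= i.+1)%N.

Definition ZG : set mx :=
  [set y | y^T = y /\ forall i j, ~~ edge i j -> y i j = 0].

Definition posdef (y : mx) : Prop :=
  y^T = y /\ forall x : 'cV[R]_n, x != 0 -> 0 < (x^T *m y *m x) 0 0.

Definition PG : set mx := [set y | ZG y /\ posdef y].

Definition IG : set mx := ZG.

Definition pairing (y eta : mx) : R := \tr (y *m eta).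

Definition QG : set mx :=
  [set eta | IG eta /\ forall y, closure PG y -> y != 0 -> 0 < pairing y eta].

Definition piG (A : mx) : mx := \matrix_(i, j) (if edge i j then A i j else 0).

Definition itv (i j : nat) : {set 'I_n} := [set k : 'I_n | (i <= k.+1 <= j)%N].

Definition psub (I : {set 'I_n}) (A : mx) : 'M[R]_#|I| :=
  mxsub enum_val enum_val A.

(* K^0; as enum_val is injective each sum has at most one term *)
Definition zext (I : {set 'I_n}) (K : 'M[R]_#|I|) : mx :=
  \matrix_(i, j) \sum_(a < #|I| | enum_val a == i)
                   \sum_(b < #|I| | enum_val b == j) K a b.

Definition minor (A : mx) (i j : nat) : R := \det (psub (itv i j) A).

Definition dg (A : mx) (i : nat) : R :=
  if insub i.-1 is Some k then A k k else 0.

Definition hat (m : mx) : mx :=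
  xget 0 [set A | posdef A /\ piG A = m /\ PG (invmx A)].

(* M_I for I = {i:j} *)
Definition Msub (m : mx) (i j : nat) : mx :=
  zext (invmx (psub (itv i j) (invmx (hat m)))).

Definition quadP (A u : mx) : mx := piG (A *m u *m A).

End path_graph.

Section wishart.
Variables (R : realType) (n M : nat) (s : n.-tuple R).
Local Notation mx := 'M[R]_n.
Local Notation coords := ((n + n.-1).-tuple (measurableTypeR R)).

(* s_i, with s_0 = s_(n+1) = 0 *)
Definition sx (i : nat) : R := (0 :: (s : seq R))`_i.

(* The linear isomorphism R^(2n-1) -> I_G: first the n diagonal entries, then
   the n-1 entries (i, i+1). *)
Definition incomplete (t : coords) : mx :=
  \matrix_(i, j)
    (if i == j then (t : seq R)`_i
     else if edge i j then (t : seq R)`_(n + minn i j) else 0).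

Definition delta (eta : mx) : R :=
  (\prod_(1 <= i < M) minor eta i i.+1 `^ sx i *
   \prod_(M.+1 <= i < n.+1) minor eta i.-1 i `^ sx i) /
  (\prod_(2 <= i < M) dg eta i `^ sx i.-1 *
   dg eta M `^ (sx M.-1 - sx M + sx M.+1) *
   \prod_(M.+1 <= i < n) dg eta i `^ sx i.+1).

Definition phi (eta : mx) : R :=
  if n == 1%N then (dg eta 1)^-1
  else \prod_(1 <= i < n) minor eta i i.+1 `^ (- (3 / 2)) *
       \prod_(2 <= i < n) dg eta i.

Definition wishart_density (y eta : mx) : R :=
  expR (- pairing y eta) * delta eta * phi eta.

(* P is the law on Q_G, in the coordinates above, with density proportional to
   wishart_density y; P setT = 1 determines the factor c. *)
Definition is_wishart (y : mx) (P : probability coords R) : Prop :=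
  exists c : R, forall A : set coords, measurable A ->
    P A = (c%:E * \int[lebesgue_tuple R (n + n.-1)]_(t in
                     A `&` incomplete @^-1` @QG R n)
                    (wishart_density y (incomplete t))%:E)%E.

Definition gamma (y : mx) : probability coords R :=
  if pselect (exists P, is_wishart y P) is left h then projT1 (cid h)
  else \d_(point : coords).

Definition mean (y : mx) : mx :=
  \matrix_(i, j) fine ('E_(gamma y)[fun t => incomplete t i j])%E.

Definition psi (m : mx) : mx := xget 0 [set y | PG y /\ mean y = m].

Definition covop (y z : mx) : mx :=
  xget 0 [set w | IG w /\ forall z', ZG z' ->
    (pairing z' w)%:E = covariance (gamma y)
      (fun t => pairing z (incomplete t)) (fun t => pairing z' (incomplete t))].

Definition variance_function (m : mx) : mx -> mx := covop (psi m).

End wishart.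

(* Main.v *)
Require Import Defs.
From HB Require Import structures.
From mathcomp Require Import all_boot all_order all_algebra.
From mathcomp Require Import all_classical all_reals all_analysis.
From mathcomp Require Import measurable_realfun ring lra zify.
Import Order.TTheory GRing.Theory Num.Theory.
Import numFieldNormedType.Exports.
Set Implicit Arguments.
Unset Strict Implicit.
Unset Printing Implicit Defensive.
Local Open Scope classical_set_scope.
Local Open Scope ring_scope.

(** Root the path at the vertex r = M - 1 of 'I_n, so that every other vertex v
    has a parent, its neighbour towards r.  Write x_v for the diagonal entries
    of eta, b_v for the entry on the edge from v to its parent p(v), and
    q_v = x_v x_p(v) - b_v^2.  On Q_G, which is exactly the set where all x_v
    and q_v are positive, the weight factors along the tree:

      delta(eta) phi(eta)
        = x_r^(s_r - 1) prod_(v <> r) q_v^(s_v - 3/2) x_p(v)^(1 - s_v).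

    Hence the Laplace integral can be computed by removing leaves.  The pair
    (b_v, x_v) of a leaf occurs only in its own factor; a gamma integral followed
    by a Gaussian one ([edge_integral]) produces a constant times
    d_v^(-s_v) exp(x_p(v) c^2 / d_v), where c is the entry of y on the edge and
    d_v its diagonal entry, and the exponential corrects the diagonal entry of
    the parent by a Schur complement.  Iterating ([nint_tree]) yields
    K prod_v d_v(y)^(-s_v), where the d_v(y) are the pivots of the Gaussian
    elimination of y from the leaves to the root.

    In matrix terms y = U^T D U with D the diagonal matrix of pivots and
    U = 1 + N, N being supported on the pairs (child, parent).  Put T = U^-1 and
    W(z) = T^T z T.  Along the line y + t z the pivot d_k has derivative W_kk and
    W_kk has derivative - 2 sum_j W_jk^2 / d_j over the strict descendants j of k
    ([is_derive_piv], [is_derive_pull]); both follow by induction from the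
    leaves.  As the moment generating function of <z, X> is a ratio of two
    Laplace integrals, its first two derivatives at 0 give the moments
    ([mgf_moments]): the mean is pi(T diag(s_k / d_k) T^T) and

      Cov(<u, X>, <z, X>) = sum_k s_k (W_kk(u) W_kk(z) / d_k^2
          + 2 sum_(j strictly below k) W_jk(u) W_jk(z) / (d_j d_k)).

    On the other side, a positive definite completion of m with inverse in Z_G is
    unique ([cov_unique]), so at the mean m of y the completion hat m is
    T diag(s_k / d_k) T^T itself.  The sets {1:j} with j < M and {k:n} with k > M
    are closed under descendants, and for such a set I the elimination of hat m^-1
    restricts to the block I, so that M_I = T diag(1_I(k) s_k / d_k) T^T
    ([block_cov]).  The coefficients 1/s_j - 1/s_(j+1) telescope, and each argument
    of P in the formula collapses to T diag(1_I(k) / d_k) T^T ([left_block],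
    [right_block], [middle_block]).  Pairing P of such a matrix applied to u with
    z gives sum_(k, l in I) W_kl(u) W_kl(z) / (d_k d_l), and W_kl(u) vanishes
    unless k and l are comparable ([pull_incomparable]).  The outer coefficients
    s_i - s_(i+1) telescope once more: a comparable pair is counted with the
    weight s_k of its vertex k closest to the root, which is the covariance form
    above ([covop_wishart]).

    Every m in Q_G is reached: its completion by regression of each vertex on its
    parent has the shape T diag(a_k) T^T, and the pivots s_k / a_k define a point
    y of P_G whose mean is m ([mean_surjective]). *)

(** * The integral over one edge of the tree *)

Section affine.
Variable R : realType.
Local Notation leb := (@lebesgue_measure R).
Local Notation RR := (measurableTypeR R).

(** The image of Lebesgue measure under an affine map is a multiple of it,
    since both agree on half-open intervals, which determine the measure. *)
Lemma ge0_integral_affine (a b : R) (f : R -> \bar R) : 0 < a ->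
  measurable_fun [set: R] f -> (forall x, (0 <= f x)%E) ->
  (\int[leb]_x f (a * x + b)%R = a^-1%:E * \int[leb]_x f x)%E.
Proof.
move=> a0 mf f0.
have a0' : 0 <= a^-1 by rewrite invr_ge0 ltW.
pose phi : RR -> RR := fun x => a * x + b.
have mphi : measurable_fun setT phi.
  by apply: measurable_funD => //; apply: measurable_funM.
unshelve epose (nu0 := (pushforward leb phi : {measure set RR -> \bar R})).
  exact: mphi.
have E (A : set RR) : measurable A ->
    nu0 A = mscale (NngNum a0') leb A.
  move=> mA.
  pose nu := mscale (NngNum (ltW a0)) nu0.
  have H : forall X, ocitv X -> leb X = nu X.
    move=> _ [[u v]] _ <-.
    rewrite /nu /mscale/= /nu0 /pushforward/=.
    have -> : (phi @^-1` `]u, v] : set RR) = `]((u - b) / a), ((v - b) / a)]%classic.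
      apply/seteqP; split => x /=; rewrite !in_itv/= /phi;
        by rewrite ltr_pdivrMr// ler_pdivlMr// (mulrC x) ltrBlDr lerBrDr.
    rewrite !lebesgue_measure_itv/= !lte_fin ltr_pM2r ?invr_gt0// ltrD2r.
    case: ifP => // _; last by rewrite mule0.
    rewrite -!EFinB -EFinM; congr EFin.
    by field; rewrite gt_eqF.
  have := lebesgue_measure_unique H mA; rewrite /nu /mscale/= => ->.
  by rewrite muleA -EFinM mulVf ?gt_eqF// mul1e.
transitivity (\int[nu0]_x f x)%E.
  by rewrite [RHS](ge0_integral_pushforward mphi).
rewrite (@eq_measure_integral _ _ _ setT (mscale (NngNum a0') leb)).
  by rewrite (ge0_integral_mscale _ _ (NngNum a0')).
by move=> A mA _; exact: E.
Qed.

End affine.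

Section gamma_integral.
Variable R : realType.
Local Notation leb := (@lebesgue_measure R).
Local Notation RR := (measurableTypeR R).

Definition gamma_fun (p D x : R) : R :=
  if 0 < x then x `^ (p - 1) * expR (- D * x) else 0.

Lemma gamma_fun_ge0 p D x : 0 <= gamma_fun p D x.
Proof.
by rewrite /gamma_fun; case: ifP => // _; rewrite mulr_ge0 ?powR_ge0 ?expR_ge0.
Qed.

Lemma measurable_gamma_fun p D : measurable_fun [set: R] (gamma_fun p D).
Proof.
apply: measurable_fun_ifT => //.
  exact: measurable_fun_ltr.
apply: measurable_funM; first exact: measurable_powR.
by apply: measurableT_comp => //; apply: measurable_funM.
Qed.

(** The primitive x^p / p bounds the integral over each [1/(i+1), 1] by
    1/p; monotone convergence does the rest. *)
Lemma integral_powR01_lty (p : R) : 0 < p ->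
  (\int[leb]_(x in `]0%R, 1%R]) (x `^ (p - 1))%:E < +oo)%E.
Proof.
move=> p0.
pose F (i : nat) : set R := `[(i.+1%:R^-1 : R), 1]%classic.
have mf (A : set R) : measurable_fun A (fun x : R => (x `^ (p - 1))%:E).
  by apply/measurable_EFinP; apply: measurable_funTS; exact: measurable_powR.
have FU : \bigcup_i F i = `]0%R, 1%R]%classic.
  apply/seteqP; split => x /=.
    move=> [i _]; rewrite /F /= !in_itv/= => /andP[h ->]; rewrite andbT.
    by apply: lt_le_trans h; rewrite invr_gt0.
  rewrite in_itv/= => /andP[x0 x1].
  have [k hk] : exists k : nat, x^-1 < k%:R.
    by exists (Num.truncn x^-1).+1; exact: truncnS_gt.
  exists k => //; rewrite /F /= in_itv/= x1 andbT.
  rewrite -[leRHS]invrK lef_pV2 ?posrE ?invr_gt0//.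
  by rewrite (le_trans (ltW hk))// ler_nat.
have nd : nondecreasing_seq F.
  move=> m k mk; apply/subsetPset => x; rewrite /F/= !in_itv/= => /andP[h ->].
  rewrite andbT (le_trans _ h)// lef_pV2 ?posrE//.
  by rewrite ler_nat.
have bd i : (\int[leb]_(x in F i) (x `^ (p - 1))%:E <= (p^-1)%:E)%E.
  case: i => [|i].
    rewrite /F invr1 set_itv1 integral_set1 lee_fin invr_ge0 ltW//.
  have i1 : (i.+2%:R^-1 : R) < 1 by rewrite invf_lt1// ltr1n.
  have i0 : 0 < (i.+2%:R^-1 : R) by rewrite invr_gt0.
  have dF (x : R) : 0 < x ->
      is_derive x 1 (fun x => p^-1 * (x `^ p)) (x `^ (p - 1)).
    move=> x0; have H := is_deriveZ p^-1 (is_derive1_powR p x0).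
    by apply: is_derive_eq H _; rewrite /GRing.scale/= mulrA mulVf ?gt_eqF// mul1r.
  have cF (x : R) : 0 < x -> {for x, continuous (fun x => p^-1 * (x `^ p))}.
    move=> x0; have [dx _] := dF _ x0.
    exact/differentiable_continuous/derivable1_diffP.
  rewrite (@continuous_FTC2 _ _ (fun x => p^-1 * (x `^ p)))//.
  - rewrite powR1 mulr1 -EFinB lee_fin lerBlDr lerDl.
    by rewrite mulr_ge0 ?powR_ge0// invr_ge0 ltW.
  - apply: derivable_within_continuous => x; rewrite in_itv/= => /andP[h _].
    by apply: derivable_powR; rewrite in_itv/= andbT (lt_le_trans i0).
  - split.
    + move=> x; rewrite in_itv/= => /andP[h _].
      by have [] := dF x (lt_trans i0 h).
    + by apply: cvg_at_right_filter; exact: cF.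
    + by apply: cvg_at_left_filter; exact: cF.
  - move=> x; rewrite in_itv/= => /andP[h _].
    by rewrite derive1E; have [_ ->] := dF x (lt_trans i0 h).
have := @ge0_nondecreasing_set_cvg_integral _ RR R F
   (fun x => (x `^ (p - 1))%:E) leb nd (fun i => measurable_itv _)
   (fun i => mf _) (fun i x _ => powR_ge0 _ _).
rewrite FU => cv.
apply: (@le_lt_trans _ _ (p^-1)%:E); last exact: ltry.
rewrite -(cvg_lim _ cv)//; apply: lime_le; first by apply/cvg_ex; eexists; exact: cv.
exact: nearW.
Qed.

(** Concavity gives ln x <= x/k + ln k, and k = 2 |p - 1| + 1 makes |p - 1|
    x/k at most x/2. *)
Lemma powR_le_expR (p x : R) : 1 <= x ->
  x `^ (p - 1) <= expR (`|p - 1| * ln (2 * `|p - 1| + 1)) * expR (x / 2).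
Proof.
move=> x1; have x0 : 0 < x by exact: lt_le_trans x1.
set q := `|p - 1|; have q0 : 0 <= q by exact: normr_ge0.
set k := 2 * q + 1; have k0 : 0 < k by rewrite /k; lra.
rewrite /powR gt_eqF// -expRD ler_expR.
have lnx : 0 <= ln x by exact: ln_ge0.
have h1 : (p - 1) * ln x <= q * ln x by rewrite ler_wpM2r// ler_norm.
have h2 : ln x <= x / k + ln k.
  have h : ln (1 + (x / k - 1)) <= x / k - 1.
    by apply: le_ln1Dx; rewrite ltrBrDr addNr divr_gt0.
  rewrite (_ : 1 + (x / k - 1) = x / k) in h; last by ring.
  by move: h; rewrite ln_div ?posrE//; lra.
have h3 : q * ln x <= q * (x / k + ln k) by rewrite ler_wpM2l.
have h4 : q * (x / k) <= x / 2.
  rewrite mulrA ler_pdivrMr// mulrAC ler_pdivlMr//.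
  by rewrite /k; nra.
by move: h3; rewrite mulrDr; lra.
Qed.

Lemma integral_gamma_fun_lty (p : R) : 0 < p ->
  (\int[leb]_x (gamma_fun p 1 x)%:E < +oo)%E.
Proof.
move=> p0.
pose C := 2 * expR (`|p - 1| * ln (2 * `|p - 1| + 1)).
have C0 : 0 <= C by rewrite mulr_ge0 ?expR_ge0.
pose f1 := (fun x : R => (x `^ (p - 1))%:E) \_ `]0%R, 1%R].
pose f2 := (fun x : R => (C%:E * (exponential_pdf 2^-1 x)%:E)%E).
have mf1 : measurable_fun [set: R] f1.
  apply/(measurable_restrictT _ _).1 => //.
  apply/measurable_EFinP; apply: measurable_funTS; exact: measurable_powR.
have h0 : 0 <= (2^-1 : R) by rewrite invr_ge0.
have mpdf : measurable_fun [set: R] (fun x : R => (exponential_pdf 2^-1 x)%:E).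
  by apply/measurable_EFinP; exact: measurable_exponential_pdf.
have mf2 : measurable_fun [set: R] f2 by apply: emeasurable_funM.
have f10 x : (0 <= f1 x)%E.
  by rewrite /f1; apply: erestrict_ge0 => y _; rewrite lee_fin powR_ge0.
have f20 x : (0 <= f2 x)%E.
  by rewrite /f2 mule_ge0// lee_fin exponential_pdf_ge0.
apply: (@le_lt_trans _ _ (\int[leb]_x (f1 x + f2 x))%E).
  apply: ge0_le_integral => //.
  - by move=> x _; rewrite lee_fin gamma_fun_ge0.
  - by apply/measurable_EFinP; exact: measurable_gamma_fun.
  - exact: emeasurable_funD.
  move=> x _; rewrite /gamma_fun; case: ifPn => x0; last by rewrite adde_ge0.
  have [x1|x1] := leP x 1.
    rewrite -[leLHS]adde0 leeD// /f1 patchE mem_set/= ?in_itv/= ?x0 ?x1//.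
    rewrite lee_fin ler_piMr ?powR_ge0//.
    by rewrite -[leRHS]expR0 ler_expR mulN1r oppr_le0 ltW.
  rewrite -[leLHS]add0e leeD// /f2 -EFinM lee_fin exponential_pdfE ?(ltW x0)//.
  have := powR_le_expR p (ltW x1).
  rewrite -(ler_pM2r (expR_gt0 (- (1) * x))) => h.
  apply: le_trans h _.
  rewrite le_eqVlt; apply/orP; left; apply/eqP.
  have -> : expR (- 2^-1 * x) = expR (x / 2) * expR (- (1) * x).
    by rewrite -expRD; congr expR; field.
  by rewrite /C; field.
rewrite ge0_integralD// ge0_integralZl//; last first.
  by move=> x _; rewrite lee_fin exponential_pdf_ge0.
rewrite integral_exponential_pdf ?invr_gt0// mule1.
rewrite lte_add_pinfty ?ltry//.
by rewrite -integral_mkcond; exact: integral_powR01_lty.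
Qed.

Lemma integral_gamma_fun_gt0 (p : R) :
  (0 < \int[leb]_x (gamma_fun p 1 x)%:E)%E.
Proof.
(* A lower bound of the integrand on [1, 2] suffices. *)
pose c := expR (- (`|p - 1| * ln 2) - 2).
apply: (@lt_le_trans _ _ (\int[leb]_(x in `[1%R, 2%R]) c%:E)%E).
  rewrite integral_cst//= lebesgue_measure_itv/= lte_fin ltr1n/= -EFinB -EFinM.
  by rewrite lte_fin mulr_gt0 ?expR_gt0//; lra.
rewrite integral_mkcond; apply: ge0_le_integral => //.
- by move=> x _; apply: erestrict_ge0 => y _; rewrite lee_fin expR_ge0.
- by apply/(measurable_restrictT _ _).1.
- by apply/measurable_EFinP; exact: measurable_gamma_fun.
- move=> x _; rewrite patchE; case: ifPn => [|_]; last first.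
    by rewrite lee_fin gamma_fun_ge0.
  rewrite inE/= in_itv/= => /andP[x1 x2].
  have x0 : 0 < x by exact: lt_le_trans x1.
  rewrite /gamma_fun x0 lee_fin /powR gt_eqF// -expRD ler_expR.
  have h1 : ln x <= ln 2 by rewrite ler_ln ?posrE.
  have h2 : 0 <= ln x by rewrite ln_ge0.
  have h3 : `|p - 1| * ln x <= `|p - 1| * ln 2 by rewrite ler_wpM2l.
  have h4 : - (`|p - 1| * ln x) <= (p - 1) * ln x.
    by rewrite lerNl -mulNr ler_wpM2r// -normrN ler_norm.
  lra.
Qed.

(** Only the dependence on D matters, as constants cancel in a probability
    law; it comes from the scaling x -> x / D. *)
Lemma gamma_integral (p : R) : 0 < p ->
  exists2 k : R, 0 < k &
    forall D, 0 < D -> (\int[leb]_x (gamma_fun p D x)%:E = (k * D `^ (- p))%:E)%E.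
Proof.
move=> p0.
have [k ek] : exists k : R, (\int[leb]_x (gamma_fun p 1 x)%:E = k%:E)%E.
  exists (fine (\int[leb]_x (gamma_fun p 1 x)%:E)%E).
  rewrite fineK// ge0_fin_numE ?integral_gamma_fun_lty//.
  exact/ltW/integral_gamma_fun_gt0.
exists k; first by rewrite -lte_fin -ek integral_gamma_fun_gt0.
move=> D D0.
have Dp : (\int[leb]_x (gamma_fun p D x)%:E =
    \int[leb]_x ((D `^ (- (p - 1)))%:E * (gamma_fun p 1 (D * x + 0)%R)%:E))%E.
  apply: eq_integral => x _; rewrite addr0 -EFinM; congr EFin.
  rewrite /gamma_fun pmulr_rgt0//; case: ifPn => x0; last by rewrite mulr0.
  rewrite powRM ?(ltW x0) ?(ltW D0)// !mulrA -powRD ?(gt_eqF D0) ?implybT//.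
  by rewrite addNr powRr0 mul1r mulN1r mulNr.
have mg : measurable_fun [set: R] (fun x => (gamma_fun p 1 x)%:E).
  by apply/measurable_EFinP; exact: measurable_gamma_fun.
have g0 : forall u : R, (0 <= (gamma_fun p 1 u)%:E)%E.
  by move=> u; rewrite lee_fin gamma_fun_ge0.
rewrite Dp ge0_integralZl ?lee_fin ?powR_ge0//; last first.
  apply: measurableT_comp mg _.
  by apply: measurable_funD => //; apply: measurable_funM.
rewrite (ge0_integral_affine 0 D0 mg g0) ek -!EFinM; congr EFin.
rewrite mulrA mulrC; congr (_ * _).
rewrite -powR_inv1 ?(ltW D0)// -powRD ?(gt_eqF D0) ?implybT//.
by congr powR; lra.
Qed.

End gamma_integral.

Section edge_integral.
Variable R : realType.
Local Notation leb := (@lebesgue_measure R).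
Local Notation RR := (measurableTypeR R).

(** Completing the square exhibits a normal density of mean - c x / D and
    variance x / (2 D). *)
Lemma integral_expR_quadratic (D c x : R) : 0 < D -> 0 < x ->
  (\int[leb]_b (expR (- D * (b ^+ 2 / x) - 2 * c * b))%:E
   = (Num.sqrt (x * pi / D) * expR (x * c ^+ 2 / D))%:E)%E.
Proof.
move=> D0 x0.
pose sg := Num.sqrt (x / (2 * D)); pose m := - (c * x / D).
have sg2 : sg ^+ 2 = x / (2 * D).
  by rewrite sqr_sqrtr// divr_ge0 ?mulr_ge0 // ltW.
have sg0 : sg != 0 by rewrite sqrtr_eq0 -ltNge divr_gt0// mulr_gt0.
have pk0 := normal_peak_gt0 sg0.
rewrite (eq_integral (fun b : RR => ((normal_peak sg)^-1 * expR (x * c ^+ 2 / D))%:E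
   * (normal_pdf m sg b)%:E)%E); last first.
  move=> b _; rewrite -EFinM; congr EFin.
  rewrite normal_pdfE// /normal_fun mulrACA mulVf ?gt_eqF// mul1r -expRD.
  congr expR; rewrite sg2 /m -[X in _ = _ + X]/(- (b - - (c * x / D)) ^+ 2 / _).
  by field; rewrite !gt_eqF.
rewrite ge0_integralZl//.
- rewrite integral_normal_pdf mule1; congr (_ * _)%:E.
  rewrite /normal_peak invrK sg2; congr Num.sqrt.
  by field; rewrite gt_eqF.
- by apply/measurable_EFinP; exact: measurable_normal_pdf.
- by move=> ? _; rewrite lee_fin normal_pdf_ge0.
- by rewrite lee_fin mulr_ge0 ?expR_ge0// invr_ge0 ltW.
Qed.

(** The factor contributed by a vertex with diagonal entry z, parent entry
    x and edge entry b. The power of x is the one that makes the integral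
    over (b, z) depend on x through an exponential only. *)
Definition edge_fun (s D c x z b : R) : R :=
  if (0 < x) && (0 < x * z - b ^+ 2) then
    expR (- D * z - 2 * c * b) * (x * z - b ^+ 2) `^ (s - 3 / 2) * x `^ (1 - s)
  else 0.

Lemma edge_fun_ge0 s D c x z b : 0 <= edge_fun s D c x z b.
Proof.
by rewrite /edge_fun; case: ifP => // _; rewrite !mulr_ge0 ?powR_ge0 ?expR_ge0.
Qed.

Lemma measurable_edge_fun d (T : measurableType d) s D c (x z b : T -> R) :
  measurable_fun setT x -> measurable_fun setT z -> measurable_fun setT b ->
  measurable_fun setT (fun t => edge_fun s D c (x t) (z t) (b t)).
Proof.
move=> mx mz mb.
have mdet : measurable_fun setT (fun t => x t * z t - b t ^+ 2).
  apply: measurable_funB; first exact: measurable_funM.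
  exact: measurable_funX.
apply: measurable_fun_ifT => //.
  apply: measurable_and; exact: measurable_fun_ltr.
apply: measurable_funM; last first.
  exact: (measurableT_comp (measurable_powR _) mx).
apply: measurable_funM; last first.
  exact: (measurableT_comp (measurable_powR _) mdet).
apply: measurableT_comp => //; apply: measurable_funB.
  exact: measurable_funM.
exact: measurable_funM.
Qed.

(** The substitution z = a + b^2 / x separates a gamma density in a from a
    Gaussian factor in b. *)
Lemma edge_fun_shift s D c x z b : 0 < x ->
  edge_fun s D c x z b =
  expR (- D * (b ^+ 2 / x) - 2 * c * b) * x `^ (- 2^-1) *
    gamma_fun (s - 1 / 2) D (1 * z + - (b ^+ 2 / x)).
Proof.
move=> x0; rewrite /edge_fun /gamma_fun x0 mul1r /=.
set a := z + _.
have za : x * z - b ^+ 2 = x * a by rewrite /a; field; rewrite gt_eqF.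
rewrite za pmulr_rgt0//; case: ifPn => a0; last by rewrite mulr0.
rewrite powRM ?(ltW x0) ?(ltW a0)//.
have -> : x `^ (- 2^-1) = x `^ (s - 3 / 2) * x `^ (1 - s).
  by rewrite -powRD ?(gt_eqF x0) ?implybT//; congr powR; lra.
have -> : s - 1 / 2 - 1 = s - 3 / 2 by lra.
have -> : expR (- D * z - 2 * c * b) =
    expR (- D * (b ^+ 2 / x) - 2 * c * b) * expR (- D * a).
  by rewrite -expRD; congr expR; rewrite /a; field; rewrite gt_eqF.
by ring.
Qed.

(** The gamma integral in z leaves the factor x^(-1/2) and the Gaussian
    integral in b the factor x^(1/2), so x survives only in the
    exponential. *)
Lemma edge_integral (s : R) : 1 / 2 < s ->
  exists2 k : R, 0 < k & forall D c x, 0 < D -> 0 < x ->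
    (\int[leb]_b \int[leb]_z (edge_fun s D c x z b)%:E =
     (k * D `^ (- s) * expR (x * c ^+ 2 / D))%:E)%E.
Proof.
move=> hs; have p0 : 0 < s - 1 / 2 by lra.
have [k k0 hk] := gamma_integral p0.
exists (k * Num.sqrt pi); first by rewrite mulr_gt0 ?sqrtr_gt0 ?pi_gt0.
move=> D c x D0 x0.
have mg : measurable_fun [set: R] (fun x => (gamma_fun (s - 1 / 2) D x)%:E).
  by apply/measurable_EFinP; exact: measurable_gamma_fun.
have g0 : forall u, (0 <= (gamma_fun (s - 1 / 2) D u)%:E)%E.
  by move=> u; rewrite lee_fin gamma_fun_ge0.
(* The factor that the inner gamma integral leaves outside the Gaussian. *)
pose C := x `^ (- 2^-1) * (k * D `^ (- (s - 1 / 2))).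
have C0 : 0 <= C by rewrite !mulr_ge0 ?powR_ge0// ltW.
rewrite (eq_integral (fun b : RR => C%:E *
    (expR (- D * (b ^+ 2 / x) - 2 * c * b))%:E)%E); last first.
  move=> b _.
  under eq_integral do rewrite edge_fun_shift// EFinM.
  rewrite ge0_integralZl//.
  - rewrite (ge0_integral_affine _ ltr01 mg g0) hk// invr1 mul1e -!EFinM.
    by congr EFin; rewrite /C; ring.
  - apply: measurableT_comp mg _.
    by apply: measurable_funD => //; apply: measurable_funM.
  - by rewrite lee_fin mulr_ge0 ?expR_ge0 ?powR_ge0.
rewrite ge0_integralZl//.
- rewrite integral_expR_quadratic// -EFinM; congr EFin.
  have -> : Num.sqrt (x * pi / D) = x `^ 2^-1 * Num.sqrt pi * D `^ (- 2^-1).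
    rewrite sqrtrM ?mulr_ge0 ?pi_ge0 ?(ltW x0)// sqrtrM ?(ltW x0)//.
    by rewrite sqrtrV ?(ltW D0)// -!powR12_sqrt ?(ltW x0) ?(ltW D0) ?pi_ge0// powRN.
  have -> : D `^ (- s) = D `^ (- (s - 1 / 2)) * D `^ (- 2^-1).
    by rewrite -powRD ?(gt_eqF D0) ?implybT//; congr powR; lra.
  have xx : x `^ (- 2^-1) * x `^ 2^-1 = 1.
    by rewrite -powRD ?(gt_eqF x0) ?implybT// addNr powRr0.
  rewrite /C; set A := x `^ (- 2^-1) in xx *; set B := x `^ 2^-1 in xx *.
  set E1 := expR _; set E2 := D `^ _; set E3 := D `^ _.
  transitivity ((A * B) * (k * Num.sqrt pi * (E2 * E3) * E1)); first by ring.
  by rewrite xx mul1r.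
- apply/measurable_EFinP; apply: measurableT_comp => //.
  apply: measurable_funB; apply: measurable_funM => //.
  by apply: measurable_funM => //; exact: measurable_funX.
Qed.

End edge_integral.

(** * Nested integrals over named variables *)

Section nested_integral.
Variable R : realType.
Local Notation leb := (@lebesgue_measure R).
Local Notation RR := (measurableTypeR R).
Local Notation env := (nat -> R).

(** Variables are named by natural numbers and an environment assigns them
    values; nested integrals can then be permuted without moving tuple
    components. *)
Definition upd (e : env) i x : env := fun j => if j == i then x else e j.

(** Measurability along every measurably parametrised family of
    environments: this notion is stable both under substitution of a
    variable and under integration over a variable ([env_measurable_nint]). *)
Definition env_measurable (f : env -> \bar R) := forall d (T : measurableType d)
  (E : T -> env), (forall i, measurable_fun [set: T] (fun t => E t i)) ->
  measurable_fun [set: T] (fun t => f (E t)).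

Fixpoint nint (l : seq nat) (f : env -> \bar R) (e : env) : \bar R :=
  if l is i :: l' then (\int[leb]_x nint l' f (upd e i x))%E else f e.

Lemma nint_ge0 l f e : (forall e, (0 <= f e)%E) -> (0 <= nint l f e)%E.
Proof. by elim: l e => //= i l IH e f0; apply: integral_ge0 => x _; exact: IH. Qed.

Lemma eq_nint l f g e : f =1 g -> nint l f e = nint l g e.
Proof.
by elim: l e => //= i l IH e fg; apply: eq_integral => x _; exact: IH.
Qed.

Lemma nint_cat l1 l2 f e : nint (l1 ++ l2) f e = nint l1 (nint l2 f) e.
Proof.
by elim: l1 e => //= i l1 IH e; apply: eq_integral => x _; exact: IH.
Qed.

Lemma measurable_upd d (T : measurableType d) (E : T -> env) (x : T -> R) i :
  (forall j, measurable_fun [set: T] (fun t => E t j)) ->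
  measurable_fun [set: T] x ->
  forall j, measurable_fun [set: T] (fun t => upd (E t) i (x t) j).
Proof. by move=> mE mx j; rewrite /upd; case: eqP => _. Qed.

Lemma env_measurable_nint l f : (forall e, (0 <= f e)%E) ->
  env_measurable f -> env_measurable (nint l f).
Proof.
move=> f0 mf; elim: l => //= i l IH d T E mE.
pose F (p : T * RR) := nint l f (upd (E p.1) i p.2).
apply: (@measurable_fun_fubini_tonelli_F _ _ T RR R leb F).
  apply: IH; apply: measurable_upd; last exact: measurable_snd.
  by move=> j; exact: measurableT_comp (mE j) measurable_fst.
by move=> x; exact: nint_ge0.
Qed.

Lemma updC e i j x y : i != j -> upd (upd e i x) j y = upd (upd e j y) i x.
Proof.
move=> ij; apply/funext => k; rewrite /upd.
by case: eqP => [->|//]; case: eqP => // ji; rewrite ji eqxx in ij.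
Qed.

Lemma nint_swap l f e i j : i != j -> (forall e, (0 <= f e)%E) ->
  env_measurable f -> nint [:: i, j & l] f e = nint [:: j, i & l] f e.
Proof.
move=> ij f0 mf /=.
pose F (p : RR * RR) := nint l f (upd (upd e i p.1) j p.2).
have mF : measurable_fun setT F.
  apply: (env_measurable_nint l f0 mf).
  apply: measurable_upd; last exact: measurable_snd.
  by apply: measurable_upd => //; exact: measurable_fst.
rewrite (@fubini_tonelli _ _ RR RR R leb leb F mF); last first.
  by move=> x; exact: nint_ge0.
by apply: eq_integral => y _; apply: eq_integral => x _; rewrite /F/= updC.
Qed.

Lemma nint_move l1 l2 f e i : i \notin l1 -> (forall e, (0 <= f e)%E) ->
  env_measurable f -> nint (l1 ++ i :: l2) f e = nint (i :: l1 ++ l2) f e.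
Proof.
move=> + f0 mf; elim: l1 e => [//|j l1 IH] e.
rewrite inE negb_or => /andP[ij il1].
transitivity (nint [:: j, i & l1 ++ l2] f e).
  by apply: eq_integral => x _; exact: IH.
by rewrite nint_swap// eq_sym.
Qed.

(** Tonelli exchanges adjacent integrals, hence the coordinates of I_G may
    be integrated in the order of elimination. *)
Lemma perm_nint l1 l2 f e : uniq l1 -> perm_eq l1 l2 ->
  (forall e, (0 <= f e)%E) -> env_measurable f -> nint l1 f e = nint l2 f e.
Proof.
move=> + + f0 mf; elim: l1 l2 e => [|i l1 IH] l2 e.
  by move=> _; rewrite perm_sym => /perm_nilP->.
move=> /= /andP[il1 ul1] pe.
have il2 : i \in l2 by rewrite -(perm_mem pe) inE eqxx.
have ul2 : uniq l2 by rewrite -(perm_uniq pe) /= il1.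
case/splitPr: il2 pe ul2 => p1 p2 pe.
rewrite cat_uniq/= negb_or => /and3P[_ /andP[ip1 _] _].
rewrite nint_move//=; apply: eq_integral => x _; apply: IH => //.
by rewrite -(perm_cons i) (perm_trans pe)// perm_catC/= perm_cons perm_catC.
Qed.

Definition ins m (t : seq R) (e : env) : env :=
  fun j => if (m <= j < m + size t)%N then t`_(j - m) else e j.

Lemma ins_nil m e : ins m [::] e = e.
Proof.
apply/funext => j; rewrite /ins/= addn0; case: ifP => // /andP[mj jm].
by have := leq_ltn_trans mj jm; rewrite ltnn.
Qed.

Lemma ins_cons m x t e : ins m (x :: t) e = ins m.+1 t (upd e m x).
Proof.
apply/funext => j; rewrite /ins /upd/= addSnnS.
have [->|jm] := eqVneq j m.
  by rewrite leqnn ltnn -addSnnS ltn_addr//= subnn.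
have [mj|mj] := ltnP m j; last first.
  by rewrite leqNgt ltn_neqAle jm mj.
by rewrite (ltnW mj)/=; case: ifP => // _; rewrite -(subnSK mj).
Qed.

Lemma measurable_ins d (T : measurableType d) k m (t : T -> k.-tuple RR) e :
  measurable_fun [set: T] t ->
  forall j, measurable_fun [set: T] (fun x => ins m (t x) e j).
Proof.
move=> mt j; rewrite /ins.
under eq_fun do rewrite size_tuple.
case: (boolP (m <= j < m + k)%N) => [/andP[mj jm]|_]; last exact: measurable_cst.
have jk : (j - m < k)%N by rewrite ltn_subLR.
under eq_fun do rewrite -(tnth_nth 0 _ (Ordinal jk)).
exact: measurableT_comp (measurable_tnth _) mt.
Qed.

(** Links the product measure on tuples to nested integrals: one Tonelli
    step per component. *)
Lemma integral_lebesgue_tuple k m (f : env -> \bar R) e :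
  (forall e, (0 <= f e)%E) -> env_measurable f ->
  (\int[lebesgue_tuple R k]_t f (ins m t e))%E = nint (iota m k) f e.
Proof.
move=> f0 mf; elim: k m e => [|k IH] m e.
  rewrite [LHS](_ : _ = \int[\d_([tuple] : 0.-tuple RR)]_t f (ins m t e))%E//.
  rewrite integral_dirac//; last exact: mf (measurable_ins _ _ _).
  by rewrite diracT mul1e/= ins_nil.
rewrite /=.
pose F (p : RR * k.-tuple RR) := f (ins m (cons_pair p) e).
have mcons := @measurable_cons_pair R k.
have mF : measurable_fun setT F.
  by apply: mf; exact: measurable_ins.
transitivity (\int[leb \x lebesgue_tuple R k]_p F p)%E.
  have mg : measurable_fun [set: k.+1.-tuple RR] (fun t => f (ins m t e)).
    by apply: mf; exact: measurable_ins.
  have := @ge0_integral_pushforward _ _ _ _ _ _ mcons (leb \x lebesgue_tuple R k)%E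
     setT (fun t => f (ins m t e)) measurableT mg (fun t _ => f0 _).
  by rewrite preimage_setT => <-.
rewrite fubini_tonelli1//; last by move=> p; exact: f0.
apply: eq_integral => x _; rewrite -IH.
by apply: eq_integral => t _; rewrite /F/= ins_cons.
Qed.

End nested_integral.

(** * Leaf elimination *)

Section elimination.
Variable R : realType.
Local Notation leb := (@lebesgue_measure R).
Local Notation env := (nat -> R).
Variables (r : nat) (p bv : nat -> nat) (s : nat -> R).

(** The list l enumerates the non-root vertices with children before their
    parents; the conditions on bv say that the edge variables are distinct
    from one another and from the vertex variables. *)
Fixpoint tree_order (l : seq nat) : bool :=
  if l is v :: l' then
    [&& v \notin r :: l', p v \in r :: l', bv v \notin r :: v :: l',
        bv v \notin map bv l', v \notin map bv l' & tree_order l']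
  else true.

(** The pair of variables of the first vertex eliminated stands last, where
    the innermost integrals are. *)
Fixpoint tree_vars (l : seq nat) : seq nat :=
  if l is v :: l' then tree_vars l' ++ [:: bv v; v] else [:: r].

Definition tree_density (d c : nat -> R) (l : seq nat) (e : env) : R :=
  gamma_fun (s r) (d r) (e r) *
  \prod_(v <- l) edge_fun (s v) (d v) (c v) (e (p v)) (e v) (e (bv v)).

(** Recovers the diagonal of a matrix from its pivots D and its
    off-diagonal entries c: elimination is parametrised backwards, by its
    result. *)
Definition unpivot (D c : nat -> R) (l : seq nat) (k : nat) : R :=
  D k + \sum_(i <- l | p i == k) c i ^+ 2 / D i.

Lemma tree_density_ge0 d c l e : 0 <= tree_density d c l e.
Proof.
apply: mulr_ge0; first exact: gamma_fun_ge0.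
by apply: prodr_ge0 => v _; exact: edge_fun_ge0.
Qed.

Lemma tree_density_measurable d c l :
  env_measurable (fun e => (tree_density d c l e)%:E).
Proof.
move=> dT T E mE; apply/measurable_EFinP; apply: measurable_funM.
  exact: (measurableT_comp (measurable_gamma_fun _ _) (mE r)).
by apply: measurable_prod => v _; exact: measurable_edge_fun.
Qed.

Lemma tree_order_root l : tree_order l -> r \notin l.
Proof.
elim: l => //= v l IH /and4P[vl _ _ /and3P[_ _ /IH rl]].
by move: vl; rewrite !inE !negb_or rl andbT eq_sym => /andP[].
Qed.

Lemma tree_order_uniq l : tree_order l -> uniq l.
Proof.
elim: l => //= v l IH /and4P[vl _ _ /and3P[_ _ /IH ->]].
by move: vl; rewrite inE negb_or => /andP[_ ->].
Qed.

Lemma tree_order_closed l i : tree_order l -> i \in l -> p i \in r :: l.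
Proof.
elim: l => //= v l IH /and4P[vl pv _ /and3P[_ _ tl]].
rewrite inE => /predU1P[->|/(IH tl)].
  by move: pv; rewrite !inE => /orP[->|->]; rewrite ?orbT.
by rewrite !inE => /orP[->|->]; rewrite ?orbT.
Qed.

(** Every vertex variable enters the exponent linearly, so the factor
    exp(x_p c^2 / D) produced by a child is a change of the diagonal
    parameter of the parent. *)
Lemma tree_density_shift d c l k a e : tree_order l -> k \in r :: l ->
  tree_density (fun j => d j + (if j == k then a else 0)) c l e * expR (e k * a)
  = tree_density d c l e.
Proof.
move=> tl; rewrite inE => /predU1P[->|kl].
  rewrite /tree_density eqxx mulrAC; congr (_ * _).
    rewrite /gamma_fun; case: ifP => _; last by rewrite mul0r.
    by rewrite -mulrA -expRD; congr (_ * expR _); ring.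
  rewrite !big_seq; apply: eq_bigr => v vl.
  rewrite ifN ?addr0//; apply: contraNneq (tree_order_root tl) => <-.
  by [].
rewrite /tree_density -mulrA; congr (_ * _).
  rewrite ifN ?addr0//; apply: contraNneq (tree_order_root tl) => ->.
  by [].
rewrite !(bigD1_seq k)/= ?tree_order_uniq// eqxx mulrAC; congr (_ * _).
  rewrite /edge_fun; case: ifP => _; last by rewrite mul0r.
  rewrite mulrAC (mulrAC _ _ (expR (e k * a))) -expRD.
  by congr (expR _ * _ * _); ring.
by apply: eq_bigr => v vk; rewrite (negbTE vk) addr0.
Qed.

(** [edge_integral] needs a positive parent entry; outside that range both
    sides of the elimination step vanish. *)
Lemma tree_density0 d c l k e : tree_order l -> k \in r :: l -> e k <= 0 ->
  tree_density d c l e = 0.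
Proof.
move=> tl + ek; rewrite inE => /predU1P[kr|kl].
  by rewrite /tree_density /gamma_fun -kr ltNge ek/= mul0r.
rewrite /tree_density (bigD1_seq k)/= ?tree_order_uniq// /edge_fun ifF ?mul0r ?mulr0//.
apply/negbTE/negP => /andP[pk0].
rewrite ltNge => /negP; apply.
have := sqr_ge0 (e (bv k)).
have : e (p k) * e k <= 0 by rewrite pmulr_rle0.
lra.
Qed.

Lemma nintZl l (f : env -> \bar R) k e : 0 <= k -> (forall e, (0 <= f e)%E) -> env_measurable f ->
  (nint l (fun e => k%:E * f e) e = k%:E * nint l f e)%E.
Proof.
move=> k0 f0 mf; elim: l e => //= i l IH e.
under eq_integral do rewrite IH.
rewrite ge0_integralZl//; last by move=> x _; exact: nint_ge0.
by apply: (env_measurable_nint l f0 mf); exact: measurable_upd.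
Qed.

Lemma unpivot_cons D c v l k :
  unpivot D c (v :: l) k =
  unpivot D c l k + (if k == p v then c v ^+ 2 / D v else 0).
Proof.
rewrite /unpivot big_cons eq_sym; case: ifP => _; last by rewrite addr0.
by rewrite [in LHS]addrCA [RHS]addrC.
Qed.

(** The two variables of a leaf occur in its own factor only, as it has no
    children among the remaining vertices. The exponential left by
    [edge_integral] is the Schur complement at the parent. *)
Lemma nint_tree_leaf v l : tree_order (v :: l) -> 1 / 2 < s v ->
  exists2 K : R, 0 < K & forall (D c : nat -> R) e, 0 < D v ->
  (nint [:: bv v; v]
    (fun e => (tree_density (unpivot D c (v :: l)) c (v :: l) e)%:E) e
   = (K * D v `^ (- s v))%:E * (tree_density (unpivot D c l) c l e)%:E)%E.
Proof.
move=> tvl sv; have [K K0 hK] := edge_integral sv; exists K => // D c e Dv0.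
have /= /and4P[vl pv bl /and3P[bb vb tl]] := tvl.
have vr : v != r by move: vl; rewrite inE negb_or => /andP[].
have vnl : v \notin l by move: vl; rewrite inE negb_or => /andP[].
have [br bv_v bnl] : [/\ bv v != r, bv v != v & bv v \notin l].
  by move: bl; rewrite !inE !negb_or => /and3P[].
have pvv : p v != v.
  by apply: contraNneq vl => {1}<-.
have Dv : unpivot D c (v :: l) v = D v.
  rewrite /unpivot big_seq_cond big_pred0 ?addr0// => i; apply/negbTE.
  rewrite negb_and -implybE; apply/implyP; rewrite inE => /predU1P[->//|il].
  by apply: contraNneq vl => <-; exact: tree_order_closed il.
set d := unpivot D c (v :: l); rewrite -/d in Dv.
have fE x z : tree_density d c (v :: l) (upd (upd e (bv v) x) v z) =
    tree_density d c l e * edge_fun (s v) (D v) (c v) (e (p v)) z x.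
  have eu u : u \in r :: l -> upd (upd e (bv v) x) v z u = e u.
    move=> url; rewrite /upd ifN; last by apply: contraNneq vl => <-.
    rewrite ifN//; apply: contraTneq url => ->.
    by rewrite inE negb_or br bnl.
  rewrite /tree_density big_cons Dv eu ?mem_head//.
  rewrite [in LHS]mulrA [LHS]mulrAC; congr (_ * _ * _).
    rewrite !big_seq; apply: eq_bigr => u ul.
    rewrite (eu u) ?inE ?ul ?orbT// (eu (p u)); last exact: tree_order_closed ul.
    congr edge_fun; rewrite /upd ifN; last first.
      by apply: contraNneq vb => <-; exact: map_f.
    by rewrite ifN//; apply: contraNneq bb => <-; exact: map_f.
  by rewrite eu// /upd eqxx (negbTE bv_v) eqxx.
rewrite /nint.
under eq_integral => x _ do under eq_integral => z _ do rewrite fE EFinM.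
have m1 x : measurable_fun setT (fun z : measurableTypeR R => (edge_fun (s v) (D v) (c v) (e (p v)) z x)%:E).
  by apply/measurable_EFinP; exact: measurable_edge_fun.
have m2 : measurable_fun setT (fun xz : measurableTypeR R * measurableTypeR R =>
    (edge_fun (s v) (D v) (c v) (e (p v)) xz.2 xz.1)%:E).
  apply/measurable_EFinP; apply: measurable_edge_fun => //.
have e0 x z : (0 <= (edge_fun (s v) (D v) (c v) (e (p v)) z x)%:E)%E.
  by rewrite lee_fin edge_fun_ge0.
under eq_integral.
  move=> x _; rewrite ge0_integralZl ?lee_fin ?tree_density_ge0//; over.
rewrite ge0_integralZl ?lee_fin ?tree_density_ge0//; last first.
- by move=> x _; exact: integral_ge0.
- exact: (@measurable_fun_fubini_tonelli_F _ _ _ _ R leb _ m2 (fun xz => e0 xz.1 xz.2)).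
have [ep0|ep0] := leP (e (p v)) 0.
  by rewrite !(@tree_density0 _ _ _ (p v))// mul0e mule0.
rewrite hK// -!EFinM; congr EFin.
rewrite -(tree_density_shift (unpivot D c l) c (c v ^+ 2 / D v) e tl pv).
rewrite (_ : (fun j => _) = d); last first.
  by apply/funext => j; rewrite /d unpivot_cons.
by rewrite mulrCA !mulrA.
Qed.

(** Elimination of all leaves ends in the gamma integral at the root;
    stated in terms of the pivots D, each step contributes one factor of
    the product. *)
Lemma nint_tree l : tree_order l -> 0 < s r -> (forall v : nat, v \in l -> 1 / 2 < s v) ->
  exists2 K : R, 0 < K & forall (D c : nat -> R) e, (forall v, v \in r :: l -> 0 < D v) ->
  nint (tree_vars l) (fun e => (tree_density (unpivot D c l) c l e)%:E) e
   = (K * \prod_(v <- r :: l) D v `^ (- s v))%:E.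
Proof.
move=> + sr; elim: l => [_ _|v l IH tvl sv].
  have [K K0 hK] := gamma_integral sr; exists K => // D c e D0 /=.
  rewrite big_seq1 -hK ?D0 ?mem_head//; apply: eq_integral => x _.
  by rewrite /tree_density /unpivot !big_nil addr0 mulr1 /upd eqxx.
have tl : tree_order l by case/and4P : tvl => _ _ _ /and3P[].
have [K1 K10 hK1] := IH tl (fun u ul => sv u (mem_behead (s := v :: l) ul)).
have [K2 K20 hK2] := nint_tree_leaf tvl (sv _ (mem_head _ _)).
exists (K1 * K2); first exact: mulr_gt0.
move=> D c e D0; have Dv0 : 0 < D v by apply: D0; rewrite !inE eqxx orbT.
rewrite nint_cat (eq_nint _ _ (fun e1 => hK2 D c e1 Dv0)).
rewrite nintZl//; last 3 first.
- by rewrite mulr_ge0 ?powR_ge0 ?ltW.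
- by move=> e'; rewrite lee_fin tree_density_ge0.
- exact: tree_density_measurable.
rewrite hK1 -?EFinM; last first.
  by move=> u; rewrite inE => /predU1P[->|ul]; apply: D0; rewrite !inE ?eqxx// ul !orbT.
by congr EFin; rewrite !big_cons; ring.
Qed.

End elimination.

(** * The path as a rooted tree *)

Section path_order.
Variables (n r : nat).
Hypothesis rn : (r < n)%N.

Definition parent (v : nat) : nat := if (v < r)%N then v.+1 else v.-1.
(** The position, in the coordinates of I_G, of the entry on the edge from
    v to its parent: the n diagonal entries come first. *)
Definition edge_var (v : nat) : nat := n + minn v (parent v).
Definition leaves_first : seq nat := rev (iota r.+1 (n - r.+1)) ++ iota 0 r.

Lemma edge_varE v : edge_var v = (n + if (v < r)%N then v else v.-1)%N.
Proof. by rewrite /edge_var /parent; case: ifP => _; congr addn; lia. Qed.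

Lemma mem_leaves_first v : (v \in leaves_first) = (v < n)%N && (v != r).
Proof. by rewrite mem_cat mem_rev !mem_iota; lia. Qed.

Lemma tree_order_left k m : (k + m = r)%N ->
  tree_order r parent edge_var (iota k m).
Proof.
elim: m k => // m IH k km /=; have kr : (k < r)%N by lia.
rewrite IH ?addSnnS// andbT !inE !negb_or !mem_iota /parent kr.
apply/and5P; split; rewrite ?edge_varE ?kr; [lia|lia|lia| |].
- by apply/mapP => -[u]; rewrite mem_iota edge_varE; case: ifP; lia.
- by apply/mapP => -[u]; rewrite mem_iota edge_varE; case: ifP; lia.
Qed.

Lemma tree_order_leaves_first : tree_order r parent edge_var leaves_first.
Proof.
have : (r + (n - r.+1) < n)%N by lia.
rewrite /leaves_first; elim: (n - r.+1)%N => [_|m IH rmn].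
  by rewrite /=; exact: tree_order_left.
rewrite -[m.+1]addn1 iotaD rev_cat /= IH ?andbT; last by lia.
rewrite !inE !negb_or !mem_cat !mem_rev !mem_iota.
have vr : (r.+1 + m < r)%N = false by lia.
rewrite edge_varE /parent vr.
apply/and5P; split; [lia|lia|lia| |].
- apply/mapP => -[u]; rewrite mem_cat mem_rev !mem_iota edge_varE.
  by case: ifP; lia.
- apply/mapP => -[u]; rewrite mem_cat mem_rev !mem_iota edge_varE.
  by case: ifP; lia.
Qed.

Lemma perm_tree_vars (p bv : nat -> nat) l :
  perm_eq (tree_vars r bv l) (r :: l ++ map bv l).
Proof.
elim: l => //= v l /permP IH; apply/permP => P.
by rewrite count_cat IH /= !count_cat /=; lia.
Qed.

(** The variables of the nested integral are exactly all coordinates of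
    I_G, each used once. *)
Lemma perm_leaves_first :
  perm_eq (iota 0 (n + n.-1)) (tree_vars r edge_var leaves_first).
Proof.
rewrite perm_sym (perm_trans (perm_tree_vars parent _ _))// iotaD add0n.
rewrite -cat_cons perm_cat//.
  apply: uniq_perm.
  - rewrite /= mem_leaves_first eqxx andbF/=.
    exact: tree_order_uniq tree_order_leaves_first.
  - exact: iota_uniq.
  - by move=> v; rewrite inE mem_leaves_first mem_iota; lia.
have mapL : map edge_var (iota 0 r) = iota n r.
  rewrite -[in RHS](addn0 n) iotaDl; apply/eq_in_map => v.
  by rewrite mem_iota edge_varE => /= ->.
have mapR : map edge_var (iota r.+1 (n - r.+1)) = iota (n + r) (n - r.+1).
  apply: (@eq_from_nth _ 0) => [|i]; rewrite size_map !size_iota// => h.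
  rewrite (nth_map 0) ?size_iota// !nth_iota// edge_varE; case: ifP; lia.
apply/permP => P; rewrite /leaves_first map_cat map_rev mapL mapR.
have -> : n.-1 = (r + (n - r.+1))%N by lia.
by rewrite iotaD !count_cat count_rev addnC.
Qed.

End path_order.

(** * Moments from the moment generating function *)

Section moments.
Context d (T : measurableType d) (R : realType) (P : probability T R).
Variables (f : T -> R) (F F1 : R -> R) (F2 del : R).
Hypotheses (del0 : 0 < del) (mf : measurable_fun [set: T] f).
Hypothesis FE : forall t : R, `|t| < 4 * del -> (\int[P]_x (expR (t * f x))%:E = (F t)%:E)%E.
Hypothesis dF : forall t : R, `|t| < 4 * del -> is_derive t 1 F (F1 t).
Hypothesis dF1 : is_derive (0 : R) 1 F1 F2.

Local Notation I := (`](- del), del[%classic : set R).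

Let I_lt (t : R) : I t -> `|t| < del.
Proof. by rewrite /= in_itv/= ltr_norml. Qed.

Let I_lt4 (t : R) : I t -> `|t| < 4 * del.
Proof. by move=> /I_lt h; apply: lt_trans h _; rewrite ltr_pMl// ltr1n. Qed.

Let I0 : I 0. Proof. by rewrite /= in_itv/= oppr_lt0 del0. Qed.

Let measurable_expRM (t : R) : measurable_fun [set: T] (fun x => expR (t * f x)).
Proof. by apply: measurableT_comp => //; apply: measurable_funM. Qed.

Let integrable_expRM (t : R) : `|t| < 4 * del ->
  P.-integrable [set: T] (EFin \o (fun x => expR (t * f x))).
Proof.
move=> te; apply/integrableP; split.
  exact/measurable_EFinP.
under eq_integral do rewrite /= ger0_norm ?expR_ge0//.
by rewrite FE// ltry.
Qed.

(** A bound on |f|^k exp(t f), for k <= 2 and |t| < del, that does not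
    depend on t and is integrable because 3 del is within the domain of the
    moment generating function. *)
Definition moment_bound (c : R) (x : T) := c * (expR (3 * del * f x) + expR (- (3 * del) * f x)).

Local Notation G := moment_bound.

Let G_ge0 c x : 0 <= c -> 0 <= G c x.
Proof. by move=> c0; rewrite mulr_ge0// addr_ge0// expR_ge0. Qed.

Let integrable_G c : P.-integrable [set: T] (EFin \o G c).
Proof.
rewrite (_ : _ \o _ = (fun x => c%:E * ((expR (3 * del * f x))%:E +
    (expR (- (3 * del) * f x))%:E))%E); last first.
  by apply/funext => x /=; rewrite -EFinD -EFinM.
have h3 : `|3 * del| < 4 * del by rewrite gtr0_norm ?mulr_gt0// ltr_pM2r// ltr_nat.
apply: integrableZl => //; apply: integrableD => //; apply: integrable_expRM.
  exact: h3.
by rewrite normrN.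
Qed.

Let expR_le_G (a x : R) : 0 <= a -> expR (a * `|x|) <= expR (a * x) + expR (- a * x).
Proof.
move=> a0; have [x0|x0] := leP 0 x.
  by rewrite ger0_norm// lerDl expR_ge0.
by rewrite ltr0_norm// mulrN mulNr lerDr expR_ge0.
Qed.

Let pow_expR_le (k : nat) (t : R) x : (k <= 2)%N -> `|t| < del ->
  `|f x ^+ k * expR (t * f x)| <= G (del ^- k) x.
Proof.
move=> k2 tdel; rewrite normrM normrX (gtr0_norm (expR_gt0 _)).
have h1 : expR (t * f x) <= expR (del * `|f x|).
  rewrite ler_expR (le_trans (ler_norm _))// normrM.
  by rewrite ler_wpM2r// ltW.
have h2 : (del * `|f x|) ^+ k <= expR (del * `|f x|) ^+ k.
  rewrite lerXn2r ?nnegrE ?expR_ge0 ?mulr_ge0 ?(ltW del0)//.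
  by rewrite (le_trans _ (expR_ge1Dx _))// lerDr.
have h3 : expR (del * `|f x|) ^+ k <= expR (2 * (del * `|f x|)).
  rewrite -expRM_natl ler_expR ler_wpM2r ?mulr_ge0 ?(ltW del0)//.
  by rewrite ler_nat.
have h4 : del ^+ k * (`|f x| ^+ k * expR (t * f x)) <= expR (3 * del * `|f x|).
  rewrite mulrA -exprMn.
  have -> : 3 * del * `|f x| = 2 * (del * `|f x|) + del * `|f x| by ring.
  rewrite expRD ler_pM ?expR_ge0 ?exprn_ge0 ?mulr_ge0 ?(ltW del0)//.
  exact: le_trans h2 h3.
rewrite -ler_pdivlMl ?exprn_gt0// in h4.
apply: le_trans h4 _; rewrite /moment_bound ler_wpM2l ?invr_ge0 ?exprn_ge0 ?(ltW del0)//.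
by apply: expR_le_G; rewrite mulr_ge0// ltW.
Qed.

Let integrable_pow_expR (k : nat) (t : R) : (k <= 2)%N -> `|t| < del ->
  P.-integrable [set: T] (EFin \o (fun x => f x ^+ k * expR (t * f x))).
Proof.
move=> k2 td; apply: le_integrable (integrable_G (del ^- k)) => //.
  apply/measurable_EFinP; apply: measurable_funM => //.
  exact: measurable_funX.
move=> x _ /=; rewrite lee_fin (le_trans (pow_expR_le x k2 td))//.
exact: ler_norm.
Qed.

Let is_derive_pow_expR (k : nat) x (t : R) :
  is_derive t 1 (fun t => f x ^+ k * expR (t * f x)) (f x ^+ k.+1 * expR (t * f x)).
Proof.
apply: is_derive_eq.
rewrite /GRing.scale/= exprS; ring.
Qed.

Let derive_moment (k : nat) (t : R) : (k <= 1)%N -> I t ->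
  derive1 (fun t => \int[P]_(x in [set: T]) (f x ^+ k * expR (t * f x)))%R t =
  (\int[P]_x (f x ^+ k.+1 * expR (t * f x)))%R.
Proof.
move=> k1 It.
have k2 : (k <= 2)%N by exact: leq_trans k1 _.
pose h t x := f x ^+ k * expR (t * f x).
have pE u x : partial1of2 h u x = f x ^+ k.+1 * expR (u * f x).
  by rewrite partial1of2E; have [_ ->] := is_derive_pow_expR k x u.
rewrite (@differentiation_under_integral R _ T P h setT measurableT t (- del) del It
   _ _ (G (del ^- k.+1)) _ (integrable_G _)).
- by apply: eq_Rintegral => x _; exact: pE.
- by move=> u Iu; apply: integrable_pow_expR => //; exact: I_lt.
- by move=> u x _ _; have [] := is_derive_pow_expR k x u.
- by move=> x; apply: G_ge0; rewrite invr_ge0 exprn_ge0 ?(ltW del0).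
- by move=> u x Iu _; rewrite pE; apply: pow_expR_le => //; exact: I_lt.
Qed.

Let near_I (t : R) : I t -> \forall u \near t, I u.
Proof. by move=> It; apply: near_in_itvoo; rewrite inE. Qed.

Let moment1 (t : R) : I t -> (\int[P]_x (f x ^+ 1 * expR (t * f x)))%R = F1 t.
Proof.
move=> It; rewrite -(derive_moment (k := 0))// derive1E.
have [_ <-] := dF (I_lt4 It).
apply: near_eq_derive => //; near=> u.
have Iu : I u by near: u; exact: near_I.
rewrite /Rintegral; under eq_integral do rewrite expr0 mul1r.
by rewrite FE//; exact: I_lt4.
Unshelve. all: end_near. Qed.

(** Two differentiations under the integral sign at 0. *)
Lemma mgf_moments : [/\ P.-integrable [set: T] (EFin \o f),
  P.-integrable [set: T] (EFin \o (fun x => f x ^+ 2)),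
  (\int[P]_x (f x)%:E = (F1 0)%:E)%E & (\int[P]_x (f x ^+ 2)%:E = F2%:E)%E].
Proof.
have d00 : `|0 : R| < del by rewrite normr0.
have i1 : P.-integrable [set: T] (EFin \o f).
  apply: eq_integrable (integrable_pow_expR (k := 1) isT d00) => // x _ /=.
  by rewrite mul0r expR0 mulr1.
have i2 : P.-integrable [set: T] (EFin \o (fun x => f x ^+ 2)).
  apply: eq_integrable (integrable_pow_expR (k := 2) isT d00) => // x _ /=.
  by rewrite mul0r expR0 mulr1.
split => //.
  rewrite -(moment1 I0) fineK; last first.
    by apply: integral_fune_fin_num => //; exact: integrable_pow_expR.
  by apply: eq_integral => x _; rewrite mul0r expR0 mulr1.
have := derive_moment (k := 1) isT I0.
rewrite derive1E (@near_eq_derive _ _ _ _ F1)//; last first.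
  by near=> u; apply: moment1; near: u; exact: near_I.
have [_ ->] := dF1 => ->; rewrite fineK.
  by apply: eq_integral => x _; rewrite mul0r expR0 mulr1.
by apply: integral_fune_fin_num => //; exact: integrable_pow_expR.
Unshelve. all: end_near. Qed.

End moments.

(** * Descendants in the rooted path *)

Section path_tree.
Variables (n : nat) (r : 'I_n).

Definition par (i j : 'I_n) : bool := (i != r) && (parent r i == j :> nat).
(** i belongs to the subtree hanging at j, i itself included when i = j. *)
Definition desc (i j : 'I_n) : bool := (i <= j <= r)%N || (r <= j <= i)%N.
Definition path_depth (i : 'I_n) : nat := ((i - r) + (r - i))%N.

Lemma descE i j : desc i j = (i <= j <= r)%N || (r <= j <= i)%N.
Proof. by []. Qed.

Lemma parE i j : par i j =
  ((i < r) && (j == i.+1 :> nat) || (r < i) && (i == j.+1 :> nat))%N.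
Proof. by rewrite /par -val_eqE /parent /=; case: ifP; lia. Qed.

Lemma par_depth i j : par i j -> path_depth i = (path_depth j).+1.
Proof. by rewrite parE /path_depth; lia. Qed.

Lemma par_inj i j k : par i j -> par i k -> j = k.
Proof. by rewrite !parE => ij ik; apply/val_inj => /=; lia. Qed.

Lemma par_neq i j : par i j -> i != j.
Proof. by rewrite parE -val_eqE /=; lia. Qed.

Lemma parN i j : par i j -> par j i = false.
Proof. by rewrite !parE; lia. Qed.

Lemma par_root j : par r j = false.
Proof. by rewrite /par eqxx. Qed.

Lemma parP i : i != r -> exists j, par i j.
Proof.
move=> ir; have pn : (parent r i < n)%N.
  by rewrite /parent; case: ifP => [/leq_ltn_trans->//|_]; have := ltn_ord i; lia.
by exists (Ordinal pn); rewrite /par ir/=.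
Qed.

Lemma par_edge i j : par i j -> edge i j.
Proof. by rewrite parE /edge; lia. Qed.

Lemma edge_sym i j : @edge n i j = edge j i.
Proof. by rewrite /edge andbC. Qed.

Lemma edge_par i j : edge i j = [|| i == j, par i j | par j i].
Proof. by rewrite /edge !parE -val_eqE /=; lia. Qed.

Lemma desc_refl i : desc i i.
Proof. by rewrite /desc; lia. Qed.

Lemma desc_par i j k : par i j -> desc i k = (i == k) || desc j k.
Proof. by rewrite parE /desc -val_eqE /=; lia. Qed.

Lemma desc_root j : desc r j = (r == j).
Proof. by rewrite /desc -val_eqE /=; lia. Qed.

Lemma desc_anti i j : desc i j -> desc j i -> i = j.
Proof. by rewrite /desc => ij ji; apply/val_inj => /=; lia. Qed.

Lemma par_desc i j : par i j -> desc i j.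
Proof. by rewrite parE /desc; lia. Qed.

Lemma par_descN i j : par i j -> desc j i = false.
Proof. by rewrite parE /desc; lia. Qed.

Lemma depth_lt i : (path_depth i < n)%N.
Proof. by rewrite /path_depth; have := ltn_ord i; have := ltn_ord r; lia. Qed.

(** Turns sums over the strict descendants of k into sums over the subtrees
    of its children, the form in which the pivots are differentiated. *)
Lemma desc_childP j k : desc j k -> j != k ->
  exists2 i, par i k & desc j i /\ forall l, par l k -> desc j l -> l = i.
Proof.
move=> djk jk.
(* The child of k on the side of j: one step away from the root. *)
have inlt : ((if j < r then k.-1 else k.+1) < n)%N.
  have := ltn_ord k; have := ltn_ord j; have := ltn_ord r.
  by move: djk jk; rewrite -val_eqE /desc /=; case: ifP; lia.
exists (Ordinal inlt).
  by move: djk jk; rewrite -val_eqE /desc parE /=; case: ifP; lia.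
split; first by move: djk jk; rewrite -val_eqE /desc /=; case: ifP; lia.
move=> l; rewrite parE => lk jl; apply/val_inj => /=.
by move: djk jk lk jl; rewrite -val_eqE /desc /=; case: ifP; lia.
Qed.

Lemma desc_trans_par j l k : desc j l -> par l k -> desc j k.
Proof. by rewrite parE /desc; lia. Qed.

(** The only edge leaving the subtree at j joins j to its parent. *)
Lemma desc_edge_out l j k : desc l j -> edge l k -> ~~ desc k j ->
  l = j /\ par j k.
Proof.
rewrite parE /desc /edge => lj lk kj; split; last by lia.
by apply/val_inj => /=; lia.
Qed.

End path_tree.

(** * Triangular factorisations along the tree *)

Section tree_matrix.
Variables (R : realFieldType) (n : nat) (r : 'I_n).
Local Notation mx := 'M[R]_n.
Local Notation par := (par r).
Local Notation desc := (desc r).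
Local Notation depth := (path_depth r).

Definition par_supp (N : mx) := forall i j, ~~ par i j -> N i j = 0.

Definition dgm (d : 'I_n -> R) : mx := diag_mx (\row_i d i).

Lemma dgmE d i j : dgm d i j = if i == j then d i else 0.
Proof. by rewrite !mxE; case: eqP => [->|]; rewrite ?mulr1n ?mulr0n. Qed.

Lemma mul_dgm d (A : mx) i j : (dgm d *m A) i j = d i * A i j.
Proof. by rewrite mul_diag_mx mxE mxE. Qed.

Lemma mulmx_dgm d (A : mx) i j : (A *m dgm d) i j = A i j * d j.
Proof. by rewrite mul_mx_diag mxE mxE. Qed.

Lemma tr_dgm d : (dgm d)^T = dgm d.
Proof. by rewrite /dgm tr_diag_mx. Qed.

Lemma dgm_mul d e : dgm d *m dgm e = dgm (fun i => d i * e i).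
Proof.
apply/matrixP => i j; rewrite mul_dgm !dgmE.
by case: eqP => [->|]; rewrite ?mulr0.
Qed.

Lemma dgm1 : dgm (fun=> 1) = 1%:M.
Proof. by apply/matrixP => i j; rewrite dgmE !mxE; case: eqP. Qed.

Section unipotent.
Variable N : mx.
Hypothesis Ns : par_supp N.

Definition uni : mx := 1%:M + N.
Definition unV : mx := invmx uni.

Lemma par_mulmxE (A : mx) i k j : par i k -> (N *m A) i j = N i k * A k j.
Proof.
move=> ik; rewrite mxE (bigD1 k)//= big1 ?addr0// => l lk.
rewrite Ns ?mul0r//; apply: contra lk => il.
by rewrite (par_inj il ik).
Qed.

Lemma par_mulmx_root (A : mx) j : (N *m A) r j = 0.
Proof. by rewrite mxE big1// => l _; rewrite Ns ?mul0r// par_root. Qed.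

Lemma mulmx_uniE (A : mx) i k :
  (A *m uni) i k = A i k + \sum_(l | par l k) A i l * N l k.
Proof.
rewrite mulmxDr mulmx1 mxE; congr (_ + _).
rewrite mxE [LHS](bigID (fun l => par l k))/= [X in _ + X]big1 ?addr0// => l lk.
by rewrite Ns// mulr0.
Qed.

(** U is unitriangular with respect to the depth, so a vector in its kernel
    vanishes from the root downwards. *)
Lemma uni_unit : uni \in unitmx.
Proof.
rewrite -unitmx_tr -row_free_unit -kermx_eq0; apply/rowV0P => v /sub_kermxP.
move=> /(congr1 trmx); rewrite trmx_mul trmxK trmx0 => uv.
suff H : forall m i, (depth i <= m)%N -> v 0 i = 0.
  by apply/rowP => i; rewrite (H (depth i))// mxE.
elim=> [|m IH] i im.
  have -> : i = r by apply/val_inj; move: im; rewrite /path_depth /=; lia.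
  have := congr1 (fun w : 'cV_n => w r 0) uv.
  rewrite mulmxDl mul1mx !mxE big1 ?addr0// => l _.
  by rewrite Ns ?mul0r// par_root.
have [ir|/parP[k ik]] := eqVneq i r.
  by apply: IH; rewrite ir /path_depth /=; lia.
have := congr1 (fun w : 'cV_n => w i 0) uv.
rewrite mulmxDl mul1mx !mxE (bigD1 k)//= big1 ?addr0.
  have vk : v 0 k = 0 by apply: IH; move: im; rewrite (par_depth ik).
  by rewrite mxE vk mulr0 addr0.
move=> l lk; rewrite Ns ?mul0r//; apply: contra lk => il.
by rewrite (par_inj il ik).
Qed.

Lemma uniK : uni *m unV = 1%:M.
Proof. exact: mulmxV uni_unit. Qed.

Lemma unVK : unV *m uni = 1%:M.
Proof. exact: mulVmx uni_unit. Qed.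

Lemma unV_par i k j : par i k -> unV i j = (i == j)%:R - N i k * unV k j.
Proof.
move=> ik; have := congr1 (fun A : mx => A i j) uniK.
by rewrite mulmxDl mul1mx mxE (par_mulmxE _ _ ik) [RHS]mxE => <-; rewrite addrK.
Qed.

Lemma unV_root j : unV r j = (r == j)%:R.
Proof.
have := congr1 (fun A : mx => A r j) uniK.
by rewrite mulmxDl mul1mx mxE par_mulmx_root [RHS]mxE addr0.
Qed.

Lemma unV_desc i j : ~~ desc i j -> unV i j = 0.
Proof.
have [m] := ubnP (depth i); elim: m i => // m IH i im.
have [->|/parP[k ik]] := eqVneq i r.
  by rewrite desc_root unV_root => /negbTE->.
rewrite (unV_par _ ik) (desc_par _ ik) negb_or => /andP[/negbTE-> kj].
by rewrite IH ?mulr0 ?subr0// -ltnS; move: im; rewrite (par_depth ik) ltnS.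
Qed.

Lemma unV_diag i : unV i i = 1.
Proof.
have [->|/parP[k ik]] := eqVneq i r; first by rewrite unV_root eqxx.
by rewrite (unV_par _ ik) eqxx unV_desc ?mulr0 ?subr0// (par_descN ik).
Qed.

Variable D : 'I_n -> R.
Hypothesis D0 : forall i, 0 < D i.

Definition conc : mx := uni^T *m dgm D *m uni.
Definition cov (s : 'I_n -> R) : mx := unV *m dgm s *m unV^T.

Lemma conc_sym : conc^T = conc.
Proof. by rewrite /conc !trmx_mul trmxK tr_dgm mulmxA. Qed.

Lemma cov_sym s : (cov s)^T = cov s.
Proof. by rewrite /cov !trmx_mul trmxK tr_dgm mulmxA. Qed.

Lemma cov_conc s : cov s *m conc = unV *m dgm (fun i => s i * D i) *m uni.
Proof.
rewrite /cov /conc !mulmxA -(mulmxA _ unV^T) -trmx_mul uniK trmx1 mulmx1.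
by rewrite -(mulmxA unV) dgm_mul.
Qed.

Lemma cov_concV : cov (fun i => (D i)^-1) *m conc = 1%:M.
Proof.
rewrite cov_conc (_ : dgm _ = 1%:M) ?mulmx1 ?unVK// -dgm1; congr dgm.
by apply/funext => i; rewrite mulVf// gt_eqF.
Qed.

Lemma conc_unit : conc \in unitmx.
Proof. by have /mulmx1_unit[] := cov_concV. Qed.

Lemma invmx_conc : invmx conc = cov (fun i => (D i)^-1).
Proof.
by rewrite -[RHS]mulmx1 -(mulmxV conc_unit) mulmxA cov_concV mul1mx.
Qed.

Lemma invmx_cov : invmx (cov (fun i => (D i)^-1)) = conc.
Proof. by rewrite -invmx_conc invmxK. Qed.

Lemma concE j k : conc j k = (if j == k then D j else 0) + N k j * D k
  + D j * N j k + \sum_i N i j * D i * N i k.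
Proof.
have -> : conc = (1%:M + N^T) *m dgm D *m (1%:M + N).
  by congr (_ *m _ *m _); apply/matrixP => a b; rewrite !mxE eq_sym.
have BE i : ((1%:M + N^T) *m dgm D) j i = ((j == i)%:R + N i j) * D i.
  by rewrite mulmx_dgm !mxE.
rewrite mulmxDr mulmx1 mxE BE [X in _ + X]mxE.
under eq_bigr do rewrite BE mulrDl mulrDl.
rewrite big_split/= (bigD1 j)//= big1 ?addr0; last first.
  by move=> i /negbTE ij; rewrite eq_sym ij !mul0r.
rewrite eqxx mul1r mulrDl addrA; congr (_ + _ + _ + _).
by case: eqP => [->|_]; rewrite ?mul1r ?mul0r.
Qed.

Lemma conc_par j k : par j k -> conc j k = D j * N j k.
Proof.
move=> jk; rewrite concE (negbTE (par_neq jk)) add0r.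
rewrite (Ns (negbT (parN jk))) mul0r add0r big1 ?addr0// => i _.
have [ij|ij] := boolP (par i j); last by rewrite Ns// !mul0r.
rewrite [N i k]Ns ?mulr0//; apply/negP => ik.
by have := par_neq jk; rewrite (par_inj ij ik) eqxx.
Qed.

Lemma conc_diag k : conc k k = D k + \sum_(i | par i k) N i k ^+ 2 * D i.
Proof.
rewrite concE eqxx Ns ?mul0r ?mulr0 ?addr0; last first.
  by apply/negP => /par_neq; rewrite eqxx.
congr (_ + _); rewrite [LHS](bigID (fun i => par i k))/= [X in _ + X]big1 ?addr0.
  by apply: eq_bigr => i _; rewrite mulrAC expr2.
by move=> i ik; rewrite Ns// !mul0r.
Qed.

Lemma conc_nonedge j k : ~~ edge j k -> conc j k = 0.
Proof.
rewrite (edge_par r) !negb_or => /and3P[/negbTE jk pjk pkj].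
rewrite concE jk !Ns// mul0r mulr0 !add0r big1// => i _.
have [ij|ij] := boolP (par i j); last by rewrite Ns// !mul0r.
rewrite [N i k]Ns ?mulr0//; apply/negP => ik.
by move: jk; rewrite (par_inj ij ik) eqxx.
Qed.

End unipotent.
End tree_matrix.

(** * Uniqueness of the positive definite completion *)

Section positive_definite.
Variables (R : realType) (n : nat) (r : 'I_n).
Local Notation mx := 'M[R]_n.
Local Notation par := (par r).
Local Notation desc := (desc r).
Local Notation depth := (path_depth r).

Lemma quadE (A : mx) (x : 'cV[R]_n) :
  (x^T *m A *m x) 0 0 = \sum_i \sum_j x i 0 * A i j * x j 0.
Proof.
rewrite mxE exchange_big/=; apply: eq_bigr => j _.
by rewrite mxE mulr_suml; apply: eq_bigr => i _; rewrite mxE.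
Qed.

Lemma quad_conc (N : mx) (D : 'I_n -> R) (x : 'cV[R]_n) :
  (x^T *m conc N D *m x) 0 0 = \sum_i D i * (uni N *m x) i 0 ^+ 2.
Proof.
rewrite /conc !mulmxA -trmx_mul -(mulmxA _ (uni N)) mxE.
apply: eq_bigr => i _; set w := uni N *m x.
rewrite mxE (bigD1 i)//= big1 ?addr0.
  by rewrite dgmE eqxx [w^T _ _]mxE expr2; ring.
by move=> j ji; rewrite dgmE (negbTE ji) mulr0.
Qed.

Section decomposition.
Variables (N : mx) (D : 'I_n -> R).
Hypotheses (Ns : par_supp r N) (D0 : forall i, 0 < D i).

Lemma conc_posdef : posdef (conc N D).
Proof.
split=> [|x x0]; first exact: conc_sym.
rewrite quad_conc lt_def sumr_ge0 ?andbT; last first.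
  by move=> i _; rewrite mulr_ge0 ?sqr_ge0// ltW.
apply: contra x0; rewrite psumr_eq0; last first.
  by move=> i _; rewrite mulr_ge0 ?sqr_ge0// ltW.
move=> /allP ux; have {}ux : uni N *m x = 0.
  apply/matrixP => i j; rewrite ord1 [RHS]mxE; apply/eqP.
  have := ux i (mem_index_enum _); rewrite mulf_eq0 sqrf_eq0.
  by rewrite gt_eqF.
by rewrite -(mul1mx x) -(unVK Ns) -mulmxA ux mulmx0.
Qed.

Lemma conc_PG : PG (conc N D).
Proof.
split; last exact: conc_posdef.
split; first exact: conc_sym.
by move=> i j; exact: (conc_nonedge Ns).
Qed.

End decomposition.

Lemma posdef_unit (A : mx) : posdef A -> A \in unitmx.
Proof.
move=> [As A0]; rewrite -unitmx_tr -row_free_unit -kermx_eq0.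
apply/rowV0P => v /sub_kermxP vA; apply/eqP; apply: contraT => v0.
have vT : v^T != 0 by apply: contra v0 => /eqP h; rewrite -(trmxK v) h trmx0.
have := A0 _ vT; rewrite trmxK.
by rewrite As in vA; rewrite vA mul0mx mxE ltxx.
Qed.

Lemma posdef_inv (A : mx) : posdef A -> posdef (invmx A).
Proof.
move=> pA; have Au := posdef_unit pA; have [As A0] := pA.
split; first by rewrite trmx_inv As.
move=> x x0; have y0 : invmx A *m x != 0.
  apply: contra x0 => /eqP h.
  by rewrite -(mul1mx x) -(mulmxV Au) -mulmxA h mulmx0.
have := A0 _ y0; rewrite trmx_mul trmx_inv As -!mulmxA mulKVmx//.
Qed.

Lemma posdef_cov (N : mx) (s : 'I_n -> R) : par_supp r N ->
  (forall i, 0 < s i) -> posdef (cov N s).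
Proof.
move=> Ns s0; rewrite (_ : s = fun i => (s i)^-1^-1); last first.
  by apply/funext => i; rewrite invrK.
rewrite -(invmx_conc Ns) => [|i]; last by rewrite invr_gt0.
by apply: posdef_inv; apply: conc_posdef => // i; rewrite invr_gt0.
Qed.

Lemma quad_delta (A : mx) i j :
  ((delta_mx i 0 : 'cV[R]_n)^T *m A *m (delta_mx j 0 : 'cV_n)) 0 0 = A i j.
Proof. by rewrite trmx_delta -rowE -colE !mxE. Qed.

Lemma quad_delta2 (A : mx) i j (a b : R) : A^T = A ->
  let x : 'cV[R]_n := a *: delta_mx i 0 + b *: delta_mx j 0 in
  (x^T *m A *m x) 0 0 = a ^+ 2 * A i i + 2 * a * b * A i j + b ^+ 2 * A j j.
Proof.
move=> As x; have Aji : A j i = A i j by rewrite -[in LHS]As mxE.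
have tE : x^T = a *: (delta_mx i 0 : 'cV[R]_n)^T + b *: (delta_mx j 0 : 'cV[R]_n)^T.
  by apply/matrixP => k l; rewrite !mxE.
rewrite tE /x !mulmxDl !mulmxDr -!scalemxAl -!scalemxAr.
set d1 := delta_mx i 0; set d2 := delta_mx j 0.
rewrite [LHS]mxE [X in X + _]mxE [X in _ + X]mxE.
rewrite !(mxE scalemx_key) /d1 /d2 !quad_delta Aji; ring.
Qed.

Lemma posdef_diag (A : mx) i : posdef A -> 0 < A i i.
Proof.
move=> [As A0]; rewrite -quad_delta; apply: A0.
apply/eqP => /matrixP/(_ i 0)/eqP; rewrite !mxE !eqxx/=.
by rewrite oner_eq0.
Qed.

Lemma posdef_minor (A : mx) i j : posdef A -> i != j ->
  0 < A i i * A j j - A i j ^+ 2.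
Proof.
move=> pA ij; have [As A0] := pA; have jj := posdef_diag j pA.
(* On this vector the quadratic form is A j j times the minor. *)
pose x : 'cV[R]_n := A j j *: delta_mx i 0 + (- A i j) *: delta_mx j 0.
have x0 : x != 0.
  apply/eqP => /matrixP/(_ i 0)/eqP; rewrite !mxE !eqxx (negbTE ij)/=.
  by rewrite mulr0 addr0 mulr1 gt_eqF.
have := A0 x x0; rewrite quad_delta2// => h.
rewrite -(pmulr_rgt0 _ jj); apply: lt_le_trans h _.
by rewrite le_eqVlt; apply/orP; left; apply/eqP; ring.
Qed.

(** The difference of two completions of the same incomplete matrix pairs
    to zero with the difference of their inverses, which lies in [Z_G];
    this trace is negative unless the completions coincide. *)
Lemma cov_unique (N : mx) (D : 'I_n -> R) (A : mx) :
  par_supp r N -> (forall i, 0 < D i) ->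
  posdef A -> ZG (invmx A) -> piG A = piG (cov N (fun i => (D i)^-1)) ->
  A = cov N (fun i => (D i)^-1).
Proof.
move=> Ns D0 pA [_ zA] piA; set B := cov _ _.
have Au := posdef_unit pA; have pK := posdef_inv pA.
set Del := A - B.
have Ds : Del^T = Del by rewrite /Del linearB/= (cov_sym N) pA.1.
have DelE i j : edge i j -> Del i j = 0.
  move=> ij; have := congr1 (fun M : mx => M i j) piA.
  by rewrite !mxE ij => ->; rewrite subrr.
have KD : \tr ((invmx A - conc N D) *m Del) = 0.
  rewrite /mxtrace big1// => i _; rewrite mxE big1// => j _.
  have [ij|ij] := boolP (edge i j); first by rewrite edge_sym in ij; rewrite (DelE _ _ ij) mulr0.
  by rewrite mxE zA// mxE (conc_nonedge Ns D)// subrr mul0r.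
have BK : B *m conc N D = 1%:M by exact: (cov_concV Ns D0).
have KB : conc N D *m B = 1%:M by exact: mulmx1C BK.
have KE : invmx A - conc N D = - (invmx A *m Del *m conc N D).
  by rewrite /Del mulmxBr mulmxBl mulVmx// mul1mx -mulmxA BK mulmx1 opprB.
have : \tr (invmx A *m Del *m conc N D *m Del) = 0.
  by apply/eqP; rewrite -oppr_eq0 -linearN/= -mulNmx -KE KD.
set w := uni N *m Del.
have -> : \tr (invmx A *m Del *m conc N D *m Del) =
    \sum_k D k * (row k w *m invmx A *m (row k w)^T) 0 0.
  rewrite /conc !mulmxA -mulmxA mxtrace_mulC -/w.
  have -> : w *m (invmx A *m Del *m (uni N)^T *m dgm D) =
      (w *m invmx A *m w^T) *m dgm D.
    by rewrite /w [X in _ = _ *m X *m _]trmx_mul Ds !mulmxA.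
  rewrite /mxtrace; apply: eq_bigr => k _.
  rewrite mulmx_dgm mulrC; congr (_ * _).
  rewrite -row_mul mxE [RHS]mxE; apply: eq_bigr => j _.
  by rewrite [(row k _) 0 j]mxE !mxE.
have q0 k : 0 <= (row k w *m invmx A *m (row k w)^T) 0 0.
  have [->|x0] := eqVneq (row k w) 0; first by rewrite !mul0mx mxE.
  rewrite -[X in X *m invmx A]trmxK ltW// pK.2//.
  by apply: contra x0 => /eqP h; rewrite -(trmxK (row k w)) h trmx0.
move/eqP; rewrite psumr_eq0 => [|k _]; last by rewrite mulr_ge0// ltW.
move=> /allP h; have w0 : w = 0.
  apply/row_matrixP => k; rewrite row0; apply/eqP; apply: contraT => x0.
  have := h k (mem_index_enum _); rewrite mulf_eq0 gt_eqF//=.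
  rewrite -[X in X *m invmx A]trmxK gt_eqF// pK.2//.
  by apply: contra x0 => /eqP e; rewrite -(trmxK (row k w)) e trmx0.
apply/eqP; rewrite -subr_eq0 -/Del -(mul1mx Del) -(unVK Ns) -mulmxA -/w w0.
by rewrite mulmx0.
Qed.

End positive_definite.

(** * Completion by regression, and pivots *)

Section completion.
Variables (R : realType) (n : nat) (r : 'I_n).
Local Notation mx := 'M[R]_n.
Local Notation par := (par r).
Local Notation desc := (desc r).
Local Notation depth := (path_depth r).

Definition tree_pos (m : mx) : Prop := m^T = m /\
  (forall i, 0 < m i i) /\ (forall i k, par i k -> 0 < m i i * m k k - m i k ^+ 2).

(** Together with [reg_var], the coefficients (with opposite sign) and
    residual variances in the regression of each vertex on its parent:
    completion makes the vertices a Gaussian Markov chain along the tree. *)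
Definition reg_coef (m : mx) : mx :=
  \matrix_(i, j) (if par i j then - (m i j / m j j) else 0).

Definition reg_var (m : mx) (i : 'I_n) : R :=
  m i i - \sum_(k | par i k) m i k ^+ 2 / m k k.

Lemma reg_coef_supp m : par_supp r (reg_coef m).
Proof. by move=> i j /negbTE ij; rewrite mxE ij. Qed.

Lemma reg_var_par m i k : par i k -> reg_var m i = m i i - m i k ^+ 2 / m k k.
Proof.
move=> ik; rewrite /reg_var (bigD1 k)//= big1 ?addr0// => l /andP[il].
by rewrite (par_inj il ik) eqxx.
Qed.

Lemma reg_var_root m : reg_var m r = m r r.
Proof. by rewrite /reg_var big1 ?subr0// => k; rewrite par_root. Qed.

Lemma reg_var_gt0 m i : tree_pos m -> 0 < reg_var m i.
Proof.
move=> [_ [m0 mm]]; have [->|/parP[k ik]] := eqVneq i r.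
  by rewrite reg_var_root.
by rewrite (reg_var_par _ ik) subr_gt0 ltr_pdivrMr// -subr_gt0; exact: mm.
Qed.

Definition completion (m : mx) : mx := cov (reg_coef m) (reg_var m).

Lemma completionC m i j : completion m i j = completion m j i.
Proof.
by rewrite -[in LHS](_ : (completion m)^T = completion m) ?mxE//; exact: cov_sym.
Qed.

Lemma completionE m i k j : par i k ->
  completion m i j = reg_var m i * unV (reg_coef m) j i +
    m i k / m k k * completion m k j.
Proof.
move=> ik; have Ns := reg_coef_supp m.
have : uni (reg_coef m) *m completion m = dgm (reg_var m) *m (unV (reg_coef m))^T.
  by rewrite /completion /cov !mulmxA (uniK Ns) mul1mx.
move=> /(congr1 (fun A : mx => A i j)).
rewrite mulmxDl mul1mx mxE (par_mulmxE Ns _ _ ik) mul_dgm [in RHS]mxE => <-.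
by rewrite [reg_coef m i k]mxE ik; ring.
Qed.

Lemma completion_par m i k : tree_pos m -> par i k ->
  completion m k k = m k k -> completion m i k = m i k.
Proof.
move=> [_ [m0 _]] ik ck; rewrite (completionE m k ik) ck.
rewrite (unV_desc (reg_coef_supp m)) ?(par_descN ik)// mulr0 add0r.
by rewrite divfK// gt_eqF.
Qed.

(** Induction from the root: the variance of a vertex is its residual
    variance plus the part explained by its parent. *)
Lemma completion_diag m i : tree_pos m -> completion m i i = m i i.
Proof.
move=> tm; have [d] := ubnP (depth i); elim: d i => // d IH i id.
have Ns := reg_coef_supp m.
have [->|/parP[k ik]] := eqVneq i r.
  have : uni (reg_coef m) *m completion m = dgm (reg_var m) *m (unV (reg_coef m))^T.
    by rewrite /completion /cov !mulmxA (uniK Ns) mul1mx.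
  move=> /(congr1 (fun A : mx => A r r)).
  rewrite mulmxDl mul1mx mxE (par_mulmx_root Ns) addr0 mul_dgm [in RHS]mxE.
  by rewrite (unV_diag Ns) mulr1 reg_var_root.
have ck : completion m k k = m k k.
  by apply: IH; move: id; rewrite (par_depth ik).
have := completion_par tm ik ck.
rewrite (completionE m i ik) (completionC m k) (unV_diag Ns) mulr1 => ->.
rewrite (reg_var_par _ ik) -addrA; apply/eqP; rewrite addrC -subr_eq0; apply/eqP.
by field; rewrite gt_eqF//; case: tm => _ [].
Qed.

Lemma piG_completion m : tree_pos m -> piG (completion m) = piG m.
Proof.
move=> tm; apply/matrixP => i j; rewrite [LHS]mxE [RHS]mxE (edge_par r).
have pE a b : par a b -> completion m a b = m a b.
  by move=> ab; apply: completion_par => //; exact: completion_diag.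
case: eqP => [->|_] /=; first by rewrite completion_diag.
case: ifP => // /orP[ij|ji]; first exact: pE.
by rewrite completionC pE// -[in RHS](tm.1) mxE.
Qed.

Lemma posdef_tree_pos (A : mx) : posdef A -> tree_pos A.
Proof.
move=> pA; split; first exact: pA.1.
split=> [i|i k /par_neq ik]; [exact: posdef_diag | exact: posdef_minor].
Qed.

Definition tree_coef (y : mx) (D : 'I_n -> R) : mx :=
  \matrix_(i, j) (if par i j then y i j / D i else 0).

Lemma tree_coef_supp y D : par_supp r (tree_coef y D).
Proof. by move=> i j /negbTE ij; rewrite mxE ij. Qed.

Definition pivots (y : mx) (D : 'I_n -> R) : Prop :=
  forall k, y k k = D k + \sum_(i | par i k) y i k ^+ 2 / D i.

Lemma conc_pivots (N : mx) D : par_supp r N -> (forall i, D i != 0) ->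
  pivots (conc N D) D /\ tree_coef (conc N D) D = N.
Proof.
move=> Ns D0; split.
  move=> k; rewrite (conc_diag Ns); congr (_ + _); apply: eq_bigr => i ik.
  by rewrite (conc_par Ns)//; field.
apply/matrixP => i j; rewrite mxE; case: ifPn => ij; last by rewrite Ns.
by rewrite (conc_par Ns)// mulrC mulKf.
Qed.

(** Every [y] in [P_G] eliminates with positive pivots: its inverse and the
    completion built from the entries of that inverse on the edges are two
    completions of the same incomplete matrix. *)
Lemma PG_pivots (y : mx) : PG y -> exists2 D, forall i, 0 < D i & pivots y D.
Proof.
move=> [yZ py]; pose A := invmx y.
have pA : posdef A by exact: posdef_inv.
have tA := posdef_tree_pos pA.
(* The pivots of a matrix are the inverses of the residual variances of its
   inverse. *)
pose D i := (reg_var A i)^-1.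
have D0 i : 0 < D i by rewrite invr_gt0 reg_var_gt0.
have Ns := reg_coef_supp A.
have cE : cov (reg_coef A) (fun i => (D i)^-1) = completion A.
  by congr cov; apply/funext => i; rewrite invrK.
have AE : A = cov (reg_coef A) (fun i => (D i)^-1).
  apply: (cov_unique Ns D0 pA); first by rewrite invmxK.
  by rewrite cE piG_completion.
exists D => //; have -> : y = conc (reg_coef A) D.
  by rewrite -(invmx_cov Ns D0) -AE invmxK.
by have [] := conc_pivots Ns (fun i => lt0r_neq0 (D0 i)).
Qed.

Lemma piG_id (m : mx) : ZG m -> piG m = m.
Proof.
move=> [_ mz]; apply/matrixP => i j; rewrite mxE.
by case: ifPn => // /mz ->.
Qed.

Lemma hat_cov (N : mx) D : par_supp r N -> (forall i, 0 < D i) ->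
  hat (piG (cov N (fun i => (D i)^-1))) = cov N (fun i => (D i)^-1).
Proof.
move=> Ns D0; set B := cov _ _.
have DV0 i : 0 < (D i)^-1 by rewrite invr_gt0.
have [pA [piA [zA _]]] : posdef (hat (piG B)) /\ piG (hat (piG B)) = piG B /\
    PG (invmx (hat (piG B))).
  rewrite /hat; case: xgetP => [A _ //|/(_ B)]; case; split.
    exact: (posdef_cov Ns).
  by split=> //; rewrite (invmx_cov Ns D0); exact: (conc_PG Ns D0).
exact: (cov_unique Ns D0).
Qed.

End completion.

(** * Directions in the coordinates of the factorisation *)

Section pulled_back.
Variables (R : realType) (n : nat) (r : 'I_n).
Local Notation mx := 'M[R]_n.
Local Notation par := (par r).
Local Notation desc := (desc r).

Lemma desc_sum (F : 'I_n -> R) k :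
  \sum_(j | desc j k && (j != k)) F j = \sum_(i | par i k) \sum_(j | desc j i) F j.
Proof.
rewrite (exchange_big_dep (fun j => desc j k && (j != k)))/=; last first.
  move=> i j ik ji; rewrite (desc_trans_par ji ik)/=.
  by apply: contraL ji => /eqP->; rewrite (par_descN ik).
apply: eq_bigr => j /andP[jk jnk].
have [i ik [ji iuniq]] := desc_childP jk jnk.
rewrite (bigD1 i)/= ?ik// big1 ?addr0// => l /andP[/andP[lk jl]].
by rewrite (iuniq _ lk jl) eqxx.
Qed.

Variables (N z : mx).
Hypotheses (Ns : par_supp r N) (zZ : ZG z).

(** The direction z in the coordinates in which conc N D becomes the
    diagonal matrix D. *)
Definition pull : mx := (unV N)^T *m z *m unV N.

Lemma pullC i j : pull i j = pull j i.
Proof.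
rewrite -[in LHS](_ : pull^T = pull) ?mxE//.
by rewrite /pull !trmx_mul trmxK zZ.1 mulmxA.
Qed.

(** The sum defining the entry runs over the subtree at j, and z only has
    entries on edges: by [desc_edge_out] at most the edge from j to its
    parent can leave the subtree. *)
Lemma trV_mulE j k : ~~ desc k j ->
  ((unV N)^T *m z) j k = if par j k then z j k else 0.
Proof.
move=> kj; rewrite mxE.
have T0 l : l != j -> (unV N)^T j l * z l k = 0.
  move=> lj; rewrite mxE.
  have [dl|dl] := boolP (desc l j); last by rewrite (unV_desc Ns)// mul0r.
  have [el|/zZ.2 ->] := boolP (edge l k); last by rewrite mulr0.
  by have [ljE _] := desc_edge_out dl el kj; rewrite ljE eqxx in lj.
rewrite (bigD1 j)//= big1 ?addr0 => [|l lj]; last exact: T0.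
rewrite mxE (unV_diag Ns) mul1r; case: ifPn => // jk.
have [el|/zZ.2 //] := boolP (edge j k).
have [_ jk'] := desc_edge_out (desc_refl r j) el kj.
by rewrite jk' in jk.
Qed.

Lemma pull_uniE j k :
  pull j k + \sum_(l | par l k) pull j l * N l k = ((unV N)^T *m z) j k.
Proof.
by rewrite -(mulmx_uniE Ns) /pull -mulmxA (unVK Ns) mulmx1.
Qed.

(** Induction on k from the leaves upwards, comparing T^T z T U with T^T z
    in column k. *)
Lemma pull_incomparable j k : ~~ desc j k -> ~~ desc k j -> pull j k = 0.
Proof.
move=> + +; have [d] := ubnP (n - path_depth r k).
elim: d k => // d IH k kd jk kj.
have := pull_uniE j k; rewrite trV_mulE//.
rewrite ifN; last by apply: contra jk => /par_desc.
rewrite big1 ?addr0// => l lk; rewrite IH ?mul0r//.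
- have := par_depth lk; have := depth_lt r l; move: kd; lia.
- by apply: contra jk => jl; exact: desc_trans_par jl lk.
- rewrite (desc_par _ lk) negb_or kj andbT.
  by apply: contra jk => /eqP <-; exact: par_desc.
Qed.

Lemma pull_step j i k : par i k -> desc j i ->
  pull j k = (if j == i then z i k else 0) - N i k * pull j i.
Proof.
move=> ik ji; have := pull_uniE j k.
have kj : ~~ desc k j.
  apply/negP => kj; have jk := desc_trans_par ji ik.
  have kE := desc_anti kj jk; move: ji; rewrite -kE (par_descN ik).
  by [].
rewrite trV_mulE// (bigD1 i)//= big1 ?addr0 => [|l /andP[lk li]].
  have -> : par j k = (j == i).
    apply/idP/eqP => [jk|->//].
    have jnk : j != k by exact: par_neq jk.
    have [i' _ [_ u]] := desc_childP (par_desc jk) jnk.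
    by rewrite (u j jk (desc_refl r j)) (u i ik ji).
  case: eqP => [->|_] <-; first by rewrite mulrC addrK.
  by rewrite mulrC addrK.
have jnk : j != k by apply: contraNneq kj => ->; exact: desc_refl.
have [i' _ [_ u]] := desc_childP (desc_trans_par ji ik) jnk.
have jl : ~~ desc j l.
  by apply: contra li => jl; rewrite (u l lk jl) (u i ik ji).
rewrite pull_incomparable ?mul0r//; apply/negP => lj.
have lk' : ~~ desc k j by [].
by move: li; rewrite (desc_par _ lk) (negbTE kj) orbF in lj; move/eqP: lj jl => ->; rewrite desc_refl.
Qed.

Lemma pull_parE i k : par i k -> pull i k = z i k - N i k * pull i i.
Proof. by move=> ik; rewrite (pull_step ik (desc_refl r i)) eqxx. Qed.

(** The linearised form of the recursion of the pivots, as [is_derive_piv]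
    shows. *)
Lemma pull_diag k : pull k k = z k k -
  \sum_(i | par i k) (2 * N i k * z i k - N i k ^+ 2 * pull i i).
Proof.
have := pull_uniE k k.
have -> : ((unV N)^T *m z) k k = z k k - \sum_(l | par l k) N l k * z l k.
  have -> : ((unV N)^T *m z) k k = (z *m unV N) k k.
    rewrite -[in RHS](trmxK (z *m unV N)) [RHS]mxE trmx_mul zZ.1.
    by [].
  have : z *m unV N *m uni N = z by rewrite -mulmxA (unVK Ns) mulmx1.
  move=> /(congr1 (fun A : mx => A k k)); rewrite (mulmx_uniE Ns) => <-.
  rewrite [X in _ + X - _](_ : _ = \sum_(l | par l k) N l k * z l k) ?addrK//.
  apply: eq_bigr => l lk; rewrite mulrC; congr (_ * _).
  have lkN : ~~ desc k l by rewrite (par_descN lk).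
  have := trV_mulE lkN; rewrite lk => <-.
  rewrite -[in LHS](trmxK (z *m unV N)) [LHS]mxE trmx_mul zZ.1.
  by [].
move=> /(canRL (addrK _)) ->; rewrite -addrA -opprD -big_split/=.
congr (_ - _); apply: eq_bigr => i ik.
by rewrite pullC (pull_parE ik); ring.
Qed.

(** The quantity on the left, which is minus half the derivative of W_kk,
    obeys a recursion over children because [pull_step] carries column i to
    column k by the factor - N i k. *)
Lemma pull_below (D : 'I_n -> R) k :
  \sum_(j | desc j k && (j != k)) pull j k ^+ 2 / D j =
  \sum_(i | par i k) (pull i k ^+ 2 / D i + N i k ^+ 2 *
    \sum_(j | desc j i && (j != i)) pull j i ^+ 2 / D j).
Proof.
rewrite desc_sum; apply: eq_bigr => i ik.
rewrite (bigD1 i) ?desc_refl//=; congr (_ + _).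
rewrite mulr_sumr; apply: eq_bigr => j /andP[ji jni].
rewrite (pull_step ik ji) (negbTE jni) sub0r sqrrN exprMn.
by rewrite mulrA.
Qed.

End pulled_back.

(** * Derivatives of the pivots *)

Section derivative_toolbox.
Variable R : realType.

Lemma is_derive_sum_cond (I : finType) (P : pred I) (h : I -> R -> R) (dh : I -> R) (x : R) :
  (forall i, P i -> is_derive x 1 (h i) (dh i)) ->
  is_derive x 1 (fun t => \sum_(i | P i) h i t) (\sum_(i | P i) dh i).
Proof.
move=> hd; rewrite (_ : (fun t => _) = (\sum_(i | P i) h i)); last first.
  by apply/funext => t; rewrite fct_sumE.
apply: (big_ind2 (fun (f : R -> R) df => is_derive x 1 f df)) => //.
  exact: (is_derive_cst 0 x 1).
move=> f df g dg; exact: is_deriveD.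
Qed.

Lemma is_derive_div (f g : R -> R) (x df dg : R) : g x != 0 ->
  is_derive x 1 f df -> is_derive x 1 g dg ->
  is_derive x 1 (fun t => f t / g t) ((df - f x / g x * dg) / g x).
Proof.
move=> gx hf hg; have hV := is_deriveV gx hg.
apply: is_derive_eq (is_deriveM hf hV) _.
by rewrite /GRing.scale/=; field.
Qed.

Lemma is_derive_affine (a b x : R) : is_derive x 1 (fun t => a + t * b) b.
Proof.
have h := is_deriveD (is_derive_cst a x 1) (is_deriveM (is_derive_id x 1) (is_derive_cst b x 1)).
by apply: is_derive_eq h _; rewrite /GRing.scale/= add0r mulr0 add0r mulr1.
Qed.

Lemma is_derive_sqr (f : R -> R) (x df : R) : is_derive x 1 f df ->
  is_derive x 1 (fun t => f t ^+ 2) (2 * f x * df).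
Proof. by move=> hf; have := is_deriveX 2 hf; rewrite expr1. Qed.

Lemma is_derive_continuous (f : R -> R) (x df : R) : is_derive x 1 f df ->
  {for x, continuous f}.
Proof. by move=> [h _]; exact/differentiable_continuous/derivable1_diffP. Qed.

End derivative_toolbox.

Section pivot_recursion.
Variables (R : realType) (n : nat) (r : 'I_n).
Local Notation mx := 'M[R]_n.
Local Notation par := (par r).
Local Notation desc := (desc r).
Local Notation depth := (path_depth r).

(** A fuel of n suffices, since it exceeds the depth of the tree. *)
Fixpoint piv_rec (f : nat) (y : mx) (k : 'I_n) : R :=
  if f is f'.+1 then y k k - \sum_(i | par i k) y i k ^+ 2 / piv_rec f' y i
  else y k k.

Definition piv (y : mx) (k : 'I_n) : R := piv_rec n y k.

Lemma piv_rec_fuel f g y k : (n <= f + depth k)%N -> (n <= g + depth k)%N ->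
  piv_rec f y k = piv_rec g y k.
Proof.
elim: f g k => [|f IH] [|g] k //; rewrite ?add0n; have := depth_lt r k; try lia.
move=> _ hf hg /=; congr (_ - _); apply: eq_bigr => i ik.
by rewrite (IH g)//; rewrite (par_depth ik); lia.
Qed.

Lemma pivE y k : piv y k = y k k - \sum_(i | par i k) y i k ^+ 2 / piv y i.
Proof.
rewrite /piv; have nk : (n <= n + depth k)%N by lia.
have nSk : (n <= n.+1 + depth k)%N by lia.
by rewrite (piv_rec_fuel y nk nSk).
Qed.

(** The depth is bounded by n, so the passage from the children to their
    parent is well founded. *)
Lemma leaf_ind (P : 'I_n -> Prop) :
  (forall k, (forall i, par i k -> P i) -> P k) -> forall k, P k.
Proof.
move=> H k; have [d] := ubnP (n - depth k); elim: d k => // d IH k kd.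
apply: H => i ik; apply: IH; have := par_depth ik; have := depth_lt r i.
by move: kd; lia.
Qed.

Lemma pivots_uniq y D : pivots r y D -> D =1 piv y.
Proof.
move=> yD; apply: leaf_ind => k IH.
rewrite pivE yD -addrA -[LHS]addr0; congr (_ + _); apply/esym/eqP.
by rewrite subr_eq0; apply/eqP/eq_bigr => i /IH ->.
Qed.

Lemma PG_piv y k : PG y -> 0 < piv y k.
Proof. by move=> /(PG_pivots r)[D D0 /pivots_uniq <-]. Qed.

Section line.
Variables (y z : mx).
Hypothesis zZ : ZG z.

Definition line (t : R) : mx := y + t *: z.
Definition pull_line (t : R) : mx := pull (tree_coef r (line t) (piv (line t))) z.

Lemma lineE t i j : line t i j = y i j + t * z i j.
Proof. by rewrite !mxE. Qed.

Lemma is_derive_line (x : R) i j : is_derive x 1 (fun t => line t i j) (z i j).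
Proof.
rewrite (_ : (fun t => _) = fun t => y i j + t * z i j).
  exact: is_derive_affine.
by apply/funext => t; rewrite lineE.
Qed.

Lemma pull_lineE t k : pull_line t k k = z k k - \sum_(i | par i k)
   (2 * (line t i k / piv (line t) i) * z i k
    - (line t i k / piv (line t) i) ^+ 2 * pull_line t i i).
Proof.
rewrite /pull_line (pull_diag (tree_coef_supp _ _) zZ); congr (_ - _).
by apply: eq_bigr => i ik; rewrite mxE ik.
Qed.

(** Differentiating the recursion [pivE] gives the recursion [pull_diag]. *)
Lemma is_derive_piv (x : R) : (forall i, piv (line x) i != 0) ->
  forall k, is_derive x 1 (fun t => piv (line t) k) (pull_line x k k).
Proof.
move=> p0; apply: leaf_ind => k IH.
rewrite (_ : (fun t => _) = (fun t => line t k k -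
    \sum_(i | par i k) line t i k ^+ 2 / piv (line t) i)); last first.
  by apply/funext => t; rewrite pivE.
have H := is_derive_sum_cond (fun i ik =>
  is_derive_div (p0 i) (is_derive_sqr (is_derive_line x i k)) (IH i ik)).
apply: is_derive_eq (is_deriveB (is_derive_line x k k) H) _.
rewrite pull_lineE; congr (_ - _); apply: eq_bigr => i ik.
by field; exact: p0.
Qed.

Lemma near_piv_gt0 (x : R) : (forall i, 0 < piv (line x) i) ->
  \forall t \near x, forall i, 0 < piv (line t) i.
Proof.
move=> p0; apply: (@filter_forall _ _ (fun i => [set t | 0 < piv (line t) i]) (nbhs x) _) => i.
have p0' j : piv (line x) j != 0 by rewrite gt_eqF.
have c := is_derive_continuous (is_derive_piv p0' i).
by have := cvgr_gt _ c; apply.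
Qed.

(** Differentiating the recursion [pull_diag] gives the recursion
    [pull_below]. *)
Lemma is_derive_pull (x : R) : (forall i, 0 < piv (line x) i) ->
  forall k, is_derive x 1 (fun t => pull_line t k k)
    (- (2 * \sum_(j | desc j k && (j != k)) pull_line x j k ^+ 2 / piv (line x) j)).
Proof.
move=> p0.
have p0' j : piv (line x) j != 0 by rewrite gt_eqF.
apply: leaf_ind => k IH.
rewrite (_ : (fun t => _) = (fun t => z k k - \sum_(i | par i k)
   (2 * (line t i k / piv (line t) i) * z i k
    - (line t i k / piv (line t) i) ^+ 2 * pull_line t i i))); last first.
  by apply/funext => t; rewrite pull_lineE.
have dN i := is_derive_div (p0' i) (is_derive_line x i k) (is_derive_piv p0' i).
have H := is_derive_sum_cond (fun i ik =>
  is_deriveB (is_deriveM (is_deriveM (is_derive_cst (2 : R) x 1) (dN i)) (is_derive_cst (z i k) x 1))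
             (is_deriveM (is_derive_sqr (dN i)) (IH i ik))).
apply: is_derive_eq (is_deriveB (is_derive_cst (z k k) x 1) H) _.
rewrite sub0r; congr (- _).
rewrite (pull_below (tree_coef_supp _ _) zZ) mulr_sumr.
apply: eq_bigr => i ik.
rewrite -/(pull_line x) (pull_parE (tree_coef_supp _ _) zZ ik) -/(pull_line x).
rewrite [tree_coef _ _ _ i k]mxE ik /GRing.scale/=.
set S := \sum_(j | _) _; set p := piv _ _; set a := line x i k.
set w := pull_line x i i; set zik := z i k.
have pn0 : p != 0 by exact: p0'.
by rewrite /cst; field.
Qed.

End line.
End pivot_recursion.

(** * Derivatives of the Laplace transform *)

Section laplace_derivatives.
Variables (R : realType) (n : nat) (r : 'I_n).
Local Notation mx := 'M[R]_n.
Local Notation desc := (desc r).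
Local Notation piv := (piv r).
Variables (s : 'I_n -> R) (y z : mx).
Hypotheses (yP : PG y) (zZ : ZG z).
Local Notation line := (line y z).
Local Notation pull_line := (pull_line r y z).

Definition log_laplace (t : R) : R :=
  - \sum_k s k * (ln (piv (line t) k) - ln (piv y k)).

Definition score (t : R) : R :=
  - \sum_k s k * (pull_line t k k / piv (line t) k).

Definition information : R :=
  \sum_k s k * ((pull_line 0 k k / piv y k) ^+ 2 +
    2 * (\sum_(j | desc j k && (j != k)) pull_line 0 j k ^+ 2 / piv y j) / piv y k).

Lemma line0 : line 0 = y.
Proof. by apply/matrixP => i j; rewrite lineE mul0r addr0. Qed.

Lemma is_derive_laplace (t : R) : (forall i, 0 < piv (line t) i) ->
  is_derive t 1 (fun t => expR (log_laplace t)) (expR (log_laplace t) * score t).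
Proof.
move=> p0; have pn0 i : piv (line t) i != 0 by rewrite gt_eqF.
have H k : is_derive t 1 (fun t => s k * (ln (piv (line t) k) - ln (piv y k)))
    (s k * (pull_line t k k / piv (line t) k)).
  have h1 := is_derive1_comp (is_derive1_ln (p0 k)) (is_derive_piv zZ pn0 k).
  have h2 := is_deriveB h1 (is_derive_cst (ln (piv y k)) t 1).
  apply: is_derive_eq (is_deriveZ (s k) h2) _.
  by rewrite subr0 /GRing.scale/= [_^-1 * _]mulrC.
have := is_deriveN (is_derive_sum_cond (P := xpredT) (fun k _ => H k)).
exact: is_derive1_comp (is_derive_expR _).
Qed.

Lemma is_derive_score :
  is_derive (0 : R) 1 (fun t => expR (log_laplace t) * score t)
    (score 0 ^+ 2 + information).
Proof.
have p0 i : 0 < piv (line 0) i by rewrite line0 PG_piv.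
have pn0 i : piv (line 0) i != 0 by rewrite gt_eqF.
have H k := is_deriveZ (s k) (is_derive_div (pn0 k) (is_derive_pull zZ p0 k) (is_derive_piv zZ pn0 k)).
have HS := is_deriveN (is_derive_sum_cond (P := xpredT) (fun k _ => H k)).
apply: is_derive_eq (is_deriveM (is_derive_laplace p0) HS) _.
have l0 : log_laplace 0 = 0.
  by rewrite /log_laplace line0 big1 ?oppr0// => k _; rewrite subrr mulr0.
rewrite l0 expR0 /GRing.scale/= !mul1r addrC; congr (_ + _).
rewrite /information -sumrN; apply: eq_bigr => k _; rewrite line0.
have : piv y k != 0 by rewrite gt_eqF// PG_piv.
move=> pk0; field; exact: pk0.
Qed.

(** Positivity of the pivots is open, and it is what makes the integral
    defining the moment generating function converge. *)
Lemma laplace_radius : exists2 del : R, 0 < del & forall t, `|t| < 4 * del ->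
  forall i, 0 < piv (line t) i.
Proof.
have p0 i : 0 < piv (line 0) i by rewrite line0 PG_piv.
have /nbhs_ballP[e /= e0 he] := near_piv_gt0 zZ p0.
exists (e / 4); first by rewrite divr_gt0.
move=> t; rewrite mulrC divfK// => te i; apply: he.
by rewrite /ball/= sub0r normrN.
Qed.

Lemma expR_log_laplace (t : R) : (forall i, 0 < piv (line t) i) ->
  expR (log_laplace t) =
  \prod_k piv (line t) k `^ (- s k) / \prod_k piv y k `^ (- s k).
Proof.
move=> p0; rewrite -prodf_div /log_laplace -sumrN expR_sum; apply: eq_bigr => k _.
have pk : 0 < piv y k by exact: PG_piv.
rewrite /powR !gt_eqF// -expRN -expRD; congr expR; ring.
Qed.

End laplace_derivatives.

(** * The cone dual to the positive definite matrices *)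

Section cone_QG.
Variables (R : realType) (n : nat) (r : 'I_n).
Local Notation mx := 'M[R]_n.
Local Notation par := (par r).

(** The matrices y + e Id, e > 0, lie in P_G and tend to y. *)
Lemma psd_closure_PG (y : mx) : ZG y ->
  (forall x : 'cV[R]_n, 0 <= (x^T *m y *m x) 0 0) -> closure (@PG R n) y.
Proof.
move=> [ys yz] y0 B [P yP PB].
have : \forall e \near (0 : R)^'+, forall ij : 'I_n * 'I_n,
    P ij.1 ij.2 (y ij.1 ij.2 + e * (1%:M : mx) ij.1 ij.2).
  apply: (@filter_forall _ _ (fun ij => [set e | P ij.1 ij.2 (y ij.1 ij.2 + e * (1%:M : mx) ij.1 ij.2)]) (0 : R)^'+ _) => -[i j].
  have c : (fun e : R => y i j + e * (1%:M : mx) i j) @ (0 : R)^'+ --> y i j.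
    apply: cvg_at_right_filter.
    have E : y i j + 0 * (1%:M : mx) i j = y i j by rewrite mul0r addr0.
    rewrite -[X in _ --> X]E.
    exact: is_derive_continuous (is_derive_affine (y i j) ((1%:M : mx) i j) 0).
  exact: (c _ (yP i j)).
move=> Pe; have [e [e0 he]] : exists e, 0 < e /\ forall ij : 'I_n * 'I_n,
    P ij.1 ij.2 (y ij.1 ij.2 + e * (1%:M : mx) ij.1 ij.2).
  near (0 : R)^'+ => e; exists e; split; first by near: e; exact: nbhs_right_gt.
  by near: e.
(* The closure is tested with finitely many entrywise conditions, so one e
   serves all of them. *)
pose w := y + e *: 1%:M : mx.
have wP : PG w.
  have ws : w^T = w.
    apply/matrixP => i j; rewrite !mxE -[in LHS]ys mxE.
    by rewrite eq_sym.
  split; split=> //.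
    move=> i j ij; rewrite !mxE yz// add0r.
    case: eqP => [ijE|_]; last by rewrite mulr0.
    by move: ij; rewrite (edge_par r) ijE eqxx.
  move=> x x0; rewrite /w mulmxDr mulmxDl mxE ltr_wpDl//.
  rewrite -scalemxAr -scalemxAl mulmx1 mxE mulr_gt0//.
  rewrite mxE lt_def sumr_ge0 ?andbT; last first.
    by move=> i _; rewrite mxE -expr2 sqr_ge0.
  apply: contra x0; rewrite psumr_eq0; last first.
    by move=> i _; rewrite mxE -expr2 sqr_ge0.
  move=> /allP h; apply/eqP/matrixP => i j; rewrite ord1 [RHS]mxE; apply/eqP.
  by have := h i (mem_index_enum _); rewrite mxE mulf_eq0 orbb.
exists w; split=> //; apply: PB => i j.
have -> : w i j = y i j + e * (1%:M : mx) i j by rewrite !mxE.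
exact: (he (i, j)).
Unshelve. all: end_near. Qed.

Lemma closure_ge0 (f : mx -> R) (A : set mx) y :
  continuous f -> (forall w, A w -> 0 <= f w) -> closure A y -> 0 <= f y.
Proof.
move=> cf f0 Ay.
have cl : closed [set w | 0 <= f w].
  by apply: (closed_comp (f := f) (D := [set u | 0 <= u])) => [w _|]; [exact: cf|exact: closed_ge].
rewrite closure_id in cl.
have : closure [set w | 0 <= f w] y by apply: closure_subset Ay.
by rewrite -cl.
Qed.

Lemma closure_PG_psd (y : mx) : closure (@PG R n) y ->
  ZG y /\ forall x : 'cV[R]_n, 0 <= (x^T *m y *m x) 0 0.
Proof.
move=> cy.
have eq0 (f : mx -> R) : continuous f -> (forall w, PG w -> f w = 0) -> f y = 0.
  move=> cf f0; apply/eqP; rewrite eq_le -oppr_ge0; apply/andP; split.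
    apply: (closure_ge0 (f := fun w => - f w) _ _ cy).
      by move=> w; apply: (@continuousN R R^o mx f w); exact: cf.
    by move=> w /f0 ->; rewrite oppr0.
  by apply: (closure_ge0 cf _ cy) => w /f0 ->.
split; [split|].
- apply/matrixP => i j; rewrite mxE; apply/eqP; rewrite -subr_eq0; apply/eqP.
  apply: (eq0 (fun w => w j i - w i j)).
    by move=> w; apply: (@continuousB R R^o mx); exact: coord_continuous.
  move=> w [[ws _] _]; have -> : w j i = w i j by rewrite -[in LHS]ws mxE.
  by rewrite subrr.
- move=> i j ij; apply: (eq0 (fun w => w i j)); first exact: coord_continuous.
  by move=> w [[_ wz] _]; exact: wz.
move=> x; rewrite quadE.
apply: (closure_ge0 (f := fun w => \sum_i \sum_j x i 0 * w i j * x j 0) _ _ cy).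
  apply: continuous_big => [|i _]; first exact: add_continuous.
  apply: continuous_big => [|j _]; first exact: add_continuous.
  move=> w; apply: (@continuousM R mx (fun w => x i 0 * w i j) (fun=> x j 0)).
    apply: (@continuousM R mx (fun=> x i 0) (fun w => w i j)).
      exact: cst_continuous.
    exact: coord_continuous.
  exact: cst_continuous.
move=> w [_ [_ w0]]; rewrite -quadE.
have [->|x0] := eqVneq x 0; last by rewrite ltW// w0.
by rewrite trmx0 !mul0mx mxE.
Qed.

End cone_QG.

Section dual_cone.
Variables (R : realType) (n : nat) (r : 'I_n).
Local Notation mx := 'M[R]_n.
Local Notation par := (par r).

Lemma pairing_piG (y A : mx) : ZG y -> pairing y (piG A) = pairing y A.
Proof.
move=> [_ yz]; rewrite /pairing /mxtrace; apply: eq_bigr => i _.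
rewrite [LHS]mxE [RHS]mxE; apply: eq_bigr => j _; rewrite [piG A j i]mxE.
by rewrite edge_sym; case: ifPn => // /yz ->; rewrite !mul0r.
Qed.

Lemma pairing_rank1 (v : 'cV[R]_n) (eta : mx) :
  pairing (v *m v^T) eta = (v^T *m eta *m v) 0 0.
Proof.
by rewrite /pairing -mulmxA mxtrace_mulC /mxtrace big_ord1.
Qed.

Lemma pairing_cov (y N : mx) (a : 'I_n -> R) :
  pairing y (cov N a) = \sum_k a k * ((unV N)^T *m y *m unV N) k k.
Proof.
rewrite /pairing /cov !mulmxA mxtrace_mulC !mulmxA /mxtrace.
by apply: eq_bigr => k _; rewrite mulmx_dgm mulrC.
Qed.

(** The defining inequality is tested on the rank one matrices v v^T with v
    supported on a vertex or on an edge. *)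
Lemma QG_tree_pos (eta : mx) : QG eta -> ZG eta /\ tree_pos r eta.
Proof.
move=> [eZ eQ]; split=> //; have [es ez] := eZ.
have pos (v : 'cV[R]_n) : v != 0 -> ZG (v *m v^T) ->
    0 < (v^T *m eta *m v) 0 0.
  move=> v0 vZ; rewrite -pairing_rank1; apply: eQ.
    apply: (psd_closure_PG r vZ) => x.
    have -> : x^T *m (v *m v^T) *m x = (v^T *m x)^T *m (v^T *m x).
      by rewrite trmx_mul trmxK !mulmxA.
    by rewrite mxE big_ord1 mxE -expr2 sqr_ge0.
  apply: contra v0 => /eqP vv; apply/eqP/matrixP => i j; rewrite ord1 mxE.
  have := congr1 (fun A : mx => A i i) vv; rewrite !mxE big_ord1 mxE.
  by move=> /eqP; rewrite mulf_eq0 orbb => /eqP.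
have diag i : 0 < eta i i.
  rewrite -quad_delta; apply: pos.
    apply/eqP => /matrixP/(_ i 0)/eqP; rewrite !mxE !eqxx/=.
    by rewrite oner_eq0.
  split; first by rewrite trmx_mul trmxK.
  move=> a b ab; rewrite mxE big_ord1 !mxE /=.
  have [ai|_] := eqVneq a i; last by rewrite mul0r.
  have [bi|_] := eqVneq b i; last by rewrite andbT/= mulr0.
  by move: ab; rewrite (edge_par r) ai bi eqxx.
split=> //; split=> // i k ik.
have ne := par_neq ik; have kk := diag k.
pose v : 'cV[R]_n := eta k k *: delta_mx i 0 + (- eta i k) *: delta_mx k 0.
have v0 : v != 0.
  apply/eqP => /matrixP/(_ i 0)/eqP; rewrite !mxE !eqxx (negbTE ne)/=.
  by rewrite mulr0 addr0 mulr1 gt_eqF.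
have vsupp a : a != i -> a != k -> v a 0 = 0.
  by move=> /negbTE ai /negbTE ak; rewrite !mxE ai ak /= !mulr0 addr0.
have vZ : ZG (v *m v^T).
  split; first by rewrite trmx_mul trmxK.
  move=> a b ab; rewrite mxE big_ord1 [v^T _ _]mxE.
  have eik : edge i k by exact: par_edge ik.
  have [ai|ai] := eqVneq a i; have [bi|bi] := eqVneq b i.
  - by move: ab; rewrite (edge_par r) ai bi eqxx.
  - rewrite (vsupp b bi) ?mulr0//; apply: contraNneq ab => ->.
    by rewrite ai.
  - rewrite (vsupp a ai) ?mul0r//; apply: contraNneq ab => ->.
    by rewrite bi edge_sym.
  - have [ak|ak] := eqVneq a k; last by rewrite (vsupp a ai ak) mul0r.
    rewrite (vsupp b bi) ?mulr0//; apply: contraNneq ab => ->.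
    by rewrite ak (edge_par r) eqxx.
have := pos v v0 vZ; rewrite quad_delta2// => h.
rewrite -(pmulr_rgt0 _ kk); apply: lt_le_trans h _.
by rewrite le_eqVlt; apply/orP; left; apply/eqP; ring.
Qed.

Lemma psd_diag0 (W : mx) : W^T = W ->
  (forall x : 'cV[R]_n, 0 <= (x^T *m W *m x) 0 0) ->
  (forall i, W i i = 0) -> W = 0.
Proof.
move=> Ws W0 Wd; apply/matrixP => i j; rewrite [RHS]mxE.
have h1 := W0 (1 *: delta_mx i 0 + 1 *: delta_mx j 0).
have h2 := W0 (1 *: delta_mx i 0 + (-1) *: delta_mx j 0).
rewrite quad_delta2// !Wd in h1; rewrite quad_delta2// !Wd in h2.
by apply/eqP; rewrite eq_le; apply/andP; split; lra.
Qed.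

(** Replacing eta by its completion T diag(a) T^T turns the pairing into
    sum_k a_k W_kk(y), where W(y) is positive semidefinite: the sum can
    only vanish if W(y) has zero diagonal, hence if y = 0. *)
Lemma tree_pos_QG (eta : mx) : ZG eta -> tree_pos r eta -> QG eta.
Proof.
move=> eZ et; split=> // y /closure_PG_psd[yZ y0] yn0.
have Ns := @reg_coef_supp _ _ r eta.
rewrite -(piG_id eZ) -(piG_completion et) pairing_piG// pairing_cov.
set W := _^T *m y *m _.
have WE x : (x^T *m W *m x) 0 0 = ((unV (reg_coef r eta) *m x)^T *m y *m (unV (reg_coef r eta) *m x)) 0 0.
  by rewrite /W trmx_mul !mulmxA.
have Wpsd (x : 'cV[R]_n) : 0 <= (x^T *m W *m x) 0 0 by rewrite WE.
have Wd i : 0 <= W i i by rewrite -quad_delta.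
rewrite lt_def sumr_ge0 ?andbT; last first.
  by move=> k _; rewrite mulr_ge0// ltW// reg_var_gt0.
apply: contra yn0; rewrite psumr_eq0; last first.
  by move=> k _; rewrite mulr_ge0// ltW// reg_var_gt0.
move=> /allP h.
have W0 : W = 0.
  apply: psd_diag0 => //; first by rewrite /W !trmx_mul trmxK yZ.1 mulmxA.
  move=> i; have := h i (mem_index_enum _); rewrite mulf_eq0 gt_eqF ?reg_var_gt0//=.
  by move=> /eqP.
have : (uni (reg_coef r eta))^T *m W *m uni (reg_coef r eta) = y.
  rewrite /W !mulmxA -trmx_mul (unVK Ns) trmx1 mul1mx -mulmxA (unVK Ns).
  by rewrite mulmx1.
by rewrite W0 mulmx0 mul0mx => <-.
Qed.

End dual_cone.

(** * The density in coordinates *)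

Section minors.
Variables (R : realType) (n : nat).

Lemma det_mxsub2 (A : 'M[R]_n) (i j : 'I_n) k (f : 'I_k -> 'I_n) :
  k = 2 -> injective f -> (forall a, f a \in [set i; j]%SET) -> i != j ->
  \det (mxsub f f A) = A i i * A j j - A i j * A j i.
Proof.
move=> k2; subst k => finj fI ij.
have l00 : lift ord0 (0 : 'I_1) = 1 :> 'I_2 by exact: val_inj.
have l10 : lift (1 : 'I_2) (0 : 'I_1) = 0 :> 'I_2 by exact: val_inj.
rewrite (expand_det_row _ 0) !big_ord_recl big_ord0 /cofactor !det_mx11 !mxE.
rewrite !l00 l10 /= addr0 expr0 expr1 mul1r.
have f01 : f 0 != f 1 by apply/eqP => /finj.
have := fI 0; have := fI 1; rewrite !inE => /orP[]/eqP f1 /orP[]/eqP f0;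
  rewrite f0 f1 ?eqxx// in f01 *; ring.
Qed.

Lemma minorE (A : 'M[R]_n) (i j : 'I_n) : j = i.+1 :> nat -> A^T = A ->
  minor A i.+1 i.+2 = A i i * A j j - A i j ^+ 2.
Proof.
move=> ij As; have inj : i != j by rewrite -val_eqE /= ij; lia.
have E : itv n i.+1 i.+2 = [set i; j]%SET.
  by apply/setP => k; rewrite !inE -!val_eqE /= ij; lia.
rewrite /minor /psub (@det_mxsub2 A i j).
- by have -> : A j i = A i j by rewrite -[in LHS]As mxE.
- by rewrite E cards2 inj.
- exact: enum_val_inj.
- by move=> a; rewrite -E; exact: enum_valP.
- exact: inj.
Qed.

Lemma dgE (A : 'M[R]_n) (i : 'I_n) : dg A i.+1 = A i i.
Proof. by rewrite /dg /= valK. Qed.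

End minors.

Section exponents.
Variable R : realType.

Lemma prod_powR_nat (f g : nat -> R) a b :
  (forall i, (a <= i < b)%N -> 0 < f i) ->
  \prod_(a <= i < b) f i `^ g i = expR (\sum_(a <= i < b) g i * ln (f i)).
Proof.
move=> f0; rewrite expR_sum; apply: eq_big_nat => i /f0 fi.
by rewrite /powR gt_eqF.
Qed.

Variables (sg lq lx : nat -> R).

(** The exponents carried by the vertices before the root: sg stands for
    the parameters, lq for the logarithms of the edge minors and lx for
    those of the diagonal entries. The correction term is the exponent that
    the last edge contributes at the root. *)
Lemma left_exponents r :
  \sum_(1 <= i < r.+1) sg i * lq i.-1 - \sum_(2 <= i < r.+1) sg i.-1 * lx i.-1
  + (\sum_(1 <= i < r.+1) - (3 / 2) * lq i.-1 + \sum_(2 <= i < r.+1) lx i.-1)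
  = \sum_(0 <= v < r) ((sg v.+1 - 3 / 2) * lq v + (1 - sg v.+1) * lx v.+1)
    - (if (0 < r)%N then (1 - sg r) * lx r else 0).
Proof.
elim: r => [|r IH]; first by rewrite !big_geq// subr0 addr0 addr0.
case: r IH => [_|r IH].
  rewrite !big_nat1 !big_geq//=; ring.
move: IH => /=; set S := (X in X - (1 - sg r.+1) * _) => IH.
rewrite !(@big_nat_recr _ _ _ r.+2)// [in RHS](@big_nat_recr _ _ _ r.+1)//=.
move: IH; rewrite -/S.
move: (\sum_(1 <= i < r.+2) sg i * lq i.-1) (\sum_(2 <= i < r.+2) sg i.-1 * lx i.-1)
 (\sum_(1 <= i < r.+2) - (3 / 2) * lq i.-1) (\sum_(2 <= i < r.+2) lx i.-1)
 => a b c d.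
move: S => e IH.
have -> : e = a - b + (c + d) + (1 - sg r.+1) * lx r.+1 by rewrite IH subrK.
ring.
Qed.

Lemma right_exponents r m : let n := (r.+1 + m)%N in
  \sum_(r.+2 <= i < n.+1) sg i * lq i.-2 - \sum_(r.+2 <= i < n) sg i.+1 * lx i.-1
  + (\sum_(r.+1 <= i < n) - (3 / 2) * lq i.-1 + \sum_(r.+2 <= i < n) lx i.-1)
  = \sum_(r.+1 <= v < n) ((sg v.+1 - 3 / 2) * lq v.-1 + (1 - sg v.+1) * lx v.-1)
    - (if (r.+1 < n)%N then (1 - sg r.+2) * lx r else 0).
Proof.
elim: m => [|m IH] /=.
  by rewrite addn0 !big_geq// ltnn subr0 addr0 addr0.
rewrite addnS; case: m IH => [_|m].
  rewrite addn0 ltnSn !big_nat1 !big_geq//=; ring.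
have rn2 : (r.+2 <= r.+1 + m.+1)%N by rewrite addnS ltnS leq_addr.
move: (r.+1 + m.+1)%N rn2 => n rn2 IH.
have rn : (r.+1 <= n)%N by exact: ltnW.
have -> : (r.+1 < n.+1)%N by [].
rewrite [\sum_(r.+2 <= i < n.+2) _]big_nat_recr//=.
rewrite [\sum_(r.+2 <= i < n.+1) sg i.+1 * _]big_nat_recr//=.
rewrite [\sum_(r.+1 <= i < n.+1) - _ * _]big_nat_recr//=.
rewrite [\sum_(r.+2 <= i < n.+1) lx _]big_nat_recr//=.
rewrite [\sum_(r.+1 <= i < n.+1) (_ + _)]big_nat_recr//=.
move: IH; rewrite /= rn2.
move: (\sum_(r.+2 <= i < n.+1) sg i * lq i.-2) (\sum_(r.+2 <= i < n) sg i.+1 * lx i.-1)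
 (\sum_(r.+1 <= i < n) - (3 / 2) * lq i.-1) (\sum_(r.+2 <= i < n) lx i.-1)
 => a b c d.
move: (\sum_(r.+1 <= v < n) ((sg v.+1 - 3 / 2) * lq v.-1 + (1 - sg v.+1) * lx v.-1)) => e /= IH.
have -> : e = a - b + (c + d) + (1 - sg r.+2) * lx r by rewrite IH subrK.
ring.
Qed.

(** The exponents of delta and phi against those of the tree factorisation.
    At the root the exponent s_(M-1) - s_M + s_(M+1) of delta absorbs the
    contributions 1 - s_v of the two edges that meet there and the factor
    of phi; the ends of the path are covered by s_0 = s_(n+1) = 0. *)
Lemma tree_exponents n r : (r < n)%N -> sg 0 = 0 -> sg n.+1 = 0 ->
  \sum_(1 <= i < r.+1) sg i * lq i.-1 + \sum_(r.+2 <= i < n.+1) sg i * lq i.-2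
  - (\sum_(2 <= i < r.+1) sg i.-1 * lx i.-1
     + (sg r - sg r.+1 + sg r.+2) * lx r
     + \sum_(r.+2 <= i < n) sg i.+1 * lx i.-1)
  + (if n == 1%N then - lx 0%N else
     \sum_(1 <= i < n) - (3 / 2) * lq i.-1 + \sum_(2 <= i < n) lx i.-1)
  = (sg r.+1 - 1) * lx r
   + (\sum_(0 <= v < r) ((sg v.+1 - 3 / 2) * lq v + (1 - sg v.+1) * lx v.+1)
   + \sum_(r.+1 <= v < n) ((sg v.+1 - 3 / 2) * lq v.-1 + (1 - sg v.+1) * lx v.-1)).
Proof.
move=> rn s0 sn; have [n1|n1] := eqVneq n 1%N.
  have r0 : r = 0%N by lia.
  move: sn; rewrite n1 r0 !big_geq//= s0 => ->; ring.
have n1' : (n == 1%N) = false by exact/negbTE.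
have nE : n = (r.+1 + (n - r.+1))%N by rewrite subnKC.
have := left_exponents r; have := right_exponents r (n - r.+1); rewrite /= -nE.
have -> : \sum_(1 <= i < n) - (3 / 2) * lq i.-1 =
    \sum_(1 <= i < r.+1) - (3 / 2) * lq i.-1 + \sum_(r.+1 <= i < n) - (3 / 2) * lq i.-1.
  by rewrite -big_cat_nat.
have -> : \sum_(2 <= i < n) lx i.-1 = \sum_(2 <= i < r.+1) lx i.-1 +
    (if (0 < r < n.-1)%N then lx r else 0) + \sum_(r.+2 <= i < n) lx i.-1.
  case: ifPn => [/andP[r0 rn1]|].
    have h2 : (2 <= r.+1)%N by lia.
    have hn : (r.+1 <= n)%N by lia.
    rewrite (big_cat_nat h2 hn)/=.
    rewrite -addrA; congr (_ + _); rewrite big_ltn//; lia.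
  rewrite addr0 negb_and => /orP[r0|rn1].
    have -> : r = 0%N by lia.
    by rewrite [X in X + _]big_geq// add0r.
  have -> : n = r.+1 by lia.
  by rewrite [X in _ + X]big_geq// addr0.
move: (\sum_(1 <= i < r.+1) sg i * lq i.-1) (\sum_(2 <= i < r.+1) sg i.-1 * lx i.-1)
 (\sum_(1 <= i < r.+1) - (3 / 2) * lq i.-1) (\sum_(2 <= i < r.+1) lx i.-1)
 (\sum_(0 <= v < r) ((sg v.+1 - 3 / 2) * lq v + (1 - sg v.+1) * lx v.+1))
 (\sum_(r.+2 <= i < n.+1) sg i * lq i.-2) (\sum_(r.+2 <= i < n) sg i.+1 * lx i.-1)
 (\sum_(r.+1 <= i < n) - (3 / 2) * lq i.-1) (\sum_(r.+2 <= i < n) lx i.-1)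
 (\sum_(r.+1 <= v < n) ((sg v.+1 - 3 / 2) * lq v.-1 + (1 - sg v.+1) * lx v.-1)) => a1 a2 a3 a4 a5 b1 b2 b3 b4 b5.
move=> hb ha.
have -> : b5 = b1 - b2 + (b3 + b4) + (if (r.+1 < n)%N then (1 - sg r.+2) * lx r else 0).
  by rewrite hb subrK.
have -> : a5 = a1 - a2 + (a3 + a4) + (if (0 < r)%N then (1 - sg r) * lx r else 0).
  by rewrite ha subrK.
have [r0|r0] := posnP r; have [rn1|rn1] := ltnP r.+1 n => /=.
- by rewrite ?n1' r0 s0; ring.
- by lia.
- have -> : (r < n.-1)%N by lia.
  ring.
have -> : (r < n.-1)%N = false by lia.
have -> : sg r.+2 = 0 by rewrite -sn; congr sg; lia.
by ring.
Qed.

End exponents.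

Section coordinates.
Variables (R : realType) (n : nat) (r : 'I_n).
Local Notation mx := 'M[R]_n.
Local Notation par := (par r).
Local Notation coords := ((n + n.-1).-tuple (measurableTypeR R)).

(** Functions on vertices extended by 0 to all natural numbers, the names
    of variables. *)
Definition ext (f : 'I_n -> R) (v : nat) : R :=
  if insub v is Some i then f i else 0.

Lemma ext_ord f (i : 'I_n) : ext f i = f i.
Proof. by rewrite /ext valK. Qed.

Lemma big_leaves_first (T : Type) (idx : T) (op : Monoid.com_law idx) (F : nat -> T) :
  \big[op/idx]_(v <- leaves_first n r) F v = \big[op/idx]_(i < n | i != r) F i.
Proof.
rewrite -(big_mkord (fun v => v != r) F) -[in RHS]big_filter.
apply/perm_big/uniq_perm.
- exact: tree_order_uniq (tree_order_leaves_first (ltn_ord r)).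
- by rewrite filter_uniq// iota_uniq.
- move=> v; rewrite mem_leaves_first ?ltn_ord// mem_filter mem_index_iota.
  by rewrite andbC.
Qed.

Variable t : coords.
Local Notation eta := (incomplete t : mx).
Local Notation x := (fun v : nat => (t : seq R)`_v).
Local Notation b := (fun v : nat => (t : seq R)`_(n + v)).
Definition edge_minor (v : nat) : R := x v * x v.+1 - b v ^+ 2.

Lemma incomplete_diag i : eta i i = x i.
Proof. by rewrite mxE eqxx. Qed.

Lemma incomplete_par i k : par i k -> eta i k = (t : seq R)`_(edge_var n r i).
Proof.
move=> ik; rewrite mxE (negbTE (par_neq ik)) (par_edge ik) /edge_var.
by case/andP: ik => _ /eqP ->.
Qed.

Lemma incomplete_ZG : ZG eta.
Proof.
split; last by move=> i j ij; rewrite mxE (negbTE ij); case: eqP => // ijE;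
  move: ij; rewrite ijE (edge_par r) eqxx.
apply/matrixP => i j; rewrite !mxE eq_sym edge_sym minnC.
by case: eqP => [->|].
Qed.

Lemma big_leaves_first_nat (F : nat -> R) :
  \sum_(v <- leaves_first n r) F v = \sum_(0 <= v < r) F v + \sum_(r.+1 <= v < n) F v.
Proof.
rewrite /leaves_first big_cat/= addrC; congr (_ + _).
  by rewrite /index_iota subn0.
by rewrite (perm_big _ (permEl (perm_rev _))).
Qed.

Lemma minor_incomplete v : (v.+1 < n)%N -> minor eta v.+1 v.+2 = edge_minor v.
Proof.
move=> vn; have vn' := ltnW vn.
have ij : Ordinal vn = (Ordinal vn').+1 :> nat by [].
rewrite (minorE ij) ?incomplete_diag; last by case: incomplete_ZG.
rewrite /edge_minor; congr (_ - _ ^+ 2).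
rewrite mxE -val_eqE /= ifN; last by lia.
have -> : edge (Ordinal vn') (Ordinal vn) by rewrite /edge /=; lia.
by have -> : minn v v.+1 = v by lia.
Qed.

Lemma dg_incomplete v : (v < n)%N -> dg eta v.+1 = x v.
Proof. by move=> vn; have := dgE eta (Ordinal vn); rewrite incomplete_diag. Qed.

Lemma edge_minorE v : (v < n)%N -> v != r ->
  x (parent r v) * x v - (t : seq R)`_(edge_var n r v) ^+ 2 =
  edge_minor (if (v < r)%N then v else v.-1).
Proof.
move=> vn vr; rewrite (edge_varE (ltn_ord r)) /edge_minor /parent; case: (ltnP v r) => vr'.
  by rewrite mulrC.
have -> : v.-1.+1 = v by lia.
by [].
Qed.

(** The positivity conditions are those under which no factor of the tree
    density vanishes. *)
Lemma QG_incomplete : QG eta <-> (forall v, (v < n)%N -> 0 < x v) /\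
  (forall v, (v < n)%N -> v != r ->
     0 < x (parent r v) * x v - (t : seq R)`_(edge_var n r v) ^+ 2).
Proof.
split=> [/(QG_tree_pos r)[_ [_ [e0 em]]]|[x0 q0]].
  split=> [v vn|v vn vr]; first by have := e0 (Ordinal vn); rewrite incomplete_diag.
  have /parP[k ik] : Ordinal vn != r by rewrite -val_eqE.
  have := em _ _ ik; rewrite (incomplete_par ik) !incomplete_diag.
  by case/andP: ik => _ /eqP <-; rewrite mulrC.
apply: (@tree_pos_QG _ _ r); first exact: incomplete_ZG.
split; first by case: incomplete_ZG.
split=> [i|i k ik]; first by rewrite incomplete_diag x0.
rewrite (incomplete_par ik) !incomplete_diag.
have := q0 i (ltn_ord i); case/andP: ik => ir /eqP <-.
by rewrite mulrC; apply; rewrite -val_eqE in ir.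
Qed.

(** Each edge entry occurs twice in the symmetric matrices, whence the
    factor 2. *)
Lemma pairing_incomplete (y : mx) : ZG y -> pairing y eta =
  y r r * x r + \sum_(i < n | i != r)
    (y i i * x i + 2 * (\sum_(k | par i k) y i k) * (t : seq R)`_(edge_var n r i)).
Proof.
move=> [ys yz].
pose F i j := y i j * eta i j.
have FC i j : F i j = F j i.
  have [es _] := incomplete_ZG.
  by rewrite /F -[in LHS]ys -[in LHS]es !mxE.
have -> : pairing y eta = \sum_i \sum_j F i j.
  apply: eq_bigr => i _; rewrite mxE; apply: eq_bigr => j _.
  by rewrite /F; have [es _] := incomplete_ZG; rewrite -[in LHS]es [in LHS]mxE.
have rowE i : \sum_j F i j = F i i + \sum_(j | par i j) F i j + \sum_(j | par j i) F i j.
  rewrite (bigD1 i)//= -addrA; congr (_ + _).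
  rewrite [LHS](bigID (fun j => par i j))/= ; congr (_ + _).
    apply: eq_bigl => j; have [ij|] := boolP (par i j); rewrite ?andbF//.
    by rewrite andbT eq_sym; exact: par_neq ij.
  rewrite [LHS](bigID (fun j => par j i))/= [X in _ + X]big1 ?addr0; last first.
    move=> j /andP[/andP[ji nij] nji].
    by rewrite /F yz ?mul0r// (edge_par r) eq_sym (negbTE ji) (negbTE nij).
  apply: eq_bigl => j; have [ji|] := boolP (par j i); rewrite ?andbF//.
  by rewrite andbT (par_neq ji) (parN ji).
under eq_bigr do rewrite rowE.
rewrite !big_split/= [X in _ + X](exchange_big_dep xpredT)//=.
under [X in _ + X]eq_bigr => j _ do under eq_bigr => i _ do rewrite FC.
rewrite -addrA -mulr2n.
have -> : \sum_i \sum_(j | par i j) F i j =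
  \sum_(i < n | i != r) (\sum_(k | par i k) y i k) * (t : seq R)`_(edge_var n r i).
  rewrite (bigD1 r)//= [X in X + _]big1 ?add0r; last by move=> j; rewrite par_root.
  apply: eq_bigr => i ir; rewrite mulr_suml; apply: eq_bigr => j ij.
  by rewrite /F incomplete_par.
rewrite (bigD1 r)//= -addrA [F r r]/F incomplete_diag; congr (_ + _).
rewrite -[X in _ + X = _]mulr_natl mulr_sumr -[LHS]big_split -[RHS]big_split/=.
apply: eq_bigr => i _.
by rewrite /F incomplete_diag mulrA.
Qed.

End coordinates.

Section density_in_coordinates.
Variables (R : realType) (n : nat) (r : 'I_n) (s : n.-tuple R).
Local Notation mx := 'M[R]_n.
Local Notation par := (par r).
Local Notation coords := ((n + n.-1).-tuple (measurableTypeR R)).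

Definition offdiag (y : mx) (i : 'I_n) : R := \sum_(k | par i k) y i k.

(** The Wishart density with its indicator of Q_G built in, as a function
    of named variables. *)
Definition wishart_env (y : mx) (e : nat -> R) : R :=
  tree_density r (parent r) (edge_var n r) (fun v => sx s v.+1)
    (ext (fun i => y i i)) (ext (offdiag y)) (leaves_first n r) e.

Variable t : coords.
Local Notation eta := (incomplete t : mx).
Local Notation x := (fun v : nat => (t : seq R)`_v).

(** The indicators inside the gamma factor of the root and the edge factors
    together cut out exactly Q_G: positivity of a minor and of its parent
    entry forces the child entry to be positive. *)
Lemma wishart_env0 y : ~ QG eta -> wishart_env y (nth 0 t) = 0.
Proof.
move=> nQ; apply/eqP; apply: contra_notT nQ.
rewrite /wishart_env /tree_density mulf_eq0 negb_or => /andP[g0].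
rewrite prodf_seq_neq0 => /allP e0; apply/QG_incomplete.
have xr : 0 < x r.
  by move: g0; rewrite /gamma_fun; case: ifPn; rewrite ?eqxx.
have q0 v : (v < n)%N -> v != r -> (0 < x (parent r v)) &&
    (0 < x (parent r v) * x v - (t : seq R)`_(edge_var n r v) ^+ 2).
  move=> vn vr; have := e0 v; rewrite mem_leaves_first ?ltn_ord// vn vr.
  by move=> /(_ isT); rewrite /edge_fun; case: ifPn; rewrite ?eqxx.
split=> [v vn|v vn vr]; last by have /andP[] := q0 v vn vr.
have [->//|vr] := eqVneq v r; have /andP[px] := q0 v vn vr.
rewrite subr_gt0 => h; rewrite -(pmulr_rgt0 _ px).
exact: le_lt_trans (sqr_ge0 _) h.
Qed.

Hypothesis etaQ : QG eta.

Let x0 v : (v < n)%N -> 0 < x v.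
Proof. by have /(QG_incomplete r)[h _] := etaQ; exact: h. Qed.

Let q0 v : (v.+1 < n)%N -> 0 < edge_minor t v.
Proof.
move=> vn; have [vr|vr] := ltnP v r.
  have vr' : v != r by rewrite ltn_eqF.
  have := edge_minorE t (ltnW vn) vr'; rewrite vr => <-.
  by have /(QG_incomplete r)[_] := etaQ; apply=> //; exact: ltnW.
have vr' : v.+1 != r by rewrite gtn_eqF.
have := edge_minorE t vn vr'; rewrite ltnNge (leqW vr)/= => <-.
by have /(QG_incomplete r)[_] := etaQ; apply.
Qed.

Let prod_minor_left (g : nat -> R) b : (b <= n)%N ->
  \prod_(1 <= i < b) minor eta i i.+1 `^ g i =
  expR (\sum_(1 <= i < b) g i * ln (edge_minor t i.-1)).
Proof.
move=> bn; rewrite -prod_powR_nat => [|[|i]//= ib]; last by apply: q0; lia.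
apply: eq_big_nat => -[|i]//= ib; rewrite (minor_incomplete r)//; lia.
Qed.

Let prod_minor_right (g : nat -> R) a :
  \prod_(a.+2 <= i < n.+1) minor eta i.-1 i `^ g i =
  expR (\sum_(a.+2 <= i < n.+1) g i * ln (edge_minor t i.-2)).
Proof.
rewrite -prod_powR_nat => [|[|[|i]]//= ib]; last by apply: q0; lia.
apply: eq_big_nat => -[|[|i]]//= ib; rewrite (minor_incomplete r)//; lia.
Qed.

Let prod_dg (g : nat -> R) a b : (b <= n.+1)%N ->
  \prod_(a.+1 <= i < b) dg eta i `^ g i =
  expR (\sum_(a.+1 <= i < b) g i * ln (x i.-1)).
Proof.
move=> bn; rewrite -prod_powR_nat => [|[|i]//= ib]; last by apply: x0; lia.
by apply: eq_big_nat => -[|i]//= ib; rewrite dg_incomplete//; lia.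
Qed.

Lemma delta_phi_tree :
  delta r.+1 s eta * phi eta =
  x r `^ (sx s r.+1 - 1) * \prod_(v <- leaves_first n r)
   (edge_minor t (if (v < r)%N then v else v.-1) `^ (sx s v.+1 - 3 / 2) *
    x (parent r v) `^ (1 - sx s v.+1)).
Proof.
have rn := ltn_ord r.
have s0 : sx s 0 = 0 by [].
have sn : sx s n.+1 = 0 by rewrite /sx nth_default//= size_tuple.
have := tree_exponents (fun v => ln (edge_minor t v)) (fun v => ln (x v)) rn s0 sn.
move=> /(congr1 expR).
have -> : x r `^ (sx s r.+1 - 1) = expR ((sx s r.+1 - 1) * ln (x r)).
  by rewrite /powR gt_eqF ?x0.
have -> : \prod_(v <- leaves_first n r)
   (edge_minor t (if (v < r)%N then v else v.-1) `^ (sx s v.+1 - 3 / 2) *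
    x (parent r v) `^ (1 - sx s v.+1)) =
  expR (\sum_(v <- leaves_first n r)
   ((sx s v.+1 - 3 / 2) * ln (edge_minor t (if (v < r)%N then v else v.-1)) +
    (1 - sx s v.+1) * ln (x (parent r v)))).
  rewrite expR_sum !big_seq; apply: eq_bigr => v.
  rewrite mem_leaves_first// => /andP[vn vr]; rewrite expRD /powR !gt_eqF//.
    by apply: x0; rewrite /parent; case: ifP; lia.
  by apply: q0; case: ifP; lia.
rewrite big_leaves_first_nat -expRD.
have -> : \sum_(0 <= v < r) ((sx s v.+1 - 3 / 2) * ln (edge_minor t (if (v < r)%N then v else v.-1)) +
    (1 - sx s v.+1) * ln (x (parent r v))) = \sum_(0 <= v < r)
      ((sx s v.+1 - 3 / 2) * ln (edge_minor t v) + (1 - sx s v.+1) * ln (x v.+1)).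
  by apply: eq_big_nat => v /= vr; rewrite /parent vr.
have -> : \sum_(r.+1 <= v < n) ((sx s v.+1 - 3 / 2) * ln (edge_minor t (if (v < r)%N then v else v.-1)) +
    (1 - sx s v.+1) * ln (x (parent r v))) = \sum_(r.+1 <= v < n)
      ((sx s v.+1 - 3 / 2) * ln (edge_minor t v.-1) + (1 - sx s v.+1) * ln (x v.-1)).
  apply: eq_big_nat => v /= /andP[rv _]; rewrite /parent.
  by have -> : (v < r)%N = false by lia.
move=> <-.
have phiE : phi eta = expR (if n == 1%N then - ln (x 0%N) else
    \sum_(1 <= i < n) - (3 / 2) * ln (edge_minor t i.-1) +
    \sum_(2 <= i < n) ln (x i.-1)).
  rewrite /phi; case: eqP => [n1|_].
    have n0 : (0 < n)%N by rewrite n1.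
    by rewrite dg_incomplete// expRN lnK// posrE x0.
  rewrite (prod_minor_left (fun=> _))// expRD; congr (_ * _).
  rewrite expR_sum; apply: eq_big_nat => -[|i]//= ib.
  by rewrite dg_incomplete ?lnK ?posrE ?x0//; lia.
rewrite phiE expRD; congr (_ * _).
rewrite /delta /= prod_minor_left// prod_minor_right !prod_dg ?leqW//.
rewrite dg_incomplete// expRB !expRD; congr (_ / (_ * _ * _)).
by rewrite /powR gt_eqF ?x0.
Qed.

Lemma wishart_env_QG y : ZG y ->
  wishart_env y (nth 0 t) = wishart_density r.+1 s y eta.
Proof.
move=> yZ; rewrite /wishart_density -mulrA delta_phi_tree.
rewrite /wishart_env /tree_density /gamma_fun x0//.
rewrite (pairing_incomplete r _ yZ) opprD expRD mulNr.
have -> : \prod_(v <- leaves_first n r)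
     edge_fun (sx s v.+1) (ext (fun i => y i i) v) (ext (offdiag y) v)
       (x (parent r v)) (x v) (t : seq R)`_(edge_var n r v) =
  expR (- \sum_(i < n | i != r) (y i i * x i + 2 * offdiag y i * (t : seq R)`_(edge_var n r i))) *
  \prod_(v <- leaves_first n r)
   (edge_minor t (if (v < r)%N then v else v.-1) `^ (sx s v.+1 - 3 / 2) *
    x (parent r v) `^ (1 - sx s v.+1)).
  rewrite -sumrN expR_sum.
  rewrite (eq_bigr (fun i : 'I_n => expR (- ((ext (fun i => y i i) i * x i +
     2 * ext (offdiag y) i * (t : seq R)`_(edge_var n r i)))))); last first.
    by move=> i _; rewrite !ext_ord.
  rewrite -(big_leaves_first r _ (fun v => expR (- ((ext (fun i => y i i) v * x v +
     2 * ext (offdiag y) v * (t : seq R)`_(edge_var n r v)))))).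
  rewrite -big_split/= !big_seq; apply: eq_bigr => v.
  rewrite mem_leaves_first ?ltn_ord// => /andP[vn vr].
  have /(QG_incomplete r)[_ h] := etaQ.
  rewrite /edge_fun x0 ?h//=; last by rewrite /parent; have := ltn_ord r; case: ifP; lia.
  rewrite edge_minorE// mulrA; congr (expR _ * _ * _); ring.
rewrite ext_ord; ring.
Qed.

End density_in_coordinates.

(** * Integration against a density *)

Section density.
Context d (T : measurableType d) (R : realType).
Variable mu : {sigma_finite_measure set T -> \bar R}.
Local Notation leb := (@lebesgue_measure R).
Local Notation RR := (measurableTypeR R).

Section density_measure.
Variable h : T -> R.
Hypotheses (h0 : forall x, 0 <= h x) (mh : measurable_fun [set: T] h).
Hypothesis h1 : (\int[mu]_x (h x)%:E = 1)%E.

Definition density_measure (A : set T) : \bar R := (\int[mu]_(x in A) (h x)%:E)%E.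

Let h_int : mu.-integrable [set: T] (EFin \o h).
Proof.
apply/integrableP; split; first exact/measurable_EFinP.
under eq_integral do rewrite /= ger0_norm//.
by rewrite h1 ltry.
Qed.

Let dm0 : density_measure set0 = 0%E.
Proof. by rewrite /density_measure integral_set0. Qed.

Let dm_ge0 A : (0 <= density_measure A)%E.
Proof. by apply: integral_ge0 => x _; rewrite lee_fin. Qed.

Let dm_sigma_additive : semi_sigma_additive density_measure.
Proof.
move=> /= A mA tA mUA.
rewrite /density_measure/= integral_bigcup//=; last first.
  exact: (integrableS _ _ (subsetT _)).
apply: is_cvg_ereal_nneg_natsum_cond => n _ _.
by apply: integral_ge0 => /= x ?; rewrite lee_fin.
Qed.

HB.instance Definition _ := isMeasure.Build _ _ _
  density_measure dm0 dm_ge0 dm_sigma_additive.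

HB.instance Definition _ :=
  Measure_isProbability.Build _ _ R density_measure h1.

Lemma density_probability : exists P : probability T R,
  forall A, measurable A -> P A = (\int[mu]_(x in A) (h x)%:E)%E.
Proof. by exists density_measure. Qed.

End density_measure.

(** Layer-cake formula: both integrals equal the integral over the levels
    [u] of the measure of the superlevel sets of [f]. *)
Lemma ge0_integral_density (P : probability T R) (f h : T -> R) :
  (forall x, 0 <= f x) -> (forall x, 0 <= h x) ->
  measurable_fun [set: T] f -> measurable_fun [set: T] h ->
  (forall A, measurable A -> P A = (\int[mu]_(x in A) (h x)%:E)%E) ->
  (\int[P]_x (f x)%:E = \int[mu]_x (f x * h x)%:E)%E.
Proof.
move=> f0 h0 mf mh Ph.
pose g (p : T * RR) : R := if (0 <= p.2) && (p.2 < f p.1) then 1 else 0.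
have mg : measurable_fun [set: T * RR] g.
  apply: measurable_fun_ifT => //; apply: measurable_and.
    by apply: measurable_fun_ler => //; exact: measurable_snd.
  apply: measurable_fun_ltr; first exact: measurable_snd.
  exact: measurableT_comp mf measurable_fst.
have g0 p : 0 <= g p by rewrite /g; case: ifP.
have layer x : (\int[leb]_u (g (x, u))%:E = (f x)%:E)%E.
  transitivity (\int[leb]_(u in `[0%R, f x[) (cst 1 u))%E.
    rewrite [RHS]integral_mkcond; apply: eq_integral => u _.
    rewrite patchE /g/=; case: ifPn => u0.
      by rewrite mem_set//= in_itv.
    by rewrite memNset//= in_itv/=; exact/negP.
  rewrite integral_cst//= mul1e lebesgue_measure_itv/= lte_fin.
  have := f0 x; rewrite le_eqVlt => /predU1P[<-|->]; first by rewrite ltxx.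
  by rewrite oppr0 adde0.
have mEg : measurable_fun [set: T * RR] (fun p => (g p)%:E) by exact/measurable_EFinP.
under eq_integral do rewrite -layer.
rewrite (@fubini_tonelli _ _ T RR R P leb (fun p => (g p)%:E) mEg); last first.
  by move=> p; rewrite lee_fin.
transitivity (\int[leb]_u \int[mu]_x ((g (x, u) * h x)%:E))%E.
  apply: eq_integral => u _.
  pose A := [set x | (0 <= u) && (u < f x)].
  have mA : measurable A.
    rewrite (_ : A = (fun x => (0 <= u) && (u < f x)) @^-1` [set true]); last first.
      by apply/seteqP; split.
    rewrite -[X in measurable X]setTI.
    have : measurable_fun [set: T] (fun x => (0 <= u) && (u < f x)).
      by apply: measurable_and => //; exact: measurable_fun_ltr.
    exact.
  have gA x : (g (x, u))%:E = (\1_A x)%:E :> \bar R.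
    rewrite indicE /g /=; case: ifPn => xA; first by rewrite mem_set.
    by rewrite memNset//; exact/negP.
  under eq_integral do rewrite gA.
  transitivity (P A); first by rewrite integral_indic// setIT.
  rewrite Ph// integral_mkcond.
  apply: eq_integral => x _; rewrite patchE EFinM gA indicE.
  by case: ifPn => _; rewrite ?mul1e ?mul0e.
pose G (p : RR * T) := (g (p.2, p.1) * h p.2)%:E.
have mG : measurable_fun [set: RR * T] G.
  apply/measurable_EFinP; apply: measurable_funM.
    apply: (measurableT_comp mg).
    by apply/measurable_fun_pairP; split; [exact: measurable_snd|exact: measurable_fst].
  exact: measurableT_comp mh measurable_snd.
rewrite (@fubini_tonelli _ _ RR T R leb mu G mG); last first.
  by move=> p; rewrite lee_fin mulr_ge0.
apply: eq_integral => x _; rewrite /G/=.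
under eq_integral do rewrite EFinM muleC.
rewrite ge0_integralZl//.
- by rewrite layer -EFinM mulrC.
- by apply/measurable_EFinP; exact: measurableT_comp mg (measurable_pair1 x).
- by move=> u _; rewrite lee_fin.
- by rewrite lee_fin.
Qed.

End density.

(** * The Wishart laws and their moments *)

Section laplace_transform.
Variables (R : realType) (n : nat) (r : 'I_n) (s : n.-tuple R).
Local Notation mx := 'M[R]_n.
Local Notation par := (par r).
Local Notation coords := ((n + n.-1).-tuple (measurableTypeR R)).

Lemma ins0E (q : seq R) : ins 0 q (fun=> 0) = nth 0 q.
Proof.
apply/funext => j; rewrite /ins add0n subn0 /=; case: ltnP => // jq.
by rewrite nth_default.
Qed.

(** The diagonal of y is recovered from its pivots. *)
Lemma wishart_env_unpivot (y : mx) :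
  wishart_env r s y = tree_density r (parent r) (edge_var n r)
    (fun v => sx s v.+1)
    (unpivot (parent r) (ext (piv r y)) (ext (offdiag r y)) (leaves_first n r))
    (ext (offdiag r y)) (leaves_first n r).
Proof.
have E (k : 'I_n) : unpivot (parent r) (ext (piv r y)) (ext (offdiag r y)) (leaves_first n r) k
     = ext (fun i => y i i) k.
  rewrite /unpivot big_mkcond.
  rewrite (big_leaves_first r _ (fun i => if parent r i == k then
      ext (offdiag r y) i ^+ 2 / ext (piv r y) i else 0)).
  rewrite !ext_ord pivE -addrA -[RHS]addr0; congr (_ + _); apply/eqP.
  rewrite addrC subr_eq0 -big_mkcondr/=; apply/eqP/eq_bigr => i ik.
  rewrite !ext_ord; congr (_ ^+ 2 / _).
  rewrite /offdiag (bigD1 k)//= big1 ?addr0// => l /andP[il].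
  by rewrite (par_inj il ik) eqxx.
apply/funext => e; rewrite /wishart_env /tree_density (E r); congr (_ * _).
rewrite !big_seq; apply: eq_bigr => v.
rewrite mem_leaves_first ?ltn_ord// => /andP[vn _].
by rewrite -(E (Ordinal vn)).
Qed.

Lemma measurable_wishart_env y :
  measurable_fun [set: coords] (fun t : coords => wishart_env r s y (nth 0 t)).
Proof.
have := @tree_density_measurable R r (parent r) (edge_var n r) (fun v => sx s v.+1)
  (ext (fun i => y i i)) (ext (offdiag r y)) (leaves_first n r).
move=> /(_ _ coords (fun t => ins 0 (t : seq R) (fun=> 0))).
move=> H; apply/measurable_EFinP; rewrite (_ : _ \o _ = fun t : coords =>
  (wishart_env r s y (ins 0 (t : seq R) (fun=> 0)))%:E).
  by apply: H; exact: measurable_ins.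
by apply/funext => t; rewrite ins0E.
Qed.

Hypothesis hs : forall i : 'I_n, i != r -> 1 / 2 < sx s i.+1.
Hypothesis hsr : 0 < sx s r.+1.

Lemma integral_wishart_env : exists2 K : R, 0 < K &
  forall y, (forall k, 0 < piv r y k) ->
  (\int[lebesgue_tuple R (n + n.-1)]_t (wishart_env r s y (nth 0 t))%:E =
   (K * \prod_k piv r y k `^ (- sx s k.+1))%:E)%E.
Proof.
have rn := ltn_ord r.
have hl v : v \in leaves_first n r -> 1 / 2 < sx s v.+1.
  by rewrite mem_leaves_first// => /andP[vn vr]; exact: (hs (i := Ordinal vn)).
have [K K0 hK] := nint_tree (s := fun v => sx s v.+1) (tree_order_leaves_first rn) hsr hl.
exists K => // y y0; rewrite wishart_env_unpivot.
set f := (tree_density _ _ _ _ _ _ _).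
have f0 e : (0 <= (f e)%:E)%E by rewrite lee_fin tree_density_ge0.
have mf : env_measurable (fun e => (f e)%:E) by exact: tree_density_measurable.
transitivity (nint (tree_vars r (edge_var n r) (leaves_first n r))
   (fun e => (f e)%:E) (fun=> 0)).
  rewrite -(@perm_nint _ (iota 0 (n + n.-1)))//; last 2 first.
  - exact: iota_uniq.
  - exact: perm_leaves_first.
  rewrite -(integral_lebesgue_tuple _ _ _ f0 mf); apply: eq_integral => t _.
  by rewrite ins0E.
rewrite hK.
  rewrite big_cons (big_leaves_first r _ (fun v => ext (piv r y) v `^ (- sx s v.+1))).
  rewrite ext_ord [in RHS](bigD1 r)//=.
  by under eq_bigr do rewrite ext_ord.
move=> v; rewrite inE mem_leaves_first// => vn.
have {}vn : (v < n)%N by case/predU1P: vn => [->//|/andP[]].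
by rewrite (ext_ord _ (Ordinal vn)).
Qed.

End laplace_transform.

Section wishart_law.
Variables (R : realType) (n : nat) (r : 'I_n) (s : n.-tuple R).
Local Notation mx := 'M[R]_n.
Local Notation par := (par r).
Local Notation desc := (desc r).
Local Notation coords := ((n + n.-1).-tuple (measurableTypeR R)).
Local Notation leb := (lebesgue_tuple R (n + n.-1)).
Local Notation gam := (@gamma R n r.+1 s).
Hypothesis hs : forall i : 'I_n, i != r -> 1 / 2 < sx s i.+1.
Hypothesis hsr : 0 < sx s r.+1.

Lemma integral_wishart_density y A : ZG y ->
  (\int[leb]_(t in A `&` (@incomplete R n) @^-1` @QG R n)
     (wishart_density r.+1 s y (incomplete t))%:E =
   \int[leb]_(t in A) (wishart_env r s y (nth 0 t))%:E)%E.
Proof.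
move=> yZ; rewrite integral_mkcondr; apply: eq_integral => t _.
rewrite patchE; case: ifPn => [|]; last first.
  by move=> /negP tQ; rewrite wishart_env0// => tQ'; apply: tQ; rewrite inE.
by rewrite inE /= => tQ; rewrite (wishart_env_QG r s tQ yZ).
Qed.

Lemma wishart_env_ge0 y (e : nat -> R) : 0 <= wishart_env r s y e.
Proof. exact: tree_density_ge0. Qed.

(** A law satisfying [is_wishart] exists because the total mass is finite
    and positive, and the total mass determines the constant, so every
    choice of the law has this density. *)
Lemma gamma_density (y : mx) : PG y -> exists2 Z : R, 0 < Z &
  (\int[leb]_t (wishart_env r s y (nth 0 t))%:E = Z%:E)%E /\
  forall A, measurable A ->
    gam y A = (\int[leb]_(t in A) (Z^-1 * wishart_env r s y (nth 0 t))%:E)%E.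
Proof.
move=> yP; have yZ : ZG y by case: yP.
have [K K0 hK] := integral_wishart_env hs hsr.
have p0 k := PG_piv r k yP.
have := hK y p0; set Z := K * _ => hZ.
have Z0 : 0 < Z by rewrite mulr_gt0// prodr_gt0// => k _; exact: powR_gt0.
exists Z => //; split=> //.
have mE (A : set coords) : measurable_fun A (fun t : coords => (wishart_env r s y (nth 0 t))%:E).
  by apply/measurable_EFinP; apply: measurable_funTS; exact: measurable_wishart_env.
have scaleE c A : 0 <= c -> measurable A ->
    (\int[leb]_(t in A) (c * wishart_env r s y (nth 0 t))%:E =
     c%:E * \int[leb]_(t in A) (wishart_env r s y (nth 0 t))%:E)%E.
  move=> c0 mA; under eq_integral do rewrite EFinM.
  rewrite ge0_integralZl//.
  by move=> t _; rewrite lee_fin wishart_env_ge0.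
have Zi0 : 0 <= Z^-1 by rewrite invr_ge0 ltW.
have ex : exists P, is_wishart r.+1 s y P.
  have [||//|P hP] := @density_probability _ coords R leb
      (fun t : coords => Z^-1 * wishart_env r s y (nth 0 t)).
  - by move=> t; rewrite mulr_ge0// wishart_env_ge0.
  - by apply: measurable_funM => //; exact: measurable_wishart_env.
  - rewrite scaleE// hZ -EFinM mulVf// gt_eqF//.
  exists P, Z^-1 => A mA; rewrite integral_wishart_density// hP//.
  exact: scaleE.
rewrite /gamma; case: pselect => // h.
have [c hc] := projT2 (cid h); move: (projT1 (cid h)) hc => P hc A mA.
have {}hc B : measurable B ->
    P B = (c%:E * \int[leb]_(t in B) (wishart_env r s y (nth 0 t))%:E)%E.
  by move=> mB; rewrite hc// integral_wishart_density.
have cE : c = Z^-1.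
  have := hc setT measurableT; rewrite hZ probability_setT -EFinM => -[/esym cZ].
  by apply: (mulIf (lt0r_neq0 Z0)); rewrite cZ mulVf// gt_eqF.
by rewrite hc// cE scaleE.
Qed.

Lemma pairing_lineE (y z eta : mx) (t : R) :
  pairing (line y z t) eta = pairing y eta + t * pairing z eta.
Proof. by rewrite /pairing /line mulmxDl -scalemxAl linearD linearZ. Qed.

Lemma line_ZG (y z : mx) t : ZG y -> ZG z -> ZG (line y z t).
Proof.
move=> [ys yz] [zs zz]; split; first by rewrite /line linearD linearZ/= ys zs.
by move=> i j ij; rewrite lineE yz// zz// mulr0 addr0.
Qed.

Lemma ZG_opp (z : mx) : ZG z -> ZG (- z).
Proof.
move=> [zs zz]; split; first by rewrite linearN/= zs.
by move=> i j ij; rewrite mxE zz// oppr0.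
Qed.

Lemma measurable_incomplete i j :
  measurable_fun [set: coords] (fun t : coords => (incomplete t : mx) i j).
Proof.
have mnth k : measurable_fun [set: coords] (fun t : coords => (t : seq R)`_k).
  have [kn|kn] := ltnP k (n + n.-1).
    under eq_fun do rewrite -(tnth_nth 0 _ (Ordinal kn)).
    exact: measurable_tnth.
  rewrite (_ : (fun t : coords => _) = cst 0); first exact: measurable_cst.
  by apply/funext => t; rewrite nth_default// size_tuple.
under eq_fun do rewrite mxE.
have [ij|ij] := eqVneq i j; first exact: mnth.
by case: (edge i j); [exact: mnth|exact: measurable_cst].
Qed.

Lemma measurable_pairing z :
  measurable_fun [set: coords] (fun t : coords => pairing z (incomplete t)).
Proof.
apply: measurable_sum => i; under eq_fun do rewrite mxE.
apply: measurable_sum => j; apply: measurable_funM => //.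
exact: measurable_incomplete.
Qed.

(** Multiplying the density by exp(t <z, eta>) moves the parameter y to y -
    t z, so the moment generating function is a quotient of two Laplace
    integrals. *)
Lemma mgf_wishart (y z : mx) (t : R) : PG y -> ZG z ->
  (forall i, 0 < piv r (line y (- z) t) i) ->
  (\int[gam y]_w (expR (t * pairing z (incomplete w)))%:E =
   (expR (log_laplace r (fun k => sx s k.+1) y (- z) t))%:E)%E.
Proof.
move=> yP zZ p0; have yZ : ZG y by case: yP.
have [K K0 hK] := integral_wishart_env hs hsr.
have [Z Z0 [hZ hP]] := gamma_density yP.
have mw (y' : mx) := @measurable_wishart_env R n r s y'.
pose f (w : coords) := expR (t * pairing z (incomplete w)).
pose h (w : coords) := Z^-1 * wishart_env r s y (nth 0 w).
have f0 w : 0 <= f w by exact: expR_ge0.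
have h0 w : 0 <= h w by rewrite mulr_ge0 ?wishart_env_ge0// invr_ge0 ltW.
have mf : measurable_fun setT f.
  apply: measurableT_comp => //; apply: measurable_funM => //.
  exact: measurable_pairing.
have mh : measurable_fun setT h by apply: measurable_funM => //; exact: mw.
rewrite (ge0_integral_density f0 h0 mf mh hP).
transitivity (\int[leb]_w (Z^-1%:E * (wishart_env r s (line y (- z) t) (nth 0 w))%:E))%E.
  apply: eq_integral => w _; rewrite -EFinM; congr EFin.
  rewrite /f /h mulrCA; congr (_ * _).
  have [wQ|wQ] := pselect (QG (incomplete w : mx)); last by rewrite !wishart_env0// mulr0.
  rewrite !(wishart_env_QG r s wQ)//; last exact: line_ZG (ZG_opp zZ).
  have -> : expR (t * pairing z (incomplete w)) =
      expR (- (t * pairing (- z) (incomplete w))).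
    by rewrite /pairing mulNmx linearN/= mulrN opprK.
  rewrite /wishart_density pairing_lineE opprD expRD.
  move: (delta _ _ _) (phi _) => dl ph; ring.
rewrite ge0_integralZl//.
- rewrite hK// -EFinM expR_log_laplace//; congr EFin.
  have -> : Z = K * \prod_k piv r y k `^ (- sx s k.+1).
    by move: hZ; rewrite hK => [[->]//|k]; exact: PG_piv.
  have k0 : \prod_k piv r y k `^ (- sx s k.+1) != 0.
    by rewrite gt_eqF// prodr_gt0// => k _; rewrite powR_gt0// PG_piv.
  by field; rewrite k0 gt_eqF.
- by apply/measurable_EFinP; exact: mw.
- by move=> w _; rewrite lee_fin wishart_env_ge0.
- by rewrite lee_fin invr_ge0 ltW.
Qed.

End wishart_law.

Section wishart_moments.
Variables (R : realType) (n : nat) (r : 'I_n) (s : n.-tuple R).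
Local Notation mx := 'M[R]_n.
Local Notation par := (par r).
Local Notation desc := (desc r).
Local Notation coords := ((n + n.-1).-tuple (measurableTypeR R)).
Local Notation gam := (@gamma R n r.+1 s).
Local Notation sk := (fun k : 'I_n => sx s k.+1).
Hypothesis hs : forall i : 'I_n, i != r -> 1 / 2 < sx s i.+1.
Hypothesis hsr : 0 < sx s r.+1.

(** The strictly triangular part N of the factorisation y = (1 + N)^T D (1
    + N). *)
Definition coef (y : mx) : mx := tree_coef r y (piv r y).

Definition mean_cov (y : mx) : mx := cov (coef y) (fun k => sk k / piv r y k).

(** The second derivative of the logarithm of the Laplace integral, as a
    bilinear form. *)
Definition cov_form (y z z' : mx) : R :=
  \sum_k sk k * (pull (coef y) z k k * pull (coef y) z' k k / piv r y k ^+ 2 +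
    2 * (\sum_(j | desc j k && (j != k))
      pull (coef y) z j k * pull (coef y) z' j k / piv r y j) / piv r y k).

Lemma pullD (N z z' : mx) : pull N (z + z') = pull N z + pull N z'.
Proof. by rewrite /pull mulmxDr mulmxDl. Qed.

Lemma pullN (N z : mx) : pull N (- z) = - pull N z.
Proof. by rewrite /pull mulmxN mulNmx. Qed.

Lemma cov_formE (y z : mx) : information r sk y (- z) = cov_form y z z.
Proof.
rewrite /information /pull_line line0; apply: eq_bigr => k _; congr (_ * (_ + 2 * _ / _)).
  by rewrite pullN [(- pull (coef y) z) k k]mxE mulNr sqrrN expr_div_n expr2.
by apply: eq_bigr => j _; rewrite pullN [(- pull (coef y) z) j k]mxE sqrrN expr2.
Qed.

Lemma cov_formDD (y z z' : mx) : cov_form y (z + z') (z + z') =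
  cov_form y z z + 2 * cov_form y z z' + cov_form y z' z'.
Proof.
rewrite /cov_form mulr_sumr -!big_split/=; apply: eq_bigr => k _.
rewrite !pullD.
have -> : \sum_(j | desc j k && (j != k))
    (pull (coef y) z + pull (coef y) z') j k * (pull (coef y) z + pull (coef y) z') j k / piv r y j =
  \sum_(j | desc j k && (j != k)) pull (coef y) z j k * pull (coef y) z j k / piv r y j +
  2 * \sum_(j | desc j k && (j != k)) pull (coef y) z j k * pull (coef y) z' j k / piv r y j +
  \sum_(j | desc j k && (j != k)) pull (coef y) z' j k * pull (coef y) z' j k / piv r y j.
  by rewrite mulr_sumr -!big_split/=; apply: eq_bigr => j _; rewrite mxE; ring.
by rewrite mxE; ring.
Qed.

Lemma score_mean (y z : mx) : score r sk y (- z) 0 = pairing z (mean_cov y).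
Proof.
rewrite /score /mean_cov pairing_cov -sumrN; apply: eq_bigr => k _.
rewrite /pull_line line0 pullN [(- pull (coef y) z) k k]mxE.
by rewrite mulNr mulrN opprK mulrA mulrAC.
Qed.

Lemma wishart_moments (y z : mx) : PG y -> ZG z ->
  let f := fun w : coords => pairing z (incomplete w) in
  [/\ (gam y).-integrable [set: coords] (EFin \o f),
    (gam y).-integrable [set: coords] (EFin \o (fun w => f w ^+ 2)),
    (\int[gam y]_w (f w)%:E = (pairing z (mean_cov y))%:E)%E &
    (\int[gam y]_w (f w ^+ 2)%:E = (pairing z (mean_cov y) ^+ 2 + cov_form y z z)%:E)%E].
Proof.
move=> yP zZ f; have nzZ := ZG_opp zZ.
have [del del0 hdel] := laplace_radius r yP nzZ.
have mf : measurable_fun [set: coords] f by exact: measurable_pairing.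
have hF (t : R) (h : `|t| < 4 * del) := mgf_wishart hs hsr yP zZ (hdel t h).
have dF (t : R) (h : `|t| < 4 * del) := is_derive_laplace sk nzZ (hdel t h).
have [i1 i2 e1 e2] := mgf_moments del0 mf hF dF (is_derive_score r sk yP nzZ).
split=> //.
  rewrite e1 -score_mean; congr EFin.
  have -> : log_laplace r sk y (- z) 0 = 0.
    by rewrite /log_laplace line0 big1 ?oppr0// => k _; rewrite subrr mulr0.
  by rewrite expR0 mul1r.
by rewrite e2 score_mean cov_formE.
Qed.

Lemma pairingD (z z' A : mx) : pairing (z + z') A = pairing z A + pairing z' A.
Proof. by rewrite /pairing mulmxDl linearD. Qed.

Lemma pairingZ (a : R) (z A : mx) : pairing (a *: z) A = a * pairing z A.
Proof. by rewrite /pairing -scalemxAl linearZ. Qed.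

Lemma pairing_delta (i j : 'I_n) (A : mx) : pairing (delta_mx i j) A = A j i.
Proof.
rewrite /pairing /mxtrace (bigD1 i)//= big1 ?addr0 => [|k ki].
  rewrite mxE (bigD1 j)//= big1 ?addr0 => [|l lj]; first by rewrite mxE !eqxx mul1r.
  by rewrite mxE (negbTE lj) andbF mul0r.
by rewrite mxE big1// => l _; rewrite mxE (negbTE ki) mul0r.
Qed.

Lemma ZGD (z z' : mx) : ZG z -> ZG z' -> ZG (z + z').
Proof.
move=> [zs zz] [zs' zz']; split; first by rewrite linearD/= zs zs'.
by move=> i j ij; rewrite mxE zz// zz'// addr0.
Qed.

(** The entry at an edge (i, j) is the pairing with the symmetrised
    elementary matrix, which lies in Z_G. *)
Lemma mean_wishart (y : mx) : PG y -> mean r.+1 s y = piG (mean_cov y).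
Proof.
move=> yP; apply/matrixP => i j; rewrite [LHS]mxE [RHS]mxE; case: ifPn => ij.
  pose z : mx := 2^-1 *: (delta_mx i j + delta_mx j i).
  have zE (A : mx) : A^T = A -> pairing z A = A i j.
    move=> As; rewrite /z pairingZ pairingD !pairing_delta.
    have -> : A j i = A i j by rewrite -[in LHS]As mxE.
    by field.
  have zZ : ZG z.
    split; first by rewrite /z linearZ linearD/= !trmx_delta addrC.
    move=> a b ab; rewrite !mxE.
    have [aE|] := eqVneq a i; have [bE|] := eqVneq b j;
      have [aE'|] := eqVneq a j; have [bE'|] := eqVneq b i;
      rewrite ?andbF ?addr0 ?mulr0//.
    all: try by move: ab; rewrite ?aE ?bE ij.
    all: try by move: ab; rewrite ?aE' ?bE' edge_sym ij.
  have [_ _ e _] := wishart_moments yP zZ.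
  rewrite unlock; have -> : (\int[gam y]_w ((incomplete w : mx) i j)%:E =
      \int[gam y]_w (pairing z (incomplete w))%:E)%E.
    by apply: eq_integral => w _; rewrite zE//; case: (incomplete_ZG r w).
  by rewrite e/= zE// /mean_cov cov_sym.
have i0 w : (incomplete w : mx) i j = 0.
  by have [_ h] := incomplete_ZG r w; exact: h.
by rewrite unlock; under eq_integral do rewrite i0; rewrite integral0.
Qed.

(** Polarisation of the second moments. *)
Lemma covariance_wishart (y z z' : mx) : PG y -> ZG z -> ZG z' ->
  covariance (gam y) (fun t : coords => pairing z (incomplete t))
    (fun t : coords => pairing z' (incomplete t)) = (cov_form y z z')%:E.
Proof.
move=> yP zZ zZ'.
have [i1 i2 e1 e2] := wishart_moments yP zZ.
have [i1' i2' e1' e2'] := wishart_moments yP zZ'.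
have [_ i2s _ e2s] := wishart_moments yP (ZGD zZ zZ').
set f := (fun t : coords => pairing z (incomplete t)) in i1 i2 e1 e2 *.
set f' := (fun t : coords => pairing z' (incomplete t)) in i1' i2' e1' e2' *.
(* The mixed moment through the squares of the three pairings. *)
have prodE : (fun w => (f w * f' w)%:E) = (fun w => (2^-1)%:E *
   ((pairing (z + z') (incomplete w) ^+ 2)%:E - (f w ^+ 2)%:E - (f' w ^+ 2)%:E))%E.
  apply/funext => w; rewrite -!EFinB -EFinM; congr EFin.
  by rewrite pairingD -/(f w) -/(f' w); field.
have iB1 := integrableB measurableT i2s i2.
have iB := integrableB measurableT iB1 i2'.
have ip : (gam y).-integrable [set: coords] (EFin \o (fun w => f w * f' w)).
  by rewrite /comp prodE; apply: integrableZl.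
rewrite covarianceE; [|exact/Lfun1_integrable|exact/Lfun1_integrable|exact/Lfun1_integrable].
rewrite unlock e1 e1'.
have -> : (\int[gam y]_w ((f * f') w)%:E = (2^-1 * (
   (pairing (z + z') (mean_cov y) ^+ 2 + cov_form y (z + z') (z + z'))
   - (pairing z (mean_cov y) ^+ 2 + cov_form y z z)
   - (pairing z' (mean_cov y) ^+ 2 + cov_form y z' z')))%:E)%E.
  transitivity (\int[gam y]_w (f w * f' w)%:E)%E; first by [].
  rewrite prodE integralZl//.
  by rewrite integralB// integralB// e2s e2 e2' -!EFinB -EFinM.
by rewrite -EFinM -EFinB; congr EFin; rewrite pairingD cov_formDD; field.
Qed.

End wishart_moments.

(** * The matrices M_I *)

Section principal_blocks.
Variables (R : realType) (n : nat) (r : 'I_n).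
Local Notation mx := 'M[R]_n.
Local Notation desc := (desc r).

Lemma psub_mul (I : {set 'I_n}) (A B : mx) :
  (forall i k, k \notin I -> A i k = 0) -> psub I (A *m B) = psub I A *m psub I B.
Proof.
move=> A0; apply/matrixP => a b; rewrite [LHS]mxE !mxE.
rewrite (bigID (fun k => k \in I))/= [X in _ + X]big1 ?addr0; last first.
  by move=> k kI; rewrite A0// mul0r.
by rewrite big_enum_val; apply: eq_bigr => c _; rewrite !mxE.
Qed.

Lemma zext_psub (I : {set 'I_n}) (A : mx) :
  (forall i k, k \notin I -> A i k = 0) -> (forall i k, i \notin I -> A i k = 0) ->
  zext (psub I A) = A.
Proof.
move=> A0 A0'; apply/matrixP => i j; rewrite mxE.
have enum1 (F : 'I_n -> R) k : \sum_(b < #|I| | enum_val b == k) F (enum_val b) =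
    if k \in I then F k else 0.
  rewrite -(big_enum_val_cond (fun b => b == k) F).
  case: ifPn => kI; last first.
    by rewrite big_pred0// => b; apply/negbTE/andP => -[bI /eqP bk]; rewrite -bk bI in kI.
  rewrite (eq_bigl (pred1 k)) ?big_pred1_eq// => b /=.
  by case: eqP => [->|]; rewrite ?kI ?andbF.
under eq_bigr => a _ do under eq_bigr => b _ do rewrite mxE.
under eq_bigr => a _ do rewrite (enum1 (fun b => A (enum_val a) b)).
rewrite (enum1 (fun a => if j \in I then A a j else 0)).
by case: ifPn => iI; [case: ifPn => // jI; rewrite A0|rewrite A0'].
Qed.

Variables (N : mx) (D : 'I_n -> R).
Hypotheses (Ns : par_supp r N) (D0 : forall i, 0 < D i).

(** If I is closed under descendants, the rows of U that meet the columns
    in I are themselves in I, so the factorisation of the concentration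
    matrix restricts to the block I. *)
Lemma block_cov (I : {set 'I_n}) :
  (forall i k, k \in I -> desc i k -> i \in I) ->
  zext (invmx (psub I (conc N D))) =
  cov N (fun k => if k \in I then (D k)^-1 else 0).
Proof.
move=> Icl; set Z := cov _ _.
have Zr i k : i \notin I -> Z i k = 0.
  move=> iI; rewrite /Z /cov mxE big1// => l _.
  rewrite mulmx_dgm; case: ifPn => lI; last by rewrite mulr0 mul0r.
  rewrite (unV_desc Ns) ?mul0r//; apply: contra iI; exact: Icl.
have Zc i k : k \notin I -> Z i k = 0.
  by move=> kI; rewrite -[Z](cov_sym N) mxE Zr.
have ZK i j : j \in I -> (Z *m conc N D) i j = (1%:M : mx) i j.
  move=> jI; rewrite /Z (cov_conc Ns) -(unVK Ns) [LHS]mxE [RHS]mxE.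
  apply: eq_bigr => k _; rewrite mulmx_dgm -mulrA; congr (_ * _).
  case: ifPn => kI; first by rewrite mulVf ?mul1r// gt_eqF.
  rewrite !mul0r /uni mxE [1%:M _ _]mxE Ns.
    by rewrite addr0; case: eqP => // kj; rewrite kj jI in kI.
  by apply: contra kI => /par_desc; exact: Icl.
have PZK : psub I Z *m psub I (conc N D) = 1%:M.
  rewrite -psub_mul//; apply/matrixP => a b.
  by rewrite mxE ZK ?enum_valP// !mxE (inj_eq enum_val_inj).
have [_ Ku] := mulmx1_unit PZK.
have -> : invmx (psub I (conc N D)) = psub I Z.
  by rewrite -[RHS]mulmx1 -(mulmxV Ku) mulmxA PZK mul1mx.
exact: zext_psub.
Qed.

End principal_blocks.

Section cov_linear.
Variables (R : realType) (n : nat) (N : 'M[R]_n).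

Lemma covEsum (f : 'I_n -> R) i j : cov N f i j = \sum_k f k * (unV N i k * unV N j k).
Proof.
rewrite /cov mxE; apply: eq_bigr => k _.
by rewrite mulmx_dgm [_^T _ _]mxE; ring.
Qed.

Lemma cov_add f g : cov N f + cov N g = cov N (fun k => f k + g k).
Proof.
apply/matrixP => i j; rewrite mxE !covEsum -big_split/=.
by apply: eq_bigr => k _; rewrite mulrDl.
Qed.

Lemma cov_scale a f : a *: cov N f = cov N (fun k => a * f k).
Proof.
apply/matrixP => i j; rewrite mxE !covEsum mulr_sumr.
by apply: eq_bigr => k _; rewrite mulrA.
Qed.

Lemma cov_sum (a b : nat) (c : nat -> R) (f : nat -> 'I_n -> R) :
  \sum_(a <= j < b) c j *: cov N (f j) =
  cov N (fun k => \sum_(a <= j < b) c j * f j k).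
Proof.
apply/matrixP => i j; rewrite summxE covEsum.
under [RHS]eq_bigr do rewrite mulr_suml.
rewrite exchange_big/=; apply: eq_bigr => l _.
by rewrite mxE covEsum mulr_sumr; apply: eq_bigr => k _; rewrite mulrA.
Qed.

Lemma eq_cov f g : f =1 g -> cov N f = cov N g.
Proof. by move=> /funext ->. Qed.

End cov_linear.

(** * Telescoping the coefficients *)

Section telescopes.
Variables (R : realType) (g : nat -> R).

(** The blocks {1:j} that contain the vertex k are those with j > k; their
    coefficients telescope from k + 1 to i. *)
Lemma telescope_above k i : (0 < i)%N ->
  \sum_(1 <= j < i) (g j - g j.+1) * (k < j)%:R + g i * (k < i)%:R =
  g k.+1 * (k < i)%:R.
Proof.
case: i => // i _; elim: i => [|i IH].
  by rewrite big_geq// add0r; case: k => [|k]//=; rewrite !mulr0.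
rewrite big_nat_recr//=; have [ki|ki|kE] := ltngtP k i.+1.
- move: IH; rewrite ki (ltn_trans ki)// !mulr1 => <-; ring.
- move: IH; rewrite ltnNge (ltnW ki)/= !mulr0 addr0 => ->.
  have -> : (k < i.+2)%N = false by lia.
  by rewrite !mulr0 !addr0.
- move: IH; rewrite kE ltnSn ltnn !mulr1 !mulr0 addr0 => ->; ring.
Qed.

(** Mirror image of [telescope_above] for the blocks {j:n}, which contain
    the vertex labelled k when j <= k. *)
Lemma telescope_below k i b : (i < b)%N ->
  \sum_(i.+1 <= j < b) (g j - g j.-1) * (j <= k)%:R + g i * (i <= k)%:R =
  g (minn b.-1 k) * (i <= k)%:R.
Proof.
move=> ib; have {ib} [m ->] : exists m, b = (i.+1 + m)%N by exists (b - i.+1)%N; lia.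
elim: m => [|m IH].
  rewrite addn0 big_geq// add0r /=; case: leqP => ik; last by rewrite !mulr0.
  by congr (g _ * _); lia.
rewrite addnS big_nat_recr ?leq_addr//= addrAC IH.
have [ik|ik] := leqP i k; last first.
  have -> : (i.+1 + m <= k)%N = false by lia.
  by rewrite !mulr0 addr0.
rewrite !mulr1; have [mk|mk] := leqP (i.+1 + m)%N k.
  have -> : minn (i.+1 + m).-1 k = (i.+1 + m).-1 by lia.
  by rewrite mulr1 addrC subrK.
rewrite mulr0 addr0; congr g; lia.
Qed.

End telescopes.

Section variance_formula.
Variables (R : realType) (n : nat) (r : 'I_n) (s : n.-tuple R).
Local Notation mx := 'M[R]_n.
Local Notation par := (par r).
Local Notation desc := (desc r).
Local Notation sk := (fun k : 'I_n => sx s k.+1).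
Hypothesis hs : forall i : 'I_n, i != r -> 1 / 2 < sx s i.+1.
Hypothesis hsr : 0 < sx s r.+1.

Let sk0 (k : 'I_n) : 0 < sx s k.+1.
Proof.
have [->//|kr] := eqVneq k r; apply: lt_trans (hs kr).
by rewrite divr_gt0.
Qed.

(** The completion of m by regression has residual variances a_k; a point
    with pivots s_k / a_k and the same triangular part has it as mean. *)
Lemma mean_surjective (m : mx) : QG m -> exists2 y, PG y & mean r.+1 s y = m.
Proof.
move=> /(QG_tree_pos r)[mZ tm].
have a0 := fun i => reg_var_gt0 i tm.
(* The pivots for which the mean has residual variances reg_var r m. *)
pose D i := sk i / reg_var r m i.
have D0 i : 0 < D i by rewrite divr_gt0.
have Ns := @reg_coef_supp _ _ r m.
have yP := conc_PG Ns D0; set y := conc _ _ in yP.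
have [yD yN] := conc_pivots Ns (fun i => lt0r_neq0 (D0 i)).
have pE : piv r y = D by apply/funext => i; rewrite -(pivots_uniq yD).
exists y => //; rewrite mean_wishart// /mean_cov /coef pE yN.
rewrite (_ : cov _ _ = completion r m) ?piG_completion ?piG_id//.
apply: eq_cov => i; rewrite /D invf_div mulrC divfK//.
by rewrite gt_eqF.
Qed.

Section at_point.
Variables (y : mx).
Hypothesis yP : PG y.
Local Notation N := (coef r y).
Local Notation d := (piv r y).
Local Notation m := (piG (mean_cov r s y)).

Let Ns : par_supp r N. Proof. exact: tree_coef_supp. Qed.
Let d0 k : 0 < d k. Proof. exact: PG_piv. Qed.

Let D0 k : 0 < d k / sx s k.+1. Proof. by rewrite divr_gt0. Qed.

Let mean_covE : mean_cov r s y = cov N (fun k => (d k / sx s k.+1)^-1).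
Proof. by apply: eq_cov => k; rewrite invf_div. Qed.

(** The mean already is the restriction to the edges of a positive definite
    matrix with inverse in P_G. *)
Lemma hat_mean : hat m = mean_cov r s y.
Proof. by rewrite mean_covE (hat_cov Ns D0). Qed.

Lemma Msub_left j : (j <= r)%N ->
  Msub m 1 j = cov N (fun k => (k < j)%:R * (sx s k.+1 / d k)).
Proof.
move=> jr; rewrite /Msub hat_mean mean_covE (invmx_cov Ns D0) (block_cov Ns D0).
  apply: eq_cov => k; rewrite inE invf_div ltnS /=.
  by case: ifP => _; rewrite ?mul1r ?mul0r.
by move=> i k; rewrite !inE !descE; lia.
Qed.

Lemma Msub_right j : (r.+2 <= j)%N ->
  Msub m j n = cov N (fun k => (j <= k.+1)%:R * (sx s k.+1 / d k)).
Proof.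
move=> jr; rewrite /Msub hat_mean mean_covE (invmx_cov Ns D0) (block_cov Ns D0).
  apply: eq_cov => k; rewrite inE invf_div (ltn_ord k) andbT.
  by case: ifP => _; rewrite ?mul1r ?mul0r.
by move=> i k; rewrite !inE !descE; have := ltn_ord i; lia.
Qed.

Let g j := (sx s j)^-1.

Let gsk (k : 'I_n) x : g k.+1 * x * (sx s k.+1 / d k) = x * (d k)^-1.
Proof. by rewrite /g; field; rewrite !gt_eqF. Qed.

Lemma left_block i : (1 <= i <= r)%N ->
  \sum_(1 <= j < i) ((sx s j)^-1 - (sx s j.+1)^-1) *: Msub m 1 j
    + (sx s i)^-1 *: Msub m 1 i = cov N (fun k => (k < i)%:R * (d k)^-1).
Proof.
move=> /andP[i1 ir]; rewrite Msub_left//.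
have -> : \sum_(1 <= j < i) ((sx s j)^-1 - (sx s j.+1)^-1) *: Msub m 1 j =
   \sum_(1 <= j < i) (g j - g j.+1) *: cov N (fun k => (k < j)%:R * (sx s k.+1 / d k)).
  by apply: eq_big_nat => j ji; rewrite Msub_left//; lia.
rewrite cov_sum cov_scale cov_add; apply: eq_cov => k.
rewrite -gsk -(telescope_above g k i1) mulrDl mulr_suml; congr (_ + _); last by rewrite /g !mulrA.
by apply: eq_bigr => j _; rewrite mulrA.
Qed.

Lemma right_block i : (r.+2 <= i <= n)%N ->
  (sx s i)^-1 *: Msub m i n
    + \sum_(i.+1 <= j < n.+1) ((sx s j)^-1 - (sx s j.-1)^-1) *: Msub m j n =
  cov N (fun k => (i <= k.+1)%:R * (d k)^-1).
Proof.
move=> /andP[ir i_n]; rewrite Msub_right//.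
have -> : \sum_(i.+1 <= j < n.+1) ((sx s j)^-1 - (sx s j.-1)^-1) *: Msub m j n =
   \sum_(i.+1 <= j < n.+1) (g j - g j.-1) *: cov N (fun k => (j <= k.+1)%:R * (sx s k.+1 / d k)).
  by apply: eq_big_nat => j ji; rewrite Msub_right//; lia.
rewrite cov_sum cov_scale cov_add; apply: eq_cov => k.
have ib : (i < n.+1)%N by [].
have mk : minn n.+1.-1 k.+1 = k.+1 by have := ltn_ord k; lia.
have := telescope_below g k.+1 ib; rewrite mk => tb.
rewrite -gsk -tb addrC mulrDl mulr_suml; congr (_ + _); last by rewrite /g !mulrA.
by apply: eq_bigr => j _; rewrite mulrA.
Qed.

Lemma middle_block :
  (sx s r.+1)^-1 *: hat m
    + \sum_(1 <= j < r.+1) ((sx s j)^-1 - (sx s j.+1)^-1) *: Msub m 1 j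
    + \sum_(r.+2 <= k < n.+1) ((sx s k)^-1 - (sx s k.-1)^-1) *: Msub m k n =
  cov N (fun k => (d k)^-1).
Proof.
rewrite hat_mean.
have -> : \sum_(1 <= j < r.+1) ((sx s j)^-1 - (sx s j.+1)^-1) *: Msub m 1 j =
   \sum_(1 <= j < r.+1) (g j - g j.+1) *: cov N (fun k => (k < j)%:R * (sx s k.+1 / d k)).
  by apply: eq_big_nat => j ji; rewrite Msub_left//; lia.
have -> : \sum_(r.+2 <= j < n.+1) ((sx s j)^-1 - (sx s j.-1)^-1) *: Msub m j n =
   \sum_(r.+2 <= j < n.+1) (g j - g j.-1) *: cov N (fun k => (j <= k.+1)%:R * (sx s k.+1 / d k)).
  by apply: eq_big_nat => j ji; rewrite Msub_right//; lia.
rewrite /mean_cov !cov_sum cov_scale !cov_add; apply: eq_cov => k.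
have rb : (r.+1 < n.+1)%N by rewrite ltnS.
have mk : minn n.+1.-1 k.+1 = k.+1 by have := ltn_ord k; lia.
have := telescope_below g k.+1 rb; rewrite mk => tb.
have ta := telescope_above g k (ltn0Sn r).
rewrite -[RHS]mul1r -gsk mulr1.
under eq_bigr do rewrite mulrA.
under [X in _ + X]eq_bigr do rewrite mulrA.
rewrite -!mulr_suml -!mulrDl; congr (_ * _).
move: ta tb; move: (\sum_(1 <= j < r.+1) _) (\sum_(r.+2 <= j < n.+1) _) => A B.
rewrite -/(g r.+1) !ltnS.
have [kr|kr|kr] := ltngtP k r.
- rewrite !mulr0 !mulr1 addr0 => <- ->.
  by rewrite addr0 addrC.
- rewrite !mulr0 !mulr1 addr0 => -> <-.
  by rewrite addr0 addrC.
- rewrite kr !mulr1 => ha hb.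
  have -> : A = 0 by apply: (addIr (g r.+1)); rewrite ha add0r.
  have -> : B = 0 by apply: (addIr (g r.+1)); rewrite hb add0r.
  by rewrite !addr0.
Qed.

End at_point.
End variance_formula.

(** * The covariance operator *)

Section covariance_operator.
Variables (R : realType) (n : nat) (r : 'I_n) (s : n.-tuple R).
Local Notation mx := 'M[R]_n.
Local Notation desc := (desc r).

Lemma pairing_quadP (N z u : mx) f : ZG z -> ZG u ->
  pairing z (quadP (cov N f) u) =
  \sum_k \sum_l f k * f l * (pull N u l k * pull N z l k).
Proof.
move=> zZ uZ; rewrite /quadP pairing_piG//.
have -> : pairing z (cov N f *m u *m cov N f) =
    \tr (pull N z *m dgm f *m (pull N u *m dgm f)).
  rewrite /pairing /cov /pull !mulmxA mxtrace_mulC !mulmxA.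
  by [].
rewrite /mxtrace; apply: eq_bigr => k _; rewrite mxE; apply: eq_bigr => l _.
rewrite !mulmx_dgm (pullC N zZ k l); ring.
Qed.

Lemma quadP_ZG (A u : mx) : A^T = A -> ZG u -> ZG (quadP A u).
Proof.
move=> As [us _]; split; last by move=> i j ij; rewrite mxE (negbTE ij).
have Bs : (A *m u *m A)^T = A *m u *m A by rewrite !trmx_mul us As mulmxA.
apply/matrixP => i j; rewrite mxE [LHS]mxE [RHS]mxE edge_sym.
by rewrite -[in LHS]Bs [in LHS]mxE.
Qed.

Lemma ZGZ (a : R) (z : mx) : ZG z -> ZG (a *: z).
Proof.
move=> [zs zz]; split; first by rewrite linearZ/= zs.
by move=> i j ij; rewrite mxE zz// mulr0.
Qed.

Lemma ZG_sum a b (c : nat -> R) (F : nat -> mx) :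
  (forall i, (a <= i < b)%N -> ZG (F i)) -> ZG (\sum_(a <= i < b) c i *: F i).
Proof.
move=> FZ; rewrite big_nat; apply: big_ind => [|x y|i /FZ]; last exact: ZGZ.
  by split; [rewrite trmx0|move=> i j _; rewrite mxE].
exact: ZGD.
Qed.

Lemma pairing_sum (z : mx) a b (c : nat -> R) (F : nat -> mx) :
  pairing z (\sum_(a <= i < b) c i *: F i) = \sum_(a <= i < b) c i * pairing z (F i).
Proof.
rewrite /pairing mulmx_sumr linear_sum; apply: eq_bigr => i _.
by rewrite -scalemxAr linearZ.
Qed.

Lemma ZG_nondegenerate (w w' : mx) : ZG w -> ZG w' ->
  (forall z, ZG z -> pairing z w = pairing z w') -> w = w'.
Proof.
move=> wZ wZ' h.
suff pz (z : mx) : ZG z -> pairing z z = 0 -> z = 0.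
  have zZ : ZG (w - w') by apply: ZGD => //; exact: ZG_opp.
  apply/eqP; rewrite -subr_eq0; apply/eqP; apply: pz => //.
  have pB : pairing (w - w') (w - w') = pairing (w - w') w - pairing (w - w') w'.
    by rewrite /pairing mulmxBr linearB.
  by rewrite pB (h _ zZ) subrr.
move=> [zs _].
have sq i j : z i j * z j i = z i j ^+ 2 by rewrite -[in z j i]zs mxE expr2.
rewrite /pairing /mxtrace => /eqP; rewrite psumr_eq0.
  move=> /allP hi; apply/matrixP => i j; apply/eqP.
  have := hi i (mem_index_enum _); rewrite mxE psumr_eq0.
    move=> /allP /(_ j (mem_index_enum _)).
    by rewrite sq sqrf_eq0 [(0 : mx) _ _]mxE.
  by move=> l _; rewrite sq sqr_ge0.
by move=> i _; rewrite mxE sumr_ge0// => l _; rewrite sq sqr_ge0.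
Qed.

(** Brings the double sum produced by [quadP] to the shape of [cov_form]:
    by symmetry each comparable pair is counted twice. *)
Lemma comparable_sum (G : 'I_n -> 'I_n -> R) :
  (forall k l, G k l = G l k) ->
  (forall k l, ~~ desc k l -> ~~ desc l k -> G k l = 0) ->
  \sum_k \sum_l G k l = \sum_k (G k k + 2 * \sum_(j | desc j k && (j != k)) G k j).
Proof.
move=> Gs G0.
have rowE k : \sum_l G k l = G k k + \sum_(j | desc j k && (j != k)) G k j +
    \sum_(j | desc k j && (j != k)) G k j.
  rewrite (bigD1 k)//= -addrA; congr (_ + _).
  rewrite (bigID (fun j => desc j k))/=; congr (_ + _).
    by apply: eq_bigl => j; rewrite andbC.
  rewrite (bigID (fun j => desc k j))/= [X in _ + X]big1 ?addr0.
    apply: eq_bigl => j; have [_|jk] := eqVneq j k; rewrite ?andbF//= ?andbT.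
    have [kj|_] := boolP (desc k j); rewrite ?andbF//= ?andbT.
    by apply: contra jk => h; apply/eqP; exact: desc_anti h kj.
  by move=> j /andP[/andP[_ jk] kj]; exact: G0.
under eq_bigr do rewrite rowE.
rewrite !big_split/=.
have -> : \sum_k \sum_(j | desc k j && (j != k)) G k j =
    \sum_k \sum_(j | desc j k && (j != k)) G k j.
  rewrite (exchange_big_dep xpredT)//=; apply: eq_bigr => j _.
  by apply: eq_big => [k|k _]; [rewrite eq_sym|exact: Gs].
rewrite -addrA; congr (_ + _); rewrite -mulr_sumr; ring.
Qed.

Lemma sum_threshold_left (x y : nat) (g : nat -> R) b : (x < b)%N -> (y <= x)%N ->
  \sum_(1 <= i < b) (g i - g i.+1) * ((x < i)%:R * (y < i)%:R) = g x.+1 - g b.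
Proof.
move=> xb yx; have {xb} [m ->] : exists m, b = (x.+1 + m)%N by exists (b - x.+1)%N; lia.
elim: m => [|m IH].
  rewrite addn0 subrr big_nat big1// => i /andP[_ ix].
  by rewrite ltnNge -ltnS ix /= mul0r mulr0.
rewrite addnS big_nat_recr ?addSn//= -addSn IH.
have -> : (x < x.+1 + m)%N by lia.
have -> : (y < x.+1 + m)%N by lia.
by rewrite !mulr1 addrA subrK.
Qed.

Lemma sum_threshold_right (x y : nat) (g : nat -> R) a b : (a <= x < b)%N -> (x <= y)%N ->
  \sum_(a.+1 <= i < b) (g i - g i.-1) * ((i <= x)%:R * (i <= y)%:R) = g x - g a.
Proof.
move=> /andP[ax xb] xy.
have xb' : (x.+1 <= b)%N by [].
have tail0 : \sum_(x.+1 <= i < b) (g i - g i.-1) * ((i <= x)%:R * (i <= y)%:R) = 0.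
  rewrite big_nat big1// => i /andP[xi _].
  by rewrite leqNgt xi /= mul0r mulr0.
rewrite (@big_cat_nat _ _ _ x.+1)//= ?ltnS// tail0 addr0.
rewrite -(@telescope_sumr _ a x)// big_add1/=.
rewrite !big_nat; apply: eq_bigr => i /andP[_ ix].
have -> : (i.+1 <= y)%N by exact: leq_trans ix xy.
by rewrite ix !mulr1.
Qed.

Hypothesis hs : forall i : 'I_n, i != r -> 1 / 2 < sx s i.+1.
Hypothesis hsr : 0 < sx s r.+1.

(** For comparable vertices, exactly the blocks that contain the one closer
    to the root contain both, and the coefficients of these blocks
    telescope to the parameter of that vertex. *)
Lemma covop_wishart (y u : mx) : PG y -> ZG u ->
  covop r.+1 s y u =
  \sum_(1 <= i < r.+1) (sx s i - sx s i.+1) *: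
      quadP (cov (coef r y) (fun k => (k < i)%:R * (piv r y k)^-1)) u
  + sx s r.+1 *: quadP (cov (coef r y) (fun k => (piv r y k)^-1)) u
  + \sum_(r.+2 <= i < n.+1) (sx s i - sx s i.-1) *:
      quadP (cov (coef r y) (fun k => (i <= k.+1)%:R * (piv r y k)^-1)) u.
Proof.
move=> yP uZ; set N := coef r y; set d := piv r y.
have Ns : par_supp r N by exact: tree_coef_supp.
set w := (X in _ = X).
have quadZ f : ZG (quadP (cov N f) u) by apply: quadP_ZG => //; exact: cov_sym.
have wZ : ZG w.
  apply: ZGD; first apply: ZGD; [|exact: ZGZ|].
    exact: (ZG_sum (fun i => sx s i - sx s i.+1)).
  exact: (ZG_sum (fun i => sx s i - sx s i.-1)).
have wE z : ZG z -> pairing z w = cov_form r s y u z.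
  move=> zZ; pose W k l := pull N u l k * pull N z l k * ((d k)^-1 * (d l)^-1).
  (* The total coefficient of the pair (k, l) in the three families of
     blocks. *)
  pose C (k l : 'I_n) : R := \sum_(1 <= i < r.+1) (sx s i - sx s i.+1) * ((k < i)%:R * (l < i)%:R)
    + sx s r.+1
    + \sum_(r.+2 <= i < n.+1) (sx s i - sx s i.-1) * ((i <= k.+1)%:R * (i <= l.+1)%:R).
  have pE f : pairing z (quadP (cov N (fun k => f k * (d k)^-1)) u) =
      \sum_k \sum_l W k l * (f k * f l).
    rewrite pairing_quadP//; apply: eq_bigr => k _; apply: eq_bigr => l _.
    by rewrite /W; ring.
  have -> : pairing z w = \sum_k \sum_l W k l * C k l.
    have pD a b : pairing z (a + b) = pairing z a + pairing z b.
      by rewrite /pairing mulmxDr linearD.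
    have pZ a b : pairing z (a *: b) = a * pairing z b.
      by rewrite /pairing -scalemxAr linearZ.
    have dist (a b : nat) (c : nat -> R) (f : nat -> 'I_n -> R) :
      \sum_(a <= i < b) c i * pairing z (quadP (cov N (fun k => f i k * (d k)^-1)) u) =
      \sum_k \sum_l W k l * (\sum_(a <= i < b) c i * (f i k * f i l)).
      under eq_bigr do rewrite pE mulr_sumr.
      rewrite exchange_big/=; apply: eq_bigr => k _.
      under eq_bigr do rewrite mulr_sumr.
      rewrite exchange_big/=; apply: eq_bigr => l _.
      by rewrite mulr_sumr; apply: eq_bigr => i _; ring.
    rewrite /w !pD pZ.
    rewrite (pairing_sum _ _ _ (fun i => sx s i - sx s i.+1))
      (pairing_sum _ _ _ (fun i => sx s i - sx s i.-1)).
    rewrite (dist _ _ (fun i => sx s i - sx s i.+1) (fun i k => (k < i)%:R)).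
    rewrite (dist _ _ (fun i => sx s i - sx s i.-1) (fun i k => (i <= k.+1)%:R)).
    have -> : pairing z (quadP (cov N (fun k => (d k)^-1)) u) = \sum_k \sum_l W k l.
      rewrite pairing_quadP//; apply: eq_bigr => k _; apply: eq_bigr => l _.
      by rewrite /W; ring.
    rewrite mulr_sumr -!big_split/=; apply: eq_bigr => k _.
    rewrite mulr_sumr -!big_split/=; apply: eq_bigr => l _.
    by rewrite /C; ring.
  have CE j k : desc j k -> C k j = sx s k.+1.
    rewrite descE /C => /orP[/andP[jk kr]|/andP[rk kj]].
      rewrite (sum_threshold_left (sx s)) ?ltnS// subrK.
      rewrite [X in _ + X]big_nat big1 ?addr0// => i /andP[ri _].
      have -> : (i <= k.+1)%N = false by lia.
      by rewrite mul0r mulr0.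
    rewrite big_nat big1 ?add0r; last first.
      move=> i /andP[_ ir]; have -> : (k < i)%N = false by lia.
      by rewrite mul0r mulr0.
    rewrite (sum_threshold_right (sx s)) ?ltnS// ?rk//; last exact: ltn_ord.
    by rewrite addrC subrK.
  rewrite comparable_sum.
  - rewrite /cov_form; apply: eq_bigr => k _; rewrite [RHS]mulrDr; congr (_ + _).
      rewrite CE ?desc_refl// /W -/d -/N expr2 invfM; ring.
    rewrite -[in RHS]mulrA [RHS]mulrCA; congr (2 * _).
    rewrite mulr_suml mulr_sumr; apply: eq_bigr => j /andP[jk _].
    by rewrite CE// /W -/d -/N; ring.
  - move=> k l; rewrite /W /C (pullC N uZ l k) (pullC N zZ l k) [(d l)^-1 * _]mulrC.
    congr (_ * (_ + _ + _)); apply: eq_bigr => i _; congr (_ * _); exact: mulrC.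
  - move=> k l kl lk; rewrite /W (pull_incomparable Ns uZ lk kl); ring.
rewrite /covop; apply: xget_unique.
  split=> // z zZ; rewrite (covariance_wishart hs hsr yP uZ zZ) wE//.
move=> w' [w'Z hw']; apply: ZG_nondegenerate => // z zZ.
have := hw' z zZ; rewrite (covariance_wishart hs hsr yP uZ zZ) => -[->].
by rewrite wE.
Qed.

End covariance_operator.

Theorem proposition9 (R : realType) (n M : nat) (s : n.-tuple R)
    (hn : (1 <= n)%N) (hM : (1 <= M <= n)%N)
    (hs : forall i : nat, (1 <= i <= n)%N -> i <> M -> 1 / 2 < sx s i)
    (hsM : 0 < sx s M)
    (m : 'M[R]_n) (hm : QG m) (u : 'M[R]_n) (hu : ZG u) :
  variance_function M s m u =
    \sum_(1 <= i < M) (sx s i - sx s i.+1) *: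
      quadP (\sum_(1 <= j < i) ((sx s j)^-1 - (sx s j.+1)^-1) *: Msub m 1 j
             + (sx s i)^-1 *: Msub m 1 i) u
    + sx s M *:
      quadP ((sx s M)^-1 *: hat m
             + \sum_(1 <= j < M) ((sx s j)^-1 - (sx s j.+1)^-1) *: Msub m 1 j
             + \sum_(M.+1 <= k < n.+1)
                 ((sx s k)^-1 - (sx s k.-1)^-1) *: Msub m k n) u
    + \sum_(M.+1 <= i < n.+1) (sx s i - sx s i.-1) *:
      quadP ((sx s i)^-1 *: Msub m i n
             + \sum_(i.+1 <= j < n.+1)
                 ((sx s j)^-1 - (sx s j.-1)^-1) *: Msub m j n) u.
Proof.
have rn : (M.-1 < n)%N by lia.
pose r := Ordinal rn; have ME : M = r.+1 by rewrite /=; lia.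
have hs' (i : 'I_n) : i != r -> 1 / 2 < sx s i.+1.
  rewrite -val_eqE /= => ir; apply: hs; first by rewrite ltn_ord.
  by move=> iM; lia.
have hsr : 0 < sx s r.+1 by rewrite -ME.
rewrite /variance_function ME.
have [yP my] : PG (psi r.+1 s m) /\ mean r.+1 s (psi r.+1 s m) = m.
  rewrite /psi; case: xgetP => [y _ []//|none].
  by have [y yP my] := mean_surjective hs' hsr hm; case: (none y).
move: (psi r.+1 s m) yP my => y yP my.
rewrite (covop_wishart hs' hsr yP hu).
have mE : m = piG (mean_cov r s y) by rewrite -my mean_wishart.
rewrite mE (middle_block hs' hsr yP); congr (_ + _ + _).
  by apply: eq_big_nat => i i1r; rewrite (left_block hs' hsr yP).
by apply: eq_big_nat => i i1r; rewrite (right_block hs' hsr yP).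
Qed.
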